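(* Let $L$ be a lattice, $h_2=\frac14g_2(L)$, $h_3=\frac14g_3(L)$, let $m$ be a positive integer and $u\in\mathbb C\setminus L$ with $mu\in L$. Then $m\cdot\wp(u;L)$ is integral over the ring $\mathbb Z[h_2,h_3]$ (i.e. a root of a monic polynomial with coefficients in $\mathbb Z[h_2,h_3]$). If moreover $m$ is even, then $\frac m2\cdot\wp(u;L)$ is integral over $\mathbb Z[h_2,h_3]$.
   Context: For a lattice $L$: $g_2(L)=60\sum_{\omega\in L\setminus\{0\}}\omega^{-4}$, $g_3(L)=140\sum_{\omega\in L\setminus\{0\}}\omega^{-6}$, $\wp(z;L)=\frac1{z^2}+\sum_{\omega\in L\setminus\{0\}}\left(\frac1{(z-\omega)^2}-\frac1{\omega^2}\right)$. *)

(* Defs.v *)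
From Stdlib Require Import Reals ZArith List.
Open Scope R_scope.

Definition Cx := (R * R)%type.
Definition Cre (z : Cx) : R := fst z.
Definition Cim (z : Cx) : R := snd z.
Definition RtoC (r : R) : Cx := (r, 0).
Definition ZtoC (k : Z) : Cx := (IZR k, 0).
Definition C0 : Cx := (0, 0).
Definition C1 : Cx := (1, 0).
Definition Cadd (z w : Cx) : Cx := (fst z + fst w, snd z + snd w).
Definition Copp (z : Cx) : Cx := (- fst z, - snd z).
Definition Csub (z w : Cx) : Cx := Cadd z (Copp w).
Definition Cmul (z w : Cx) : Cx :=
  (fst z * fst w - snd z * snd w, fst z * snd w + snd z * fst w).
Definition Cinv (z : Cx) : Cx :=
  (fst z / (fst z ^ 2 + snd z ^ 2), - snd z / (fst z ^ 2 + snd z ^ 2)).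
Definition Cdiv (z w : Cx) : Cx := Cmul z (Cinv w).
Fixpoint Cpow (z : Cx) (n : nat) : Cx :=
  match n with O => C1 | S k => Cmul z (Cpow z k) end.
Definition Cnorm (z : Cx) : R := sqrt (fst z ^ 2 + snd z ^ 2).

Definition Csum_list (l : list Cx) : Cx := fold_right Cadd C0 l.
Fixpoint Csum_nat (f : nat -> Cx) (n : nat) : Cx :=
  match n with O => C0 | S k => Cadd (Csum_nat f k) (f k) end.

Definition Cseq_cv (u : nat -> Cx) (l : Cx) : Prop :=
  forall eps : R, eps > 0 -> exists N : nat, forall n : nat, (n >= N)%nat ->
    Cnorm (Csub (u n) l) < eps.

Definition lattice_basis (w1 w2 : Cx) : Prop :=
  fst w1 * snd w2 - snd w1 * fst w2 <> 0.
Definition lat_pt (w1 w2 : Cx) (a b : Z) : Cx :=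
  Cadd (Cmul (ZtoC a) w1) (Cmul (ZtoC b) w2).
Definition in_lattice (w1 w2 : Cx) (z : Cx) : Prop :=
  exists a b : Z, z = lat_pt w1 w2 a b.

Definition Zrange (N : nat) : list Z :=
  map (fun k => (Z.of_nat k - Z.of_nat N)%Z) (seq 0 (2 * N + 1)).

Definition lat_partial_sum (w1 w2 : Cx) (f : Cx -> Cx) (N : nat) : Cx :=
  Csum_list (map (fun p => f (lat_pt w1 w2 (fst p) (snd p)))
    (filter (fun p => negb (Z.eqb (fst p) 0 && Z.eqb (snd p) 0))
       (list_prod (Zrange N) (Zrange N)))).

(* Lattice sums: all sums below are absolutely convergent, so their value is
   the limit of the square partial sums. *)
Definition is_g2 (w1 w2 : Cx) (g : Cx) : Prop :=
  Cseq_cv (fun N => Cmul (RtoC 60)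
     (lat_partial_sum w1 w2 (fun w => Cinv (Cpow w 4)) N)) g.
Definition is_g3 (w1 w2 : Cx) (g : Cx) : Prop :=
  Cseq_cv (fun N => Cmul (RtoC 140)
     (lat_partial_sum w1 w2 (fun w => Cinv (Cpow w 6)) N)) g.
Definition is_wp (w1 w2 : Cx) (z : Cx) (p : Cx) : Prop :=
  Cseq_cv (fun N => Cadd (Cinv (Cpow z 2))
     (lat_partial_sum w1 w2
        (fun w => Csub (Cinv (Cpow (Csub z w) 2)) (Cinv (Cpow w 2))) N)) p.

Definition in_Z_h2h3 (h2 h3 y : Cx) : Prop :=
  exists (d : nat) (c : nat -> nat -> Z),
    y = Csum_nat (fun i => Csum_nat (fun j =>
          Cmul (ZtoC (c i j)) (Cmul (Cpow h2 i) (Cpow h3 j))) d) d.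

Definition integral_over_Z_h2h3 (h2 h3 x : Cx) : Prop :=
  exists (n : nat) (coef : nat -> Cx),
    (forall i, in_Z_h2h3 h2 h3 (coef i)) /\
    Cadd (Cpow x n) (Csum_nat (fun i => Cmul (coef i) (Cpow x i)) n) = C0.

(* Main.v *)
(** Put x = wp, y = wp'/2, so that y^2 = x^3 - h2 x - h3, and let u have exact order
    m modulo L. The numbers W(1) = 1, W(2) = 2y, W(i+1) W(i-1) = W(i)^2 (x(u) - x(iu))
    satisfy the recurrences of the division polynomials, so W(m) is a polynomial in x(u)
    over Z[h2,h3] with leading coefficient m (for even m: 2y times one with leading
    coefficient m/2). Since x((m-1)u) = x(u), W(m) = 0; multiplying by a power of the
    leading coefficient makes the equation monic in m x(u), respectively (m/2) x(u).

    The recurrences follow from the addition theorem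
    (zeta(a) + zeta(b) - zeta(a+b))^2 = x(a) + x(b) + x(a+b) and its derivative, and
    that identity and the differential equation are instances of a Liouville theorem:
    a doubly periodic continuous function which vanishes at the origin, and is
    holomorphic wherever it does not vanish, is zero. Only second-order Taylor expansions
    with cubic remainder are needed for it, no complex integration. *)

From Coquelicot Require Import Coquelicot.
From Stdlib Require Import Reals ZArith Lra Lia Classical ClassicalEpsilon List.
Require Import Defs.
Open Scope R_scope.

Section Development.

Local Notation C := Complex.C.
Local Notation RtoC := Complex.RtoC.
Local Notation Cinv := Complex.Cinv.
Local Notation Cpow := Complex.Cpow.
Open Scope C_scope.

(** The terms of [W] are complex numbers attached to one point, and each is a quotient by an earlier
    one. All rests on W(n) being nonzero for 0 < n < m, hence on x(a) = x(b) only for a = b or a =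
    -b modulo L. The usual proof counts zeros and poles by residues. Here the addition theorem does
    it: any other coincidence forces y(a) = y(b) = 0, then x constant near a point, then a singular
    cubic, where the addition theorem contradicts the pole at the origin. Limits of chords give the
    tangent at u. A leading coefficient belongs to a presentation of a number as a polynomial in
    x(u), not to the number, so W(m) = 0 with leading coefficient m is an equation and no
    contradiction. The Liouville theorem asks for Taylor expansions only off the zeros. At a
    cancelled pole it is therefore enough that the function is O(h); no theorem on removable
    singularities is involved. The order n of u may be a proper divisor of m. If m is even and n is
    odd, the factor 1/2 is taken from m/n. *)

Lemma Cmod_minus_sym (x y : C) : Cmod (x - y) = Cmod (y - x).
Proof. rewrite <- Cmod_opp. f_equal. ring. Qed.

Lemma Cmod_minus_triangle (x y : C) : (Cmod (x - y) <= Cmod x + Cmod y)%R.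
Proof.
unfold Cminus. eapply Rle_trans. apply Cmod_triangle. rewrite Cmod_opp. lra.
Qed.

Lemma Cmod_triangle_inv (x y : C) : (Cmod x - Cmod y <= Cmod (x - y))%R.
Proof.
assert (H := Cmod_triangle (x - y) y).
replace (x - y + y) with x in H by ring. lra.
Qed.

Lemma Cmod_triangle_inv_plus (x y : C) : (Cmod x - Cmod y <= Cmod (x + y))%R.
Proof.
assert (H := Cmod_minus_triangle (x + y) y).
replace (x + y - y) with x in H by ring. lra.
Qed.

(** With 1/0 = 0 the index (0, 0) may stay in the sums over the lattice: the terms [(/ om a b) ^ n]
    with n > 0 vanish there. *)
Lemma Cinv_0 : Cinv 0 = 0.
Proof.
unfold Cinv, Rdiv; simpl. unfold Complex.RtoC. f_equal; ring.
Qed.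

Lemma Cmod_inv_le (x : C) (d : R) :
  (0 < d)%R -> (d <= Cmod x)%R -> (Cmod (/ x) <= / d)%R.
Proof.
intros Hd Hx. rewrite Cmod_inv by (apply Cmod_gt_0; lra).
apply Rinv_le_contravar; assumption.
Qed.

Lemma Cmod_le_sum (z : C) : (Cmod z <= Rabs (fst z) + Rabs (snd z))%R.
Proof.
destruct z as [x y]; simpl. unfold Cmod; simpl.
apply Rsqr_incr_0_var.
2: generalize (Rabs_pos x) (Rabs_pos y); lra.
rewrite Rsqr_sqrt by nra. unfold Rsqr.
generalize (Rabs_pos x) (Rabs_pos y) (pow2_abs x) (pow2_abs y).
simpl. intros. nra.
Qed.

Lemma Rabs_fst_le_Cmod (z : C) : (Rabs (fst z) <= Cmod z)%R.
Proof. eapply Rle_trans. apply Rmax_l. apply Rmax_Cmod. Qed.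

Lemma Rabs_snd_le_Cmod (z : C) : (Rabs (snd z) <= Cmod z)%R.
Proof. eapply Rle_trans. apply Rmax_r. apply Rmax_Cmod. Qed.

(** * Limits of complex sequences *)

Lemma Cseq_cv_const (c : C) : Cseq_cv (fun _ => c) c.
Proof.
intros eps He. exists 0%nat. intros _ _.
change (Cmod (c - c) < eps)%R. replace (c - c) with (RtoC 0) by ring.
rewrite Cmod_0. exact He.
Qed.

Lemma Cseq_cv_ext (u v : nat -> C) (l : C) :
  (forall n, u n = v n) -> Cseq_cv u l -> Cseq_cv v l.
Proof.
intros E H eps He. destruct (H eps He) as [N HN]. exists N. intros n Hn.
rewrite <- E. auto.
Qed.

Lemma Cseq_cv_plus (u v : nat -> C) (l l' : C) :
  Cseq_cv u l -> Cseq_cv v l' -> Cseq_cv (fun n => u n + v n) (l + l').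
Proof.
intros H1 H2 eps He.
destruct (H1 (eps / 2)%R) as [N1 H1']; [lra|].
destruct (H2 (eps / 2)%R) as [N2 H2']; [lra|].
exists (N1 + N2)%nat. intros n Hn.
specialize (H1' n ltac:(lia)). specialize (H2' n ltac:(lia)).
change (Cmod (u n - l) < eps / 2)%R in H1'.
change (Cmod (v n - l') < eps / 2)%R in H2'.
change (Cmod (u n + v n - (l + l')) < eps)%R.
replace (u n + v n - (l + l')) with ((u n - l) + (v n - l')) by ring.
assert (H := Cmod_triangle (u n - l) (v n - l')). lra.
Qed.

Lemma Cseq_cv_scal (c : C) (u : nat -> C) (l : C) :
  Cseq_cv u l -> Cseq_cv (fun n => c * u n) (c * l).
Proof.
intros H eps He.
assert (Hc := Cmod_ge_0 c).
assert (He' : (0 < eps / (Cmod c + 1))%R) by (apply Rdiv_lt_0_compat; lra).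
destruct (H _ He') as [N HN]. exists N. intros n Hn. specialize (HN n Hn).
change (Cmod (u n - l) < eps / (Cmod c + 1))%R in HN.
change (Cmod (c * u n - c * l) < eps)%R.
replace (c * u n - c * l) with (c * (u n - l)) by ring.
rewrite Cmod_mult.
apply Rlt_le_trans with ((Cmod c + 1) * (eps / (Cmod c + 1)))%R.
2: right; field; lra.
assert (Hu := Cmod_ge_0 (u n - l)).
apply Rle_lt_trans with ((Cmod c + 1) * Cmod (u n - l))%R; [nra|].
apply Rmult_lt_compat_l; lra.
Qed.

Lemma Cseq_cv_unique (u : nat -> C) (l l' : C) :
  Cseq_cv u l -> Cseq_cv u l' -> l = l'.
Proof.
intros H1 H2.
destruct (Ceq_dec l l') as [E|E]; [exact E|exfalso].
assert (Hp : (0 < Cmod (l - l'))%R).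
{ apply Cmod_gt_0. intro H. apply E. apply Ceq_minus. exact H. }
destruct (H1 (Cmod (l - l') / 2)%R) as [N1 H1']; [lra|].
destruct (H2 (Cmod (l - l') / 2)%R) as [N2 H2']; [lra|].
specialize (H1' (N1 + N2)%nat ltac:(lia)).
specialize (H2' (N1 + N2)%nat ltac:(lia)).
set (x := u (N1 + N2)%nat) in *.
change (Cmod (x - l) < Cmod (l - l') / 2)%R in H1'.
change (Cmod (x - l') < Cmod (l - l') / 2)%R in H2'.
assert (H := Cmod_minus_triangle (x - l') (x - l)).
replace (x - l' - (x - l)) with (l - l') in H by ring. lra.
Qed.

Lemma Cseq_cv_Cmod_le (u : nat -> C) (l : C) (B : R) :
  Cseq_cv u l -> (forall n, Cmod (u n) <= B)%R -> (Cmod l <= B)%R.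
Proof.
intros H HB. apply le_epsilon. intros eps He.
destruct (H eps He) as [N HN]. specialize (HN N (Nat.le_refl _)).
change (Cmod (u N - l) < eps)%R in HN.
assert (H1 := Cmod_minus_triangle (u N) (u N - l)).
replace (u N - (u N - l)) with l in H1 by ring.
specialize (HB N). lra.
Qed.

Lemma Cseq_cv_of_pair (u : nat -> C) (a b : R) :
  is_lim_seq (fun n => fst (u n)) a -> is_lim_seq (fun n => snd (u n)) b ->
  Cseq_cv u (a, b).
Proof.
intros Ha Hb eps He.
apply is_lim_seq_spec in Ha. apply is_lim_seq_spec in Hb.
assert (He2 : (0 < eps / 2)%R) by lra.
destruct (Ha (mkposreal _ He2)) as [N1 H1].
destruct (Hb (mkposreal _ He2)) as [N2 H2]. simpl in *.
exists (N1 + N2)%nat. intros n Hn.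
specialize (H1 n ltac:(lia)). specialize (H2 n ltac:(lia)).
change (Cmod (u n - (a, b)) < eps)%R.
eapply Rle_lt_trans. apply Cmod_le_sum. simpl.
unfold Rminus in *. lra.
Qed.

Lemma Cseq_cv_fst (u : nat -> C) (l : C) :
  Cseq_cv u l -> is_lim_seq (fun n => fst (u n)) (fst l).
Proof.
intros H. apply is_lim_seq_spec. intros eps.
destruct (H eps (cond_pos eps)) as [N HN]. exists N. intros n Hn.
eapply Rle_lt_trans. 2: apply (HN n Hn).
exact (Rabs_fst_le_Cmod (u n - l)).
Qed.

Lemma Cseq_cv_snd (u : nat -> C) (l : C) :
  Cseq_cv u l -> is_lim_seq (fun n => snd (u n)) (snd l).
Proof.
intros H. apply is_lim_seq_spec. intros eps.
destruct (H eps (cond_pos eps)) as [N HN]. exists N. intros n Hn.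
eapply Rle_lt_trans. 2: apply (HN n Hn).
exact (Rabs_snd_le_Cmod (u n - l)).
Qed.

(** A total function with a junk value when there is no limit, so that lattice sums can be written
    down before their convergence is known. *)
Definition Clim (u : nat -> C) : C :=
  (real (Lim_seq (fun n => fst (u n))), real (Lim_seq (fun n => snd (u n)))).

Lemma Clim_unique (u : nat -> C) (l : C) : Cseq_cv u l -> Clim u = l.
Proof.
intros H. unfold Clim.
rewrite (is_lim_seq_unique _ _ (Cseq_cv_fst _ _ H)).
rewrite (is_lim_seq_unique _ _ (Cseq_cv_snd _ _ H)).
destruct l; reflexivity.
Qed.

Lemma quadratic_step_constant_ge_0 (u : nat -> C) (K : R) :
  (forall n, Cmod (u (S n) - u n) <= K / (INR n + 2) ^ 2)%R -> (0 <= K)%R.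
Proof.
intros H. specialize (H 0%nat). simpl in H.
generalize (Cmod_ge_0 (u 1%nat - u 0%nat)). intro.
assert (0 <= K / ((0 + 2) * ((0 + 2) * 1)))%R by lra.
apply Rmult_le_reg_r with (/ ((0 + 2) * ((0 + 2) * 1)))%R; [lra|].
unfold Rdiv in H1. lra.
Qed.

(** Since 1/(n+2)^2 is at most 1/(n+1) - 1/(n+2), the steps telescope. The explicit bound serves
    twice: for the Cauchy property, and from index 0 for the size of the sum. *)
Lemma quadratic_step_dist (u : nat -> C) (K : R) :
  (forall n, Cmod (u (S n) - u n) <= K / (INR n + 2) ^ 2)%R ->
  forall n p, (Cmod (u (n + p)%nat - u n)
     <= K * (/ (INR n + 1) - / (INR (n + p) + 1)))%R.
Proof.
intros H n p.
assert (HK := quadratic_step_constant_ge_0 u K H).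
induction p as [|p IH].
- rewrite Nat.add_0_r. replace (u n - u n) with (RtoC 0) by ring.
  rewrite Cmod_0. lra.
- rewrite Nat.add_succ_r.
  replace (u (S (n + p)) - u n)
    with ((u (S (n + p)) - u (n + p)%nat) + (u (n + p)%nat - u n)) by ring.
  eapply Rle_trans. apply Cmod_triangle.
  specialize (H (n + p)%nat).
  rewrite S_INR. assert (Hp := pos_INR (n + p)). set (t := INR (n + p)) in *.
  assert (E : (K / (t + 2) ^ 2 <= K * (/ (t + 1) - / (t + 1 + 1)))%R).
  { unfold Rdiv. apply Rmult_le_compat_l; [exact HK|].
    replace (/ (t + 1) - / (t + 1 + 1))%R
      with (/ ((t + 1) * (t + 1 + 1)))%R by (field; lra).
    apply Rinv_le_contravar; nra. }
  lra.
Qed.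

Lemma quadratic_step_cv (u : nat -> C) (K : R) :
  (forall n, Cmod (u (S n) - u n) <= K / (INR n + 2) ^ 2)%R ->
  Cseq_cv u (Clim u).
Proof.
intros H.
assert (HK := quadratic_step_constant_ge_0 u K H).
assert (HC : forall eps : posreal, exists N : nat, forall n m : nat,
  (N <= n)%nat -> (N <= m)%nat -> (Cmod (u n - u m) < eps)%R).
{ intros eps.
  destruct (nfloor_ex (2 * K / eps)) as [N HN].
  { apply Rdiv_le_0_compat. lra. apply cond_pos. }
  exists N.
  assert (Hb : forall n, (N <= n)%nat -> (Cmod (u n - u N) <= K * / (INR N + 1))%R).
  { intros n Hn. replace n with (N + (n - N))%nat by lia.
    eapply Rle_trans. apply quadratic_step_dist. exact H.
    apply Rmult_le_compat_l; [exact HK|].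
    assert (0 < / (INR (N + (n - N)) + 1))%R.
    { apply Rinv_0_lt_compat. generalize (pos_INR (N + (n - N))). lra. }
    lra. }
  intros n m Hn Hm. replace (u n - u m) with ((u n - u N) - (u m - u N)) by ring.
  eapply Rle_lt_trans. apply Cmod_minus_triangle.
  generalize (Hb n Hn) (Hb m Hm). intros.
  assert (2 * (K * / (INR N + 1)) < eps)%R; [|lra].
  assert (Hp := pos_INR N). assert (He := cond_pos eps).
  apply Rmult_lt_reg_r with (INR N + 1)%R; [lra|].
  replace (2 * (K * / (INR N + 1)) * (INR N + 1))%R with (2 * K / eps * eps)%R by (field; lra).
  nra. }
unfold Clim.
apply Cseq_cv_of_pair.
- apply Lim_seq_correct'. apply ex_lim_seq_cauchy_corr. intros eps.
  destruct (HC eps) as [N HN]. exists N. intros n m Hn Hm.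
  eapply Rle_lt_trans. 2: apply (HN n m Hn Hm).
  exact (Rabs_fst_le_Cmod (u n - u m)).
- apply Lim_seq_correct'. apply ex_lim_seq_cauchy_corr. intros eps.
  destruct (HC eps) as [N HN]. exists N. intros n m Hn Hm.
  eapply Rle_lt_trans. 2: apply (HN n m Hn Hm).
  exact (Rabs_snd_le_Cmod (u n - u m)).
Qed.

(** * Sums over square boxes *)

Fixpoint sum_sym (g : Z -> C) (N : nat) : C :=
  match N with
  | O => g 0%Z
  | S n => sum_sym g n + g (Z.of_nat N) + g (- Z.of_nat N)%Z
  end.

Definition box_sum (f : Z -> Z -> C) (N : nat) : C :=
  sum_sym (fun a => sum_sym (f a) N) N.

Lemma sum_sym_ext (g h : Z -> C) (N : nat) :
  (forall k, (Z.abs k <= Z.of_nat N)%Z -> g k = h k) -> sum_sym g N = sum_sym h N.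
Proof.
induction N as [|N IH]; intros H.
- simpl. apply H. simpl. lia.
- cbn [sum_sym]. rewrite IH by (intros; apply H; lia).
  rewrite !H by lia. reflexivity.
Qed.

Lemma sum_sym_plus (g h : Z -> C) (N : nat) :
  sum_sym (fun k => g k + h k) N = sum_sym g N + sum_sym h N.
Proof.
induction N as [|N IH]; [reflexivity|]. cbn [sum_sym]. rewrite IH. ring.
Qed.

Lemma sum_sym_scal (c : C) (g : Z -> C) (N : nat) :
  sum_sym (fun k => c * g k) N = c * sum_sym g N.
Proof.
induction N as [|N IH]; [reflexivity|]. cbn [sum_sym]. rewrite IH. ring.
Qed.

Lemma sum_sym_opp_index (g : Z -> C) (N : nat) :
  sum_sym (fun k => g (- k)%Z) N = sum_sym g N.
Proof.
induction N as [|N IH]; [reflexivity|]. cbn [sum_sym]. rewrite IH.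
rewrite Z.opp_involutive. ring.
Qed.

Lemma sum_sym_telescope (g : Z -> C) (N : nat) :
  sum_sym (fun k => g (k + 1)%Z - g k) N
  = g (Z.of_nat N + 1)%Z - g (- Z.of_nat N)%Z.
Proof.
induction N as [|N IH]; [reflexivity|]. cbn [sum_sym]. rewrite IH.
replace (- Z.of_nat (S N) + 1)%Z with (- Z.of_nat N)%Z by lia.
replace (Z.of_nat N + 1)%Z with (Z.of_nat (S N)) by lia. ring.
Qed.

Lemma sum_sym_Cmod_le (g : Z -> C) (N : nat) (B : R) :
  (forall k, (Z.abs k <= Z.of_nat N)%Z -> (Cmod (g k) <= B)%R) ->
  (Cmod (sum_sym g N) <= (2 * INR N + 1) * B)%R.
Proof.
induction N as [|N IH]; intros H.
- simpl. specialize (H 0%Z ltac:(lia)). lra.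
- cbn [sum_sym]. rewrite S_INR.
  eapply Rle_trans. apply Cmod_triangle.
  assert (H1 := Cmod_triangle (sum_sym g N) (g (Z.of_nat (S N)))).
  assert (H2 := H (Z.of_nat (S N)) ltac:(lia)).
  assert (H3 := H (- Z.of_nat (S N))%Z ltac:(lia)).
  specialize (IH ltac:(intros; apply H; lia)). lra.
Qed.

Lemma box_sum_ext (f g : Z -> Z -> C) (N : nat) :
  (forall a b, f a b = g a b) -> box_sum f N = box_sum g N.
Proof.
intros H. apply sum_sym_ext. intros a _. apply sum_sym_ext. intros b _. apply H.
Qed.

Lemma box_sum_plus (f g : Z -> Z -> C) (N : nat) :
  box_sum (fun a b => f a b + g a b) N = box_sum f N + box_sum g N.
Proof.
unfold box_sum. rewrite <- sum_sym_plus. apply sum_sym_ext. intros a _.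
apply sum_sym_plus.
Qed.

Lemma box_sum_scal (c : C) (f : Z -> Z -> C) (N : nat) :
  box_sum (fun a b => c * f a b) N = c * box_sum f N.
Proof.
unfold box_sum. rewrite <- sum_sym_scal. apply sum_sym_ext. intros a _.
apply sum_sym_scal.
Qed.

Lemma box_sum_opp_index (f : Z -> Z -> C) (N : nat) :
  box_sum (fun a b => f (- a)%Z (- b)%Z) N = box_sum f N.
Proof.
unfold box_sum.
rewrite <- (sum_sym_opp_index (fun a => sum_sym (f a) N) N).
apply sum_sym_ext. intros a _. apply sum_sym_opp_index.
Qed.

Lemma sum_sym_exchange (f : Z -> Z -> C) (M N : nat) :
  sum_sym (fun a => sum_sym (f a) N) M = sum_sym (fun b => sum_sym (fun a => f a b) M) N.
Proof.
induction M as [|M IH]; [reflexivity|]. cbn [sum_sym]. rewrite IH.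
rewrite <- !sum_sym_plus. apply sum_sym_ext. reflexivity.
Qed.

(** The added 1 keeps it positive at the origin, so bounds by its inverse powers make sense at every
    index. *)
Definition idx_size (a b : Z) : R := (1 + IZR (Z.max (Z.abs a) (Z.abs b)))%R.

Lemma idx_size_ge_1 (a b : Z) : (1 <= idx_size a b)%R.
Proof.
unfold idx_size. assert (0 <= IZR (Z.max (Z.abs a) (Z.abs b)))%R; [|lra].
apply IZR_le. lia.
Qed.

Lemma idx_size_0 : idx_size 0 0 = 1%R.
Proof. unfold idx_size. change (Z.max (Z.abs 0) (Z.abs 0)) with 0%Z. lra. Qed.

(** The square shell of radius n has 8n points, so cubic decay leaves O(1/n^2) per shell, which is
    what [quadratic_step_cv] sums. *)
Definition summable (M : R) (f : Z -> Z -> C) : Prop :=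
  forall a b, (Cmod (f a b) <= M / idx_size a b ^ 3)%R.

Lemma summable_ge_0 (M : R) (f : Z -> Z -> C) : summable M f -> (0 <= M)%R.
Proof.
intros H. specialize (H 0%Z 0%Z). rewrite idx_size_0 in H.
assert (H1 := Cmod_ge_0 (f 0%Z 0%Z)). lra.
Qed.

Lemma box_sum_S (f : Z -> Z -> C) (N : nat) :
  box_sum f (S N) = box_sum f N
   + (sum_sym (fun a => f a (Z.of_nat (S N))) N
      + sum_sym (fun a => f a (- Z.of_nat (S N))%Z) N
      + sum_sym (f (Z.of_nat (S N))) (S N) + sum_sym (f (- Z.of_nat (S N))%Z) (S N)).
Proof.
unfold box_sum at 1.
change (sum_sym (fun a => sum_sym (f a) (S N)) (S N))
  with (sum_sym (fun a => sum_sym (f a) N + f a (Z.of_nat (S N)) + f a (- Z.of_nat (S N))%Z) N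
   + sum_sym (f (Z.of_nat (S N))) (S N) + sum_sym (f (- Z.of_nat (S N))%Z) (S N)).
rewrite !sum_sym_plus. unfold box_sum. ring.
Qed.

(** The shell has 8(N+1) indices, each with a term of size at most M/(N+2)^3. *)
Lemma box_sum_shell (M : R) (f : Z -> Z -> C) (N : nat) :
  summable M f ->
  (Cmod (box_sum f (S N) - box_sum f N) <= 8 * M / (INR N + 2) ^ 2)%R.
Proof.
intros H. assert (HM := summable_ge_0 _ _ H).
assert (Hp := pos_INR N).
assert (Hb : forall a b, Z.max (Z.abs a) (Z.abs b) = Z.of_nat (S N) ->
  (Cmod (f a b) <= M / (INR N + 2) ^ 3)%R).
{ intros a b E. eapply Rle_trans. apply H. unfold idx_size. rewrite E.
  rewrite <- INR_IZR_INZ. rewrite S_INR.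
  replace (1 + (INR N + 1))%R with (INR N + 2)%R by ring. lra. }
rewrite box_sum_S.
set (B := (M / (INR N + 2) ^ 3)%R) in *.
assert (HB : (0 <= B)%R).
{ apply Rdiv_le_0_compat; [lra|]. apply pow_lt. lra. }
assert (H1 := sum_sym_Cmod_le (fun a => f a (Z.of_nat (S N))) N B
  ltac:(intros; apply Hb; lia)).
assert (H2 := sum_sym_Cmod_le (fun a => f a (- Z.of_nat (S N))%Z) N B
  ltac:(intros; apply Hb; lia)).
assert (H3 := sum_sym_Cmod_le (f (Z.of_nat (S N))) (S N) B
  ltac:(intros; apply Hb; lia)).
assert (H4 := sum_sym_Cmod_le (f (- Z.of_nat (S N))%Z) (S N) B
  ltac:(intros; apply Hb; lia)).
rewrite S_INR in H3, H4.
match goal with |- (Cmod (?x + (?p + ?q + ?r + ?s) - ?x) <= _)%R =>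
  replace (x + (p + q + r + s) - x) with (p + q + r + s) by ring;
  assert (T1 := Cmod_triangle (p + q + r) s);
  assert (T2 := Cmod_triangle (p + q) r);
  assert (T3 := Cmod_triangle p q) end.
replace (8 * M / (INR N + 2) ^ 2)%R with (8 * (INR N + 2) * B)%R.
2: unfold B; field; lra.
nra.
Qed.

Definition lat_sum (f : Z -> Z -> C) : C := Clim (box_sum f).

Lemma lat_sum_correct (M : R) (f : Z -> Z -> C) :
  summable M f -> Cseq_cv (box_sum f) (lat_sum f).
Proof.
intros H. apply quadratic_step_cv with (8 * M)%R. intros n.
apply box_sum_shell. exact H.
Qed.

Lemma lat_sum_unique (f : Z -> Z -> C) (l : C) :
  Cseq_cv (box_sum f) l -> lat_sum f = l.
Proof. apply Clim_unique. Qed.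

(** The constant is 1 for the origin plus 8 for all the shells. Its independence of f turns uniform
    bounds on terms into bounds on sums. *)
Lemma lat_sum_Cmod_le (M : R) (f : Z -> Z -> C) :
  summable M f -> (Cmod (lat_sum f) <= 9 * M)%R.
Proof.
intros H. apply Cseq_cv_Cmod_le with (box_sum f).
apply lat_sum_correct with M; exact H.
intros n. assert (HM := summable_ge_0 _ _ H).
assert (D := quadratic_step_dist (box_sum f) (8 * M)
  (fun n => box_sum_shell M f n H) 0 n).
rewrite Nat.add_0_l in D.
assert (H0 : (Cmod (box_sum f 0) <= M)%R).
{ unfold box_sum; simpl. eapply Rle_trans. apply H. rewrite idx_size_0. lra. }
assert (T := Cmod_triangle (box_sum f n - box_sum f 0) (box_sum f 0)).
replace (box_sum f n - box_sum f 0 + box_sum f 0) with (box_sum f n) in T by ring.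
simpl INR in D.
assert (0 < / (INR n + 1))%R.
{ apply Rinv_0_lt_compat. generalize (pos_INR n). lra. }
nra.
Qed.

Lemma lat_sum_ext (f g : Z -> Z -> C) :
  (forall a b, f a b = g a b) -> lat_sum f = lat_sum g.
Proof.
intros H. unfold lat_sum, Clim. f_equal; f_equal; apply Lim_seq_ext;
intros n; rewrite (box_sum_ext f g n H); reflexivity.
Qed.

Lemma summable_plus (M M' : R) (f g : Z -> Z -> C) :
  summable M f -> summable M' g -> summable (M + M') (fun a b => f a b + g a b).
Proof.
intros H1 H2 a b. eapply Rle_trans. apply Cmod_triangle.
unfold Rdiv. rewrite Rmult_plus_distr_r. apply Rplus_le_compat. apply H1. apply H2.
Qed.

Lemma summable_scal (M : R) (c : C) (f : Z -> Z -> C) :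
  summable M f -> summable (Cmod c * M) (fun a b => c * f a b).
Proof.
intros H a b. rewrite Cmod_mult. unfold Rdiv. rewrite Rmult_assoc.
apply Rmult_le_compat_l. apply Cmod_ge_0. apply H.
Qed.

Lemma lat_sum_plus (M M' : R) (f g : Z -> Z -> C) :
  summable M f -> summable M' g ->
  lat_sum (fun a b => f a b + g a b) = lat_sum f + lat_sum g.
Proof.
intros H1 H2. apply lat_sum_unique.
eapply Cseq_cv_ext. intros n. symmetry. apply box_sum_plus.
apply Cseq_cv_plus; eapply lat_sum_correct; eassumption.
Qed.

Lemma lat_sum_scal (M : R) (c : C) (f : Z -> Z -> C) :
  summable M f -> lat_sum (fun a b => c * f a b) = c * lat_sum f.
Proof.
intros H. apply lat_sum_unique.
eapply Cseq_cv_ext. intros n. symmetry. apply box_sum_scal.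
apply Cseq_cv_scal. eapply lat_sum_correct; eassumption.
Qed.

Lemma lat_sum_opp_index (f : Z -> Z -> C) :
  lat_sum (fun a b => f (- a)%Z (- b)%Z) = lat_sum f.
Proof.
unfold lat_sum, Clim. f_equal; f_equal; apply Lim_seq_ext;
intros n; rewrite box_sum_opp_index; reflexivity.
Qed.

(** Every box is symmetric, so the partial sums are already zero and no decay has to be assumed. *)
Lemma lat_sum_odd (f : Z -> Z -> C) :
  (forall a b, f (- a)%Z (- b)%Z = - f a b) -> lat_sum f = 0.
Proof.
intros H. apply lat_sum_unique. eapply Cseq_cv_ext. 2: apply (Cseq_cv_const 0).
intros n. simpl.
assert (E : box_sum f n = - box_sum f n).
{ rewrite <- box_sum_opp_index at 1.
  rewrite (box_sum_ext _ (fun a b => (- (1)) * f a b)).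
  rewrite box_sum_scal. ring. intros. rewrite H. ring. }
assert (E2 : 2 * box_sum f n = 0).
{ replace (2 * box_sum f n) with (box_sum f n + box_sum f n) by ring.
  rewrite E at 1. ring. }
destruct (Ceq_dec (box_sum f n) 0) as [Z0|Z0]; [congruence|exfalso].
revert E2. apply Cmult_neq_0; [|exact Z0]. intro H2. apply RtoC_inj in H2. lra.
Qed.

(** Carries the polar part of a series as a term of the same lattice sum, so that it is handled by
    linearity. *)
Definition at_origin (c : C) (a b : Z) : C :=
  if (Z.eqb a 0 && Z.eqb b 0)%bool then c else 0.

Lemma summable_at_origin (c : C) : summable (Cmod c) (at_origin c).
Proof.
intros a b. unfold at_origin.
destruct (Z.eqb_spec a 0), (Z.eqb_spec b 0); simpl.
2-4: rewrite Cmod_0; apply Rdiv_le_0_compat; [apply Cmod_ge_0|];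
  apply (pow_lt _ 3); generalize (idx_size_ge_1 a b); lra.
subst. rewrite idx_size_0. lra.
Qed.

Lemma sum_sym_single (g : Z -> C) (N : nat) :
  (forall k, k <> 0%Z -> g k = 0) -> sum_sym g N = g 0%Z.
Proof.
intros H. induction N as [|N IH]; [reflexivity|]. cbn [sum_sym].
rewrite IH, (H (Z.of_nat (S N))), (H (- Z.of_nat (S N))%Z) by lia. ring.
Qed.

Lemma box_sum_at_origin (c : C) (n : nat) : box_sum (at_origin c) n = c.
Proof.
unfold box_sum. rewrite sum_sym_single.
- rewrite sum_sym_single. reflexivity.
  intros k Hk. unfold at_origin. rewrite (proj2 (Z.eqb_neq k 0) Hk). reflexivity.
- intros k Hk. rewrite sum_sym_single.
  + unfold at_origin. rewrite (proj2 (Z.eqb_neq k 0) Hk). reflexivity.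
  + intros j _. unfold at_origin. rewrite (proj2 (Z.eqb_neq k 0) Hk). reflexivity.
Qed.

Lemma lat_sum_at_origin (c : C) : lat_sum (at_origin c) = c.
Proof.
apply lat_sum_unique. eapply Cseq_cv_ext. 2: apply (Cseq_cv_const c).
intros n. symmetry. apply box_sum_at_origin.
Qed.


(** * Germs at a punctured neighbourhood of the origin *)

(** The centre is left out because the functions to be expanded have their poles there. *)
Definition near0 (P : C -> Prop) : Prop :=
  exists r : R, (0 < r)%R /\ forall h : C, h <> 0 -> (Cmod h < r)%R -> P h.

Lemma near0_and (P Q : C -> Prop) :
  near0 P -> near0 Q -> near0 (fun h => P h /\ Q h).
Proof.
intros [r [Hr HP]] [s [Hs HQ]]. exists (Rmin r s). split.
apply Rmin_pos; assumption.
intros h H0 Hh. split; [apply HP|apply HQ]; auto; eapply Rlt_le_trans; eauto.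
apply Rmin_l. apply Rmin_r.
Qed.

Lemma near0_imp (P Q : C -> Prop) :
  (forall h, P h -> Q h) -> near0 P -> near0 Q.
Proof. intros I [r [Hr HP]]. exists r. split; auto. Qed.

Lemma near0_all (P : C -> Prop) : (forall h, P h) -> near0 P.
Proof. intros H. exists 1%R. split; [lra|auto]. Qed.

Lemma near0_lt (e : R) : (0 < e)%R -> near0 (fun h => (Cmod h < e)%R).
Proof. intros He. exists e. split; auto. Qed.

Lemma near0_neq : near0 (fun h => h <> 0).
Proof. exists 1%R. split; [lra|intros h Hh _; exact Hh]. Qed.

Lemma near0_real (P : C -> Prop) :
  near0 P -> exists r : R, (0 < r)%R /\ forall t : R, (0 < t < r)%R -> P (RtoC t).
Proof.
intros [r [Hr H]]. exists r. split; [exact Hr|]. intros t Ht. apply H.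
intro E. apply RtoC_inj in E. lra. rewrite Cmod_R, Rabs_pos_eq; lra.
Qed.

Lemma near0_ex (P : C -> Prop) : near0 P -> exists h : C, h <> 0 /\ P h.
Proof.
intros H. destruct (near0_real _ (near0_and _ _ H near0_neq)) as [r [Hr Ht]].
exists (RtoC (r / 2)). destruct (Ht (r/2)%R); [lra|]. auto.
Qed.

Lemma near0_opp (P : C -> Prop) : near0 P -> near0 (fun h => P (- h)).
Proof.
intros [r [Hr H]]. exists r. split; [exact Hr|]. intros h H0 Hh. apply H.
- intro E. apply H0. replace h with (- - h) by ring. rewrite E. ring.
- rewrite Cmod_opp. exact Hh.
Qed.

Definition bnd (f : C -> C) : Prop :=
  exists K : R, (0 <= K)%R /\ near0 (fun h => (Cmod (f h) <= K)%R).

Lemma bnd_const (c : C) : bnd (fun _ => c).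
Proof. exists (Cmod c). split. apply Cmod_ge_0. apply near0_all. intros; lra. Qed.

Lemma bnd_id : bnd (fun h => h).
Proof.
exists 1%R. split; [lra|]. exists 1%R. split; [lra|]. intros; lra.
Qed.

Lemma bnd_plus (f g : C -> C) : bnd f -> bnd g -> bnd (fun h => f h + g h).
Proof.
intros [K [HK Hf]] [L [HL Hg]]. exists (K + L)%R. split; [lra|].
eapply near0_imp. 2: apply (near0_and _ _ Hf Hg). simpl. intros h [H1 H2].
assert (T := Cmod_triangle (f h) (g h)). lra.
Qed.

Lemma bnd_mult (f g : C -> C) : bnd f -> bnd g -> bnd (fun h => f h * g h).
Proof.
intros [K [HK Hf]] [L [HL Hg]]. exists (K * L)%R. split; [nra|].
eapply near0_imp. 2: apply (near0_and _ _ Hf Hg). simpl. intros h [H1 H2].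
rewrite Cmod_mult. apply Rmult_le_compat; auto using Cmod_ge_0.
Qed.

Lemma bnd_opp (f : C -> C) : bnd f -> bnd (fun h => - f h).
Proof.
intros [K [HK Hf]]. exists K. split; [lra|].
eapply near0_imp. 2: apply Hf. simpl. intros h H. rewrite Cmod_opp. exact H.
Qed.

Lemma bnd_minus (f g : C -> C) : bnd f -> bnd g -> bnd (fun h => f h - g h).
Proof. intros Hf Hg. apply bnd_plus; [|apply bnd_opp]; assumption. Qed.

Lemma bnd_pow (f : C -> C) (n : nat) : bnd f -> bnd (fun h => f h ^ n).
Proof.
intros H. induction n as [|n IH]; simpl. apply bnd_const. apply bnd_mult; assumption.
Qed.

Lemma bnd_small (f : C -> C) (e : R) :
  (0 < e)%R -> bnd f -> near0 (fun h => (Cmod (h * f h) < e)%R).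
Proof.
intros He [K [HK Hf]].
assert (Hd : (0 < e / (K + 1))%R) by (apply Rdiv_lt_0_compat; lra).
eapply near0_imp. 2: apply (near0_and _ _ Hf (near0_lt _ Hd)).
simpl. intros h [H1 H2]. rewrite Cmod_mult.
apply Rle_lt_trans with (Cmod h * (K + 1))%R.
- apply Rmult_le_compat_l. apply Cmod_ge_0. lra.
- apply Rlt_le_trans with (e / (K + 1) * (K + 1))%R. nra. right. field. lra.
Qed.

Ltac bnd_auto := repeat first
  [ assumption | apply bnd_id | apply bnd_const | apply bnd_opp
  | apply bnd_pow | apply bnd_minus | apply bnd_plus | apply bnd_mult ].

Lemma near0_inv_shift (z : C) : z <> 0 ->
  near0 (fun h => (Cmod z / 2 <= Cmod (z + h))%R /\ z + h <> 0).
Proof.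
intros Hz. assert (Hp : (0 < Cmod z)%R) by (apply Cmod_gt_0; exact Hz).
eapply near0_imp. 2: apply (near0_lt (Cmod z / 2)); lra. simpl. intros h Hh.
assert (H : (Cmod z / 2 <= Cmod (z + h))%R).
{ assert (T := Cmod_triangle_inv_plus z h). lra. }
split; [exact H|]. intro E. rewrite E, Cmod_0 in H. lra.
Qed.

Lemma bnd_inv_shift (z : C) : z <> 0 -> bnd (fun h => / (z + h)).
Proof.
intros Hz. assert (Hp : (0 < Cmod z)%R) by (apply Cmod_gt_0; exact Hz).
exists (/ (Cmod z / 2))%R. split. left. apply Rinv_0_lt_compat. lra.
eapply near0_imp. 2: apply (near0_inv_shift z Hz). simpl. intros h [H1 H2].
apply Cmod_inv_le; lra.
Qed.

Definition Ccont (f : C -> C) (z : C) : Prop :=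
  forall e : R, (0 < e)%R -> near0 (fun h => (Cmod (f (z + h)%C - f z) < e)%R).

(** The stand-in for holomorphy: the linear and quadratic terms are complex polynomials in h. Order
    two is what [four_sum] requires, since a cubic remainder is negligible against a gain of order
    h^2. *)
Definition jet (f : C -> C) (z a1 a2 : C) : Prop :=
  exists r, bnd r /\
    near0 (fun h => f (z + h) = f z + a1 * h + a2 * h ^ 2 + h ^ 3 * r h).

Lemma jet_ext_near (f g : C -> C) (z a1 a2 : C) :
  f z = g z -> near0 (fun h => f (z + h) = g (z + h)) ->
  jet f z a1 a2 -> jet g z a1 a2.
Proof.
intros E N [r [Hr H]]. exists r. split; [exact Hr|].
eapply near0_imp. 2: apply (near0_and _ _ N H). simpl. intros h [H1 H2].
rewrite <- H1, H2, E. reflexivity.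
Qed.

Lemma jet_const (c z : C) : jet (fun _ => c) z 0 0.
Proof.
exists (fun _ => 0). split; [apply bnd_const|]. apply near0_all. intros h. ring.
Qed.

Lemma jet_plus (f g : C -> C) (z a1 a2 b1 b2 : C) :
  jet f z a1 a2 -> jet g z b1 b2 -> jet (fun x => f x + g x) z (a1 + b1) (a2 + b2).
Proof.
intros [r [Hr Hf]] [s [Hs Hg]]. exists (fun h => r h + s h).
split; [apply bnd_plus; assumption|].
eapply near0_imp. 2: apply (near0_and _ _ Hf Hg). simpl. intros h [-> ->]. ring.
Qed.

Lemma jet_mult (f g : C -> C) (z a1 a2 b1 b2 : C) :
  jet f z a1 a2 -> jet g z b1 b2 ->
  jet (fun x => f x * g x) z (a1 * g z + f z * b1) (a2 * g z + a1 * b1 + f z * b2).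
Proof.
intros [r [Hr Hf]] [s [Hs Hg]].
exists (fun h => (f z * s h + r h * g z + a1 * b2 + a2 * b1)
   + h * (a2 * b2 + a1 * s h + r h * b1) + h ^ 2 * (a2 * s h + r h * b2)
   + h ^ 3 * (r h * s h)).
split. bnd_auto.
eapply near0_imp. 2: apply (near0_and _ _ Hf Hg). simpl. intros h [-> ->]. ring.
Qed.

Lemma jet_opp (f : C -> C) (z a1 a2 : C) :
  jet f z a1 a2 -> jet (fun x => - f x) z (- a1) (- a2).
Proof.
intros [r [Hr Hf]]. exists (fun h => - r h). split; [apply bnd_opp; assumption|].
eapply near0_imp. 2: apply Hf. simpl. intros h ->. ring.
Qed.

Lemma jet_minus (f g : C -> C) (z a1 a2 b1 b2 : C) :
  jet f z a1 a2 -> jet g z b1 b2 -> jet (fun x => f x - g x) z (a1 - b1) (a2 - b2).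
Proof. intros Hf Hg. apply jet_plus; [|apply jet_opp]; assumption. Qed.

Lemma jet_shift (f : C -> C) (b z a1 a2 : C) :
  jet f (z + b) a1 a2 -> jet (fun x => f (x + b)) z a1 a2.
Proof.
intros [r [Hr Hf]]. exists r. split; [exact Hr|].
eapply near0_imp. 2: apply Hf. simpl. intros h <-. f_equal. ring.
Qed.

Lemma jet_inv (z : C) : z <> 0 -> jet Cinv z (- / z ^ 2) (/ z ^ 3).
Proof.
intros Hz. exists (fun h => - / z ^ 3 * / (z + h)). split.
- apply bnd_mult. apply bnd_const. apply bnd_inv_shift; exact Hz.
- eapply near0_imp. 2: apply (near0_inv_shift z Hz). simpl. intros h [_ Hh].
  field. auto.
Qed.

Lemma jet_Ccont (f : C -> C) (z a1 a2 : C) : jet f z a1 a2 -> Ccont f z.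
Proof.
intros [r [Hr Hf]] e He.
eapply near0_imp.
2: apply (near0_and _ _ Hf (bnd_small (fun h => a1 + a2 * h + h ^ 2 * r h) e He
   ltac:(bnd_auto))).
simpl. intros h [-> H2]. eapply Rle_lt_trans. 2: exact H2. right. f_equal. ring.
Qed.

(** This is what allows an identity between jets to be differentiated. *)
Lemma jet_zero_derivative (f : C -> C) (z a1 a2 : C) :
  f z = 0 -> near0 (fun h => f (z + h) = 0) -> jet f z a1 a2 -> a1 = 0.
Proof.
intros E0 N [r [Hr Hf]].
destruct (Ceq_dec a1 0) as [E|E]; [exact E|exfalso].
assert (Hp : (0 < Cmod a1)%R) by (apply Cmod_gt_0; exact E).
destruct (near0_ex _ (near0_and _ _ (near0_and _ _ N Hf)
  (bnd_small (fun h => a2 + h * r h) _ Hp ltac:(bnd_auto)))) as [h [H0 [[H1 H2] H3]]].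
rewrite H1, E0 in H2.
assert (E4 : a1 = - (h * (a2 + h * r h))).
{ assert (E5 : h * (a1 + h * (a2 + h * r h)) = 0).
  { transitivity (0 + a1 * h + a2 * h ^ 2 + h ^ 3 * r h). ring. symmetry. exact H2. }
  destruct (Ceq_dec (a1 + h * (a2 + h * r h)) 0) as [E6|E6].
  - transitivity ((a1 + h * (a2 + h * r h)) - h * (a2 + h * r h)). ring.
    rewrite E6. ring.
  - exfalso. exact (Cmult_neq_0 _ _ H0 E6 E5). }
rewrite E4, Cmod_opp in H3. lra.
Qed.

(** * Maxima on compact sets and a Liouville theorem *)

Lemma locally_bounded_bounded (D : C -> Prop) (g : C -> R) (R0 : R) :
  (forall z, D z -> (Cmod z <= R0)%R) ->
  (forall z, exists d B : R, (0 < d)%R /\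
     forall w, D w -> (Cmod (w - z) < d)%R -> (g w <= B)%R) ->
  exists B : R, forall w, D w -> (g w <= B)%R.
Proof.
intros HD HL.
(* The radius is doubled because closeness below d in both coordinates only gives a modulus below
   2d. *)
assert (HL' : forall z, exists d : posreal, exists B : R,
  forall w, D w -> (Cmod (w - z) < 2 * d)%R -> (g w <= B)%R).
{ intros z. destruct (HL z) as [d [B [Hd H]]].
  assert (Hd2 : (0 < d / 2)%R) by lra. exists (mkposreal _ Hd2), B. simpl.
  intros w Hw Hz. apply H; auto. lra. }
set (delta := fun z => proj1_sig (constructive_indefinite_description _ (HL' z))).
assert (Hdelta : forall z, exists B : R,
  forall w, D w -> (Cmod (w - z) < 2 * delta z)%R -> (g w <= B)%R).
{ intros z. unfold delta. destruct (constructive_indefinite_description _ (HL' z)).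
  exact e. }
(* A finite cover of the square of half-side R0, delivered under a double negation. *)
assert (Hc := compactness_list 2 ((- R0)%R, ((- R0)%R, tt)) (R0, (R0, tt))
  (fun t => delta (fst t, fst (snd t)))).
apply NNPP in Hc. destruct Hc as [l Hl].
assert (HB : exists B : R, forall t, In t l -> forall w, D w ->
  (Cmod (w - (fst t, fst (snd t))) < 2 * delta (fst t, fst (snd t)))%R -> (g w <= B)%R).
{ clear Hl. induction l as [|t l IH].
  - exists 0%R. intros t [].
  - destruct IH as [B HB]. destruct (Hdelta (fst t, fst (snd t))) as [B' HB'].
    exists (Rmax B B'). intros s [<-|Hs] w Hw Hd.
    + eapply Rle_trans. 2: apply Rmax_r. apply HB'; assumption.
    + eapply Rle_trans. 2: apply Rmax_l. apply (HB s); assumption. }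
destruct HB as [B HB]. exists B. intros w Hw.
assert (Hm := HD w Hw).
assert (H1 := Rabs_fst_le_Cmod w). assert (H2 := Rabs_snd_le_Cmod w).
destruct (Hl (fst w, (snd w, tt))) as [t [Ht [_ Hcl]]].
{ assert (H3 := Rabs_le_between (fst w) R0). assert (H4 := Rabs_le_between (snd w) R0).
  simpl. repeat split; lra. }
apply (HB t Ht w Hw).
destruct t as [t1 [t2 []]]. destruct w as [x y]. simpl in Hcl |- *.
destruct Hcl as [Hx [Hy _]].
eapply Rle_lt_trans. apply Cmod_le_sum. simpl.
change (x + - t1)%R with (x - t1)%R. change (y + - t2)%R with (y - t2)%R. lra.
Qed.

Definition Rcont (g : C -> R) (z : C) : Prop :=
  forall e : R, (0 < e)%R -> near0 (fun h => (Rabs (g (z + h)%C - g z) < e)%R).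

Lemma Rcont_pt (g : C -> R) (z : C) (e : R) : Rcont g z -> (0 < e)%R ->
  exists d : R, (0 < d)%R /\ forall w, (Cmod (w - z) < d)%R -> (Rabs (g w - g z) < e)%R.
Proof.
intros H He. destruct (H e He) as [d [Hd Hh]]. exists d. split; [exact Hd|].
intros w Hw. destruct (Ceq_dec (w - z) 0) as [E|E].
- apply Ceq_minus in E. subst. rewrite Rminus_diag_eq, Rabs_R0 by reflexivity. exact He.
- specialize (Hh _ E Hw). replace (z + (w - z)) with w in Hh by ring. exact Hh.
Qed.

(** If the supremum M were not attained, 1/(M - g) would be locally bounded, hence bounded by some
    B', and M - 1/B' would be a smaller upper bound. *)
Lemma maximum_on_compact (D : C -> Prop) (g : C -> R) (R0 : R) (z0 : C) :
  D z0 ->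
  (forall z, D z -> (Cmod z <= R0)%R) ->
  (forall z, ~ D z -> exists d : R, (0 < d)%R /\
     forall w, (Cmod (w - z) < d)%R -> ~ D w) ->
  (forall z, D z -> Rcont g z) ->
  exists z, D z /\ forall w, D w -> (g w <= g z)%R.
Proof.
intros Hz0 HD Hcl Hg.
destruct (locally_bounded_bounded D g R0 HD) as [B HB].
{ intros z. destruct (classic (D z)) as [Dz|Dz].
  - destruct (Rcont_pt g z 1 (Hg z Dz)) as [d [Hd H]]; [lra|].
    exists d, (g z + 1)%R. split; [exact Hd|]. intros w _ Hw. specialize (H w Hw).
    apply Rabs_lt_between in H. lra.
  - destruct (Hcl z Dz) as [d [Hd H]]. exists d, 0%R. split; [exact Hd|].
    intros w Dw Hw. exfalso. exact (H w Hw Dw). }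
destruct (completeness (fun x => exists w, D w /\ x = g w)) as [M [HM1 HM2]].
{ exists B. intros x [w [Dw ->]]. apply HB; exact Dw. }
{ exists (g z0), z0. auto. }
apply NNPP. intro Hno.
assert (Hlt : forall w, D w -> (g w < M)%R).
{ intros w Dw. destruct (HM1 (g w)) as [H|H].
  - exists w; auto.
  - exact H.
  - exfalso. apply Hno. exists w. split; [exact Dw|]. intros v Dv. rewrite H.
    apply HM1. exists v; auto. }
destruct (locally_bounded_bounded D (fun w => / (M - g w))%R R0 HD) as [B' HB'].
{ intros z. destruct (classic (D z)) as [Dz|Dz].
  - specialize (Hlt z Dz).
    destruct (Rcont_pt g z ((M - g z) / 2) (Hg z Dz)) as [d [Hd H]]; [lra|].
    exists d, (/ ((M - g z) / 2))%R. split; [exact Hd|]. intros w Dw Hw. specialize (H w Hw).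
    apply Rabs_lt_between in H. apply Rinv_le_contravar; lra.
  - destruct (Hcl z Dz) as [d [Hd H]]. exists d, 0%R. split; [exact Hd|].
    intros w Dw Hw. exfalso. exact (H w Hw Dw). }
assert (HBp : (0 < B')%R).
{ eapply Rlt_le_trans. 2: apply (HB' z0 Hz0). apply Rinv_0_lt_compat.
  specialize (Hlt z0 Hz0). lra. }
assert (Hub : (M <= M - / B')%R).
{ apply HM2. intros x [w [Dw ->]]. specialize (HB' w Dw). specialize (Hlt w Dw).
  assert (/ B' <= M - g w)%R; [|lra].
  rewrite <- (Rinv_inv (M - g w)). apply Rinv_le_contravar; [|exact HB'].
  apply Rinv_0_lt_compat. lra. }
assert (0 < / B')%R by (apply Rinv_0_lt_compat; exact HBp). lra.
Qed.

Lemma Rcont_comp (g : C -> R) (F : R -> R) (z : C) :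
  Rcont g z -> continuity_pt F (g z) -> Rcont (fun w => F (g w)) z.
Proof.
intros Hg HF e He. destruct (HF e He) as [d [Hd H]].
eapply near0_imp. 2: apply (Hg d Hd). simpl. intros h Hh.
destruct (Req_dec (g (z + h)) (g z)) as [E|E].
- rewrite E, Rminus_diag_eq, Rabs_R0 by reflexivity. exact He.
- apply (H (g (z + h))). split; [|exact Hh].
  split; [exact I|]. intro E'. apply E. symmetry. exact E'.
Qed.

Lemma Rcont_plus (f g : C -> R) (z : C) :
  Rcont f z -> Rcont g z -> Rcont (fun w => f w + g w)%R z.
Proof.
intros Hf Hg e He.
eapply near0_imp.
2: apply (near0_and _ _ (Hf (e/2)%R ltac:(lra)) (Hg (e/2)%R ltac:(lra))).
simpl. intros h [H1 H2].
apply Rabs_lt_between in H1. apply Rabs_lt_between in H2. apply Rabs_lt_between. lra.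
Qed.

Lemma Rcont_Cmod (f : C -> C) (z : C) : Ccont f z -> Rcont (fun w => Cmod (f w)) z.
Proof.
intros Hf e He. eapply near0_imp. 2: apply (Hf e He). simpl. intros h Hh.
assert (H1 := Cmod_triangle_inv (f (z + h)) (f z)).
assert (H2 := Cmod_triangle_inv (f z) (f (z + h))).
rewrite Cmod_minus_sym in H2. apply Rabs_lt_between. lra.
Qed.

Lemma Ccont_id (z : C) : Ccont (fun w => w) z.
Proof.
intros e He. eapply near0_imp. 2: apply (near0_lt e He). simpl. intros h Hh.
replace (z + h - z) with h by ring. exact Hh.
Qed.

Definition four_sum (g : C -> R) (w : C) (h : R) : R :=
  (g (w + h)%C + g (w + Ci * h)%C + g (w + - RtoC h)%C + g (w + - (Ci * h))%C)%R.

Lemma Cmod_sqr (z : C) : (Cmod z ^ 2 = fst z ^ 2 + snd z ^ 2)%R.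
Proof. unfold Cmod. rewrite pow2_sqrt. reflexivity. nra. Qed.

Lemma Cmod_sqr_plus_ge (x y : C) :
  (Cmod x ^ 2 - 2 * Cmod x * Cmod y <= Cmod (x + y) ^ 2)%R.
Proof.
assert (H := Cmod_triangle_inv_plus x y).
assert (Hx := Cmod_ge_0 x). assert (Hy := Cmod_ge_0 y).
assert (Hxy := Cmod_ge_0 (x + y)).
destruct (Rle_dec (Cmod x) (Cmod y)).
- assert (0 <= Cmod (x + y) ^ 2)%R by nra. nra.
- assert ((Cmod x - Cmod y) ^ 2 <= Cmod (x + y) ^ 2)%R.
  { apply pow_incr. lra. } nra.
Qed.

(** The cross terms of the square are t or t^2 up to conjugation and constants, times a power of h;
    these sum to zero over the four directions. *)
Lemma four_sum_poly (a0 a1 a2 : C) (h : R) :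
  (four_sum (fun t => Cmod (a0 + a1 * t + a2 * t ^ 2) ^ 2) 0 h
   = 4 * (Cmod a0 ^ 2 + Cmod a1 ^ 2 * h ^ 2 + Cmod a2 ^ 2 * h ^ 4))%R.
Proof.
unfold four_sum. rewrite !Cmod_sqr.
destruct a0 as [p p'], a1 as [q q'], a2 as [s s']. simpl. ring.
Qed.

(* The linear and quadratic terms average out over the four directions; this is
   the discrete form of "the Laplacian of |f|^2 is 4|f'|^2". *)
Lemma four_sum_jet (f : C -> C) (w a1 a2 : C) : jet f w a1 a2 ->
  exists K r : R, (0 < r)%R /\ forall h : R, (0 < h < r)%R ->
   (four_sum (fun t => Cmod (f t) ^ 2) w h
     >= 4 * Cmod (f w) ^ 2 + 4 * Cmod a1 ^ 2 * h ^ 2 - K * h ^ 3)%R.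
Proof.
intros [r [[K [HK Hr]] Hf]].
set (A := (Cmod (f w) + Cmod a1 + Cmod a2)%R).
assert (HA : (0 <= A)%R).
{ unfold A. generalize (Cmod_ge_0 (f w)) (Cmod_ge_0 a1) (Cmod_ge_0 a2). lra. }
destruct (near0_and _ _ (near0_and _ _ Hf Hr) (near0_lt 1 ltac:(lra)))
  as [rho [Hrho HN]].
(* Four directions, each losing at most 2 A K h^3; A bounds the Taylor polynomial because h < 1. *)
exists (8 * A * K)%R, rho. split; [exact Hrho|]. intros h Hh.
assert (Hone : forall t : C, Cmod t = h ->
  (Cmod (f (w + t)%C) ^ 2 >=
    Cmod (f w + a1 * t + a2 * t ^ 2) ^ 2 - 2 * A * (K * h ^ 3))%R).
{ intros t Et. destruct (HN t) as [[E1 E2] E3].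
  - apply Cmod_gt_0. lra.
  - lra.
  - rewrite E1. apply Rle_ge. eapply Rle_trans. 2: apply Cmod_sqr_plus_ge.
    rewrite Cmod_mult, Cmod_pow, Et.
    assert (HT : (Cmod (f w + a1 * t + a2 * t ^ 2) <= A)%R).
    { eapply Rle_trans. apply Cmod_triangle.
      assert (T := Cmod_triangle (f w) (a1 * t)). rewrite Cmod_mult in T.
      rewrite Cmod_mult, Cmod_pow. rewrite Et in *. unfold A.
      assert (Cmod a1 * h <= Cmod a1)%R by (generalize (Cmod_ge_0 a1); nra).
      assert (Cmod a2 * h ^ 2 <= Cmod a2)%R.
      { assert (h ^ 2 <= 1)%R by nra. generalize (Cmod_ge_0 a2); nra. } lra. }
    assert (Hh3 : (0 <= h ^ 3)%R) by (apply pow_le; lra).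
    assert (h ^ 3 * Cmod (r t) <= K * h ^ 3)%R by nra.
    assert (Hm := Cmod_ge_0 (f w + a1 * t + a2 * t ^ 2)).
    assert (0 <= h ^ 3 * Cmod (r t))%R by (generalize (Cmod_ge_0 (r t)); nra).
    assert (Cmod (f w + a1 * t + a2 * t ^ 2) * (h ^ 3 * Cmod (r t)) <= A * (K * h ^ 3))%R
      by (apply Rmult_le_compat; lra). lra. }
assert (P := four_sum_poly (f w) a1 a2 h). unfold four_sum in *.
rewrite !Cplus_0_l in P.
assert (Eh : Cmod h = h) by (rewrite Cmod_R, Rabs_pos_eq; lra).
assert (Eih : Cmod (Ci * h) = h) by (rewrite Cmod_mult, Eh, Cmod_Ci; lra).
assert (Enh : Cmod (- RtoC h) = h) by (rewrite Cmod_opp; exact Eh).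
assert (Enih : Cmod (- (Ci * h)) = h) by (rewrite Cmod_opp; exact Eih).
generalize (Hone _ Eh) (Hone _ Eih) (Hone _ Enh) (Hone _ Enih). intros G1 G2 G3 G4.
assert (0 <= Cmod a2 ^ 2 * h ^ 4)%R.
{ apply Rmult_le_pos; apply pow_le; [apply Cmod_ge_0|lra]. } lra.
Qed.

(** The product of the four points is w^4 - h^4, so the sum is ln|w^4 - h^4|, and ln(1 + t) <= t
    gives the bound. The logarithm is harmonic, and its error of order h^4 cannot compete with
    h^2. *)
Lemma four_sum_ln (w : C) (h : R) : (0 < h < Cmod w)%R ->
  (four_sum (fun t => ln (Cmod t)) w h <= 4 * ln (Cmod w) + h ^ 4 / Cmod w ^ 4)%R.
Proof.
intros Hh. unfold four_sum.
assert (Eh : Cmod h = h) by (rewrite Cmod_R, Rabs_pos_eq; lra).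
assert (Eih : Cmod (Ci * h) = h) by (rewrite Cmod_mult, Eh, Cmod_Ci; lra).
assert (P : forall t, Cmod t = h -> (0 < Cmod (w + t))%R).
{ intros t Et. assert (T := Cmod_triangle_inv_plus w t). lra. }
assert (P1 := P _ Eh). assert (P2 := P _ Eih).
assert (P3 : (0 < Cmod (w + - RtoC h))%R) by (apply P; rewrite Cmod_opp; exact Eh).
assert (P4 : (0 < Cmod (w + - (Ci * h)))%R) by (apply P; rewrite Cmod_opp; exact Eih).
rewrite <- !ln_mult; repeat apply Rmult_lt_0_compat; try assumption.
rewrite <- !Cmod_mult.
assert (Ci2 : Ci * Ci = - (1)).
{ unfold Ci, Cmult, Complex.Copp, Complex.RtoC; simpl. f_equal; ring. }
(* The relation i^2 = -1 is kept apart as the factor [Ci * Ci + 1], so that the identity holds in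
   every commutative ring. *)
replace ((w + h) * (w + Ci * h) * (w + - RtoC h) * (w + - (Ci * h)))
  with (w ^ 4 - h ^ 4 - (Ci * Ci + 1) * (h ^ 2 * (w ^ 2 - h ^ 2))) by ring.
rewrite Ci2.
replace (w ^ 4 - h ^ 4 - (- (1) + 1) * (h ^ 2 * (w ^ 2 - h ^ 2))) with (w ^ 4 - h ^ 4) by ring.
assert (H4 : (0 < Cmod w ^ 4)%R) by (apply pow_lt; lra).
assert (Hh4 : (0 < h ^ 4)%R) by (apply pow_lt; lra).
assert (Hq : (0 < h ^ 4 / Cmod w ^ 4)%R) by (apply Rdiv_lt_0_compat; assumption).
assert (Hlt : (h ^ 4 < Cmod w ^ 4)%R).
{ assert (h ^ 2 < Cmod w ^ 2)%R by nra. nra. }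
replace (4 * ln (Cmod w))%R with (ln (Cmod w ^ 4)).
2:{ rewrite ln_pow by lra. simpl INR. lra. }
apply Rle_trans with (ln (Cmod w ^ 4 * (1 + h ^ 4 / Cmod w ^ 4))).
- apply ln_le.
  + eapply Rlt_le_trans. 2: apply Cmod_triangle_inv. rewrite !Cmod_pow, Eh. lra.
  + eapply Rle_trans. apply Cmod_minus_triangle. rewrite !Cmod_pow, Eh. right.
    field. lra.
- rewrite ln_mult by lra. apply Rplus_le_compat_l.
  apply Rle_trans with (ln (exp (h ^ 4 / Cmod w ^ 4))).
  + apply ln_le; [lra|]. left. apply exp_ineq1. lra.
  + rewrite ln_exp. lra.
Qed.

Lemma annulus_closed (d R1 : R) (z : C) : ~ (d <= Cmod z <= R1)%R ->
  exists e : R, (0 < e)%R /\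
    forall w, (Cmod (w - z) < e)%R -> ~ (d <= Cmod w <= R1)%R.
Proof.
intros Hz. destruct (Rlt_dec (Cmod z) d) as [H|H].
- exists (d - Cmod z)%R. split; [lra|]. intros w Hw Hd.
  assert (T := Cmod_triangle_inv w z). lra.
- assert (H' : (R1 < Cmod z)%R) by lra.
  exists (Cmod z - R1)%R. split; [lra|]. intros w Hw Hd.
  assert (T := Cmod_triangle_inv z w). rewrite Cmod_minus_sym in T. lra.
Qed.

Lemma ln_unbounded (B : R) : exists R1 : R, (0 < R1)%R /\
  forall t, (R1 <= t)%R -> (B <= ln t)%R.
Proof.
exists (exp B). split; [apply exp_pos|]. intros t Ht.
rewrite <- (ln_exp B). apply ln_le; [apply exp_pos|exact Ht].
Qed.

(* The barrier eta/|z|^2 - eps ln|z| makes |f|^2 + barrier strictly subharmonic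
   and small at infinity, so its maximum over an annulus is on the inner circle
   or at a zero of f. *)
Lemma liouville_zero (f : C -> C) (B : R) :
  (forall z, (Cmod (f z) <= B)%R) -> (forall z, Ccont f z) -> f 0 = 0 ->
  (forall z, f z = 0 \/ exists a1 a2, jet f z a1 a2) ->
  forall z, f z = 0.
Proof.
intros HB Hc H0 HJ z1.
destruct (Ceq_dec (f z1) 0) as [E|E]; [exact E|exfalso].
assert (Hf1 : (0 < Cmod (f z1))%R) by (apply Cmod_gt_0; exact E).
assert (Hz1 : (0 < Cmod z1)%R).
{ apply Cmod_gt_0. intros ->. exact (E H0). }
set (s := (Cmod (f z1) ^ 2)%R).
assert (Hs : (0 < s)%R) by (apply pow_lt; exact Hf1).
assert (HB0 : (0 <= B)%R) by (eapply Rle_trans; [apply Cmod_ge_0|apply (HB 0)]).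
destruct (Hc 0 (Cmod (f z1) / 2)%R) as [d0 [Hd0 Hd1]]; [lra|].
(* The inner radius: by continuity at 0, |f| is at most |f(z1)|/2 on this circle, and z1 stays
   outside or on it. *)
set (d := (Rmin (d0 / 2) (Cmod z1))%R).
assert (Hd : (0 < d)%R) by (apply Rmin_pos; lra).
assert (Hdd : (d < d0)%R) by (eapply Rle_lt_trans; [apply Rmin_l|lra]).
assert (Hdz : (d <= Cmod z1)%R) by apply Rmin_r.
assert (Hin : forall z, Cmod z = d -> (Cmod (f z) ^ 2 <= s / 4)%R).
{ intros z Ez. specialize (Hd1 z). rewrite Cplus_0_l, H0 in Hd1.
  replace (f z - 0) with (f z) in Hd1 by ring.
  assert (Hz : z <> 0) by (apply Cmod_gt_0; lra).
  specialize (Hd1 Hz ltac:(lra)). unfold s.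
  replace (Cmod (f z1) ^ 2 / 4)%R with ((Cmod (f z1) / 2) ^ 2)%R by field.
  apply pow_incr. split; [apply Cmod_ge_0|lra]. }
(* The largest factor for which eta/|z|^2 stays below s/4 outside the inner circle. *)
set (eta := (d ^ 2 * s / 4)%R).
assert (Heta : (0 < eta)%R).
{ unfold eta. assert (0 < d ^ 2)%R by (apply pow_lt; exact Hd). nra. }
set (L := (ln (Cmod z1) - ln d)%R).
assert (HL : (0 <= L)%R).
{ unfold L. assert (ln d <= ln (Cmod z1))%R by (apply ln_le; assumption). lra. }
(* The logarithmic term then costs at most s/4 at z1. Thus v(z1) is at least 3s/4, while v is at
   most s/2 on the inner circle. *)
set (eps := (s / 4 / (L + 1))%R).
assert (Heps : (0 < eps)%R) by (apply Rdiv_lt_0_compat; lra).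
assert (HepsL : (eps * L <= s / 4)%R).
{ replace (s / 4)%R with (eps * (L + 1))%R by (unfold eps; field; lra). nra. }
set (v := fun z : C => (Cmod (f z) ^ 2 + (eta * Cmod (/ z) ^ 2 + - eps * (ln (Cmod z) - ln d)))%R).
assert (Hbar : forall z, (d <= Cmod z)%R -> (eta * Cmod (/ z) ^ 2 <= s / 4)%R).
{ intros z Hz. assert (H1 : (Cmod (/ z) <= / d)%R) by (apply Cmod_inv_le; assumption).
  apply Rle_trans with (eta * (/ d) ^ 2)%R.
  - apply Rmult_le_compat_l; [lra|]. apply pow_incr. split; [apply Cmod_ge_0|exact H1].
  - right. unfold eta. field. lra. }
(* From R1 on, the logarithmic term is at least B^2 + s and makes v negative. *)
destruct (ln_unbounded (ln d + (B ^ 2 + s) / eps)) as [R1 [HR1 HlnR]].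
set (R2 := (R1 + Cmod z1)%R).
assert (Hv1 : (3 * s / 4 <= v z1)%R).
{ unfold v. fold s. fold L.
  assert (0 <= eta * Cmod (/ z1) ^ 2)%R.
  { apply Rmult_le_pos; [lra|]. apply pow2_ge_0. } lra. }
destruct (maximum_on_compact (fun z => (d <= Cmod z <= R2)%R) v R2 z1) as [w [Hw Hmax]].
- unfold R2; lra.
- intros z Hz; lra.
- apply annulus_closed.
- intros z [Hz _]. assert (Hz0 : z <> 0) by (apply Cmod_gt_0; lra).
  unfold v. apply Rcont_plus; [|apply Rcont_plus].
  + apply (Rcont_comp (fun w => Cmod (f w)) (fun x => x ^ 2)%R).
    apply Rcont_Cmod, Hc. apply derivable_continuous_pt. reg.
  + apply (Rcont_comp (fun w => Cmod (/ w)) (fun x => eta * x ^ 2)%R).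
    apply Rcont_Cmod. eapply jet_Ccont. apply jet_inv; exact Hz0.
    apply derivable_continuous_pt. reg.
  + apply (Rcont_comp (fun w => Cmod w) (fun x => - eps * (ln x - ln d))%R).
    apply Rcont_Cmod. apply Ccont_id.
    apply continuity_pt_mult. apply derivable_continuous_pt; reg.
    apply continuity_pt_minus. 2: apply derivable_continuous_pt; reg.
    apply derivable_continuous_pt. exists (/ Cmod z)%R. apply derivable_pt_lim_ln. lra.
- assert (Hvw : (3 * s / 4 <= v w)%R).
  { eapply Rle_trans. exact Hv1. apply Hmax. unfold R2; lra. }
  assert (Hlnw : (ln d <= ln (Cmod w))%R) by (apply ln_le; lra).
  assert (Hbw := Hbar w (proj1 Hw)).
  assert (Hbarw : (0 <= eps * (ln (Cmod w) - ln d))%R) by (apply Rmult_le_pos; lra).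
  (* At a zero of f only the barrier is left, which is at most s/4; so the maximum lies where f has
     a jet. *)
  destruct (HJ w) as [Hfw|[a1 [a2 Hjet]]].
  { unfold v in Hvw. rewrite Hfw, Cmod_0 in Hvw. lra. }
  assert (Hwd : (d < Cmod w)%R).
  { destruct (proj1 Hw) as [H|H]; [exact H|exfalso].
    assert (H1 := Hin w (eq_sym H)). unfold v in Hvw. lra. }
  assert (HwR : (Cmod w < R2)%R).
  { destruct (proj2 Hw) as [H|H]; [exact H|exfalso].
    assert (H1 : (ln d + (B ^ 2 + s) / eps <= ln (Cmod w))%R).
    { apply HlnR. rewrite H. unfold R2. lra. }
    assert (H2 : (Cmod (f w) ^ 2 <= B ^ 2)%R).
    { apply pow_incr. split; [apply Cmod_ge_0|apply HB]. }
    assert (H3 : (B ^ 2 + s <= eps * (ln (Cmod w) - ln d))%R).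
    { replace (B ^ 2 + s)%R with (eps * ((B ^ 2 + s) / eps))%R by (field; lra).
      apply Rmult_le_compat_l; lra. }
    unfold v in Hvw. lra. }
  assert (Hw0 : w <> 0) by (apply Cmod_gt_0; lra).
  destruct (four_sum_jet f w a1 a2 Hjet) as [K1 [r1 [Hr1 F1]]].
  destruct (four_sum_jet Cinv w _ _ (jet_inv w Hw0)) as [K2 [r2 [Hr2 F2]]].
  assert (Hwp : (0 < Cmod w)%R) by lra.
  set (q := (/ Cmod w ^ 4)%R).
  assert (Hq : (0 < q)%R) by (apply Rinv_0_lt_compat, pow_lt; lra).
  assert (Eq : (Cmod (- / w ^ 2) ^ 2 = q)%R).
  { rewrite Cmod_opp, Cmod_inv, Cmod_pow. unfold q. field. lra.
    apply Cpow_nz; exact Hw0. }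
  rewrite Eq in F2.
  set (K3 := (Rabs K1 + eta * Rabs K2 + eps * q)%R).
  assert (HK3 : (0 <= K3)%R).
  { unfold K3. generalize (Rabs_pos K1) (Rabs_pos K2). intros.
    assert (0 <= eta * Rabs K2)%R by nra. nra. }
  assert (Hpos3 : (0 < eta * q / (K3 + 1))%R) by (apply Rdiv_lt_0_compat; nra).
  assert (exists h : R, (0 < h)%R /\ (h < r1)%R /\ (h < r2)%R /\ (h < 1)%R /\
    (h < Cmod w - d)%R /\ (h < R2 - Cmod w)%R /\ (h < Cmod w)%R /\
    (h < eta * q / (K3 + 1))%R) as [h Hh].
  { set (m := Rmin (Rmin (Rmin r1 r2) (Rmin 1 (Cmod w - d)))
       (Rmin (Rmin (R2 - Cmod w) (Cmod w)) (eta * q / (K3 + 1)))).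
    assert (Hm : (0 < m)%R) by (unfold m; repeat apply Rmin_pos; lra).
    exists (m / 2)%R. assert (Hmm : (m / 2 < m)%R) by lra.
    repeat split; try lra; (eapply Rlt_le_trans; [exact Hmm|]); unfold m;
    [ eapply Rle_trans; [apply Rmin_l|]; eapply Rle_trans; [apply Rmin_l|]; apply Rmin_l
    | eapply Rle_trans; [apply Rmin_l|]; eapply Rle_trans; [apply Rmin_l|]; apply Rmin_r
    | eapply Rle_trans; [apply Rmin_l|]; eapply Rle_trans; [apply Rmin_r|]; apply Rmin_l
    | eapply Rle_trans; [apply Rmin_l|]; eapply Rle_trans; [apply Rmin_r|]; apply Rmin_r
    | eapply Rle_trans; [apply Rmin_r|]; eapply Rle_trans; [apply Rmin_l|]; apply Rmin_l
    | eapply Rle_trans; [apply Rmin_r|]; eapply Rle_trans; [apply Rmin_l|]; apply Rmin_r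
    | eapply Rle_trans; [apply Rmin_r|]; apply Rmin_r ]. }
  destruct Hh as [Hh0 [Hh1 [Hh2 [Hh3 [Hh4 [Hh5 [Hh6 Hh7]]]]]]].
  specialize (F1 h ltac:(lra)). specialize (F2 h ltac:(lra)).
  assert (F3 := four_sum_ln w h ltac:(lra)).
  assert (Hfour : (four_sum v w h <= 4 * v w)%R).
  { assert (Eh : Cmod h = h) by (rewrite Cmod_R, Rabs_pos_eq; lra).
    assert (Eih : Cmod (Ci * h) = h) by (rewrite Cmod_mult, Eh, Cmod_Ci; lra).
    assert (P : forall t, Cmod t = h -> (v (w + t)%C <= v w)%R).
    { intros t Et. apply Hmax.
      assert (T1 := Cmod_triangle_inv_plus w t). assert (T2 := Cmod_triangle w t). lra. }
    assert (P1 := P _ Eh). assert (P2 := P _ Eih).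
    assert (P3 := P (- RtoC h) ltac:(rewrite Cmod_opp; exact Eh)).
    assert (P4 := P (- (Ci * h)) ltac:(rewrite Cmod_opp; exact Eih)).
    unfold four_sum. lra. }
  assert (Esplit : (four_sum v w h = four_sum (fun t => Cmod (f t) ^ 2) w h
     + eta * four_sum (fun t => Cmod (/ t) ^ 2) w h
     - eps * (four_sum (fun t => ln (Cmod t)) w h - 4 * ln d))%R).
  { unfold four_sum, v. ring. }
  rewrite Esplit in Hfour. unfold v in Hfour.
  assert (G2 := Rmult_ge_compat_l eta _ _ ltac:(lra) F2).
  assert (G3 := Rmult_le_compat_l eps _ _ ltac:(lra) F3).
  change (h ^ 4 / Cmod w ^ 4)%R with (h ^ 4 * q)%R in G3.
  assert (Ha : (0 <= Cmod a1 ^ 2 * h ^ 2)%R) by (apply Rmult_le_pos; apply pow2_ge_0).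
  (* At the maximum the four-point sum is at most 4 v(w). As a1 may vanish, the contradiction comes
     from the barrier: the squared derivative of 1/z at w is q and gives 4 eta q h^2, against terms
     of order h^3. *)
  assert (Key : (4 * eta * q * h ^ 2 <= K1 * h ^ 3 + eta * (K2 * h ^ 3) + eps * (h ^ 4 * q))%R) by lra.
  assert (Hh3p : (0 < h ^ 3)%R) by (apply pow_lt; lra).
  assert (A1 := Rle_abs K1). assert (A2 := Rle_abs K2).
  assert (B1 : (K1 * h ^ 3 <= Rabs K1 * h ^ 3)%R) by nra.
  assert (B2 : (eta * (K2 * h ^ 3) <= eta * Rabs K2 * h ^ 3)%R).
  { rewrite Rmult_assoc. apply Rmult_le_compat_l; nra. }
  assert (B3 : (eps * (h ^ 4 * q) <= eps * q * h ^ 3)%R).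
  { replace (eps * (h ^ 4 * q))%R with (eps * q * h ^ 3 * h)%R by ring.
    assert (0 <= eps * q * h ^ 3)%R by (apply Rmult_le_pos; [nra|lra]). nra. }
  assert (B4 : (4 * eta * q * h ^ 2 <= K3 * h * h ^ 2)%R).
  { unfold K3. replace ((Rabs K1 + eta * Rabs K2 + eps * q) * h * h ^ 2)%R with
     (Rabs K1 * h ^ 3 + eta * Rabs K2 * h ^ 3 + eps * q * h ^ 3)%R by ring. lra. }
  assert (B5 : (4 * eta * q <= K3 * h)%R).
  { apply Rmult_le_reg_r with (h ^ 2)%R; [apply pow_lt; lra|exact B4]. }
  assert (B6 : (K3 * h <= eta * q)%R).
  { replace (eta * q)%R with ((K3 + 1) * (eta * q / (K3 + 1)))%R by (field; lra). nra. }
  assert (0 < eta * q)%R by nra. lra.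
Qed.


(** * Integrality over Z[e2, e3] *)

Definition csum (f : nat -> C) (n : nat) : C := Csum_nat f n.

Lemma csum_S (f : nat -> C) (n : nat) : csum f (S n) = csum f n + f n.
Proof. reflexivity. Qed.

Lemma csum_ext (f g : nat -> C) (n : nat) :
  (forall i, (i < n)%nat -> f i = g i) -> csum f n = csum g n.
Proof.
induction n as [|n IH]; intros H; [reflexivity|]. rewrite !csum_S.
rewrite IH by (intros; apply H; lia). rewrite H by lia. reflexivity.
Qed.

Lemma csum_plus (f g : nat -> C) (n : nat) :
  csum (fun i => f i + g i) n = csum f n + csum g n.
Proof.
induction n as [|n IH].
- change (RtoC 0 = RtoC 0 + RtoC 0). ring.
- rewrite !csum_S, IH. ring.
Qed.

Lemma csum_scal (c : C) (f : nat -> C) (n : nat) :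
  csum (fun i => c * f i) n = c * csum f n.
Proof.
induction n as [|n IH].
- change (RtoC 0 = c * RtoC 0). ring.
- rewrite !csum_S, IH. ring.
Qed.

Lemma csum_shift (f : nat -> C) (n : nat) :
  csum f (S n) = f 0%nat + csum (fun i => f (S i)) n.
Proof.
induction n as [|n IH].
- change (RtoC 0 + f 0%nat = f 0%nat + RtoC 0). ring.
- rewrite csum_S, IH, csum_S. ring.
Qed.

Lemma csum_extend (f : nat -> C) (d D : nat) : (d <= D)%nat ->
  (forall i, (d <= i)%nat -> f i = 0) -> csum f D = csum f d.
Proof.
intros Hd H. induction D as [|D IH].
- replace d with 0%nat by lia. reflexivity.
- destruct (Nat.eq_dec d (S D)) as [->|Hn]; [reflexivity|].
  rewrite csum_S, IH, H by lia. ring.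
Qed.

Section Integrality.

Variables e2 e3 : C.

Definition InA (y : C) : Prop := in_Z_h2h3 e2 e3 y.

Definition double_sum (c : nat -> nat -> Z) (D E : nat) : C :=
  csum (fun i => csum (fun j => RtoC (IZR (c i j)) * (e2 ^ i * e3 ^ j)) E) D.

(** Asking for all larger truncations forces the coefficients to be extended by zero; two elements
    can then be compared at a common size without aligning their degrees. *)
Definition represents (y : C) (d : nat) (c : nat -> nat -> Z) : Prop :=
  forall D E, (d <= D)%nat -> (d <= E)%nat -> y = double_sum c D E.

Lemma InA_iff_represents (y : C) : InA y <-> exists d c, represents y d c.
Proof.
split.
- intros [d [c Hy]].
  exists d, (fun i j => if (andb (Nat.ltb i d) (Nat.ltb j d)) then c i j else 0%Z).
  intros D E HD HE. unfold double_sum.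
  change (y = csum (fun i => csum (fun j => RtoC (IZR (c i j)) * (e2 ^ i * e3 ^ j)) d) d) in Hy.
  rewrite Hy.
  rewrite (csum_extend _ d D HD).
  + apply csum_ext. intros i Hi. rewrite (csum_extend _ d E HE).
    * apply csum_ext. intros j Hj.
      rewrite (proj2 (Nat.ltb_lt i d) Hi), (proj2 (Nat.ltb_lt j d) Hj). reflexivity.
    * intros j Hj. rewrite (proj2 (Nat.ltb_ge j d) Hj), Bool.andb_false_r. ring.
  + intros i Hi. rewrite (csum_extend _ 0 E); [reflexivity|lia|].
    intros j _. rewrite (proj2 (Nat.ltb_ge i d) Hi). simpl. ring.
- intros [d [c H]]. exists d, c. exact (H d d (Nat.le_refl d) (Nat.le_refl d)).
Qed.

Lemma InA_plus (y z : C) : InA y -> InA z -> InA (y + z).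
Proof.
rewrite !InA_iff_represents. intros [d [c H]] [d' [c' H']].
exists (d + d')%nat, (fun i j => (c i j + c' i j)%Z). intros D E HD HE.
rewrite (H D E) by lia. rewrite (H' D E) by lia. unfold double_sum.
rewrite <- csum_plus. apply csum_ext. intros i _.
rewrite <- csum_plus. apply csum_ext. intros j _.
rewrite plus_IZR, RtoC_plus. ring.
Qed.

Lemma InA_int_mult (k : Z) (y : C) : InA y -> InA (RtoC (IZR k) * y).
Proof.
rewrite !InA_iff_represents. intros [d [c H]].
exists d, (fun i j => (k * c i j)%Z). intros D E HD HE.
rewrite (H D E) by lia. unfold double_sum.
rewrite <- csum_scal. apply csum_ext. intros i _.
rewrite <- csum_scal. apply csum_ext. intros j _.
rewrite mult_IZR, RtoC_mult. ring.
Qed.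

Lemma InA_e2_mult (y : C) : InA y -> InA (e2 * y).
Proof.
rewrite !InA_iff_represents. intros [d [c H]].
exists (S d), (fun i j => match i with O => 0%Z | S i => c i j end).
intros D E HD HE. destruct D as [|D]; [lia|].
rewrite (H D E) by lia. unfold double_sum.
rewrite csum_shift, (csum_extend _ 0 E); [|lia|intros; ring].
rewrite <- csum_scal.
match goal with |- ?l = ?a + ?r => transitivity (RtoC 0 + r) end; [|reflexivity].
rewrite Cplus_0_l. apply csum_ext. intros i _.
rewrite <- csum_scal. apply csum_ext. intros j _. simpl. ring.
Qed.

Lemma InA_e3_mult (y : C) : InA y -> InA (e3 * y).
Proof.
rewrite !InA_iff_represents. intros [d [c H]].
exists (S d), (fun i j => match j with O => 0%Z | S j => c i j end).
intros D E HD HE. destruct E as [|E]; [lia|].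
rewrite (H D E) by lia. unfold double_sum.
rewrite <- csum_scal. apply csum_ext. intros i _.
rewrite csum_shift, <- csum_scal.
match goal with |- ?l = ?a + ?r => transitivity (RtoC 0 + r) end; [|f_equal; ring].
rewrite Cplus_0_l. apply csum_ext. intros j _. simpl. ring.
Qed.

Lemma InA_1 : InA 1.
Proof.
exists 1%nat, (fun _ _ => 1%Z).
change (RtoC 1 = RtoC 0 + (RtoC 0 + RtoC 1 * (RtoC 1 * RtoC 1))). ring.
Qed.

Lemma InA_int (k : Z) : InA (RtoC (IZR k)).
Proof. replace (RtoC (IZR k)) with (RtoC (IZR k) * 1) by ring. apply InA_int_mult, InA_1. Qed.

Lemma InA_e2 : InA e2.
Proof. replace e2 with (e2 * 1) by ring. apply InA_e2_mult, InA_1. Qed.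

Lemma InA_e3 : InA e3.
Proof. replace e3 with (e3 * 1) by ring. apply InA_e3_mult, InA_1. Qed.

Lemma InA_Csum (f : nat -> C) (n : nat) :
  (forall i, InA (f i)) -> InA (csum f n).
Proof.
intros H. induction n as [|n IH].
- exact (InA_int 0).
- rewrite csum_S. apply InA_plus; auto.
Qed.

(** Expanding one factor only reduces the product to sums and to multiplication by integers, [e2]
    and [e3]; no convolution of coefficients appears. *)
Lemma InA_mult (y z : C) : InA y -> InA z -> InA (y * z).
Proof.
intros [d [c Hy]] Hz.
change (y = csum (fun i => csum (fun j => RtoC (IZR (c i j)) * (e2 ^ i * e3 ^ j)) d) d) in Hy.
rewrite Hy, Cmult_comm. clear Hy.
rewrite <- csum_scal. apply InA_Csum. intros i.
rewrite <- csum_scal. apply InA_Csum. intros j.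
replace (z * (RtoC (IZR (c i j)) * (e2 ^ i * e3 ^ j)))
  with (RtoC (IZR (c i j)) * (e2 ^ i * (e3 ^ j * z))) by ring.
apply InA_int_mult.
assert (H3 : InA (e3 ^ j * z)).
{ induction j as [|j IH]; simpl; [rewrite Cmult_1_l; exact Hz|].
  rewrite <- Cmult_assoc. apply InA_e3_mult, IH. }
induction i as [|i IH]; simpl; [rewrite Cmult_1_l; exact H3|].
rewrite <- Cmult_assoc. apply InA_e2_mult, IH.
Qed.

Lemma InA_opp (y : C) : InA y -> InA (- y).
Proof.
intros H. replace (- y) with (RtoC (IZR (-1)) * y); [apply InA_int_mult; exact H|].
change (IZR (-1)) with (- (1))%R. rewrite RtoC_opp. ring.
Qed.

Lemma InA_pow (y : C) (n : nat) : InA y -> InA (y ^ n).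
Proof. intros H. induction n as [|n IH]; simpl. apply InA_1. apply InA_mult; assumption. Qed.

(** * Polynomial expressions in x, their degrees and leading coefficients *)

Variable x : C.

(** Some polynomial of degree below d over Z[e2, e3] takes the value w at [x]. The predicate
    concerns the number alone, so polynomials need not be constructed; the polynomial is not
    unique. *)
Fixpoint polyval (d : nat) (w : C) : Prop :=
  match d with
  | O => w = 0
  | S d => exists c w', InA c /\ polyval d w' /\ w = w' + c * x ^ d
  end.

Lemma polyval_0 (d : nat) : polyval d 0.
Proof.
induction d as [|d IH]; simpl; [reflexivity|].
exists 0, 0. split; [exact (InA_int 0)|split; [exact IH|ring]].
Qed.

Lemma polyval_S (d : nat) (w : C) : polyval d w -> polyval (S d) w.
Proof. intros H. exists 0, w. split; [exact (InA_int 0)|split; [exact H|ring]]. Qed.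

Lemma polyval_le (d d' : nat) (w : C) : (d <= d')%nat -> polyval d w -> polyval d' w.
Proof. intros H Hw. induction H; [exact Hw|apply polyval_S; assumption]. Qed.

Lemma polyval_term (c : C) (k d : nat) : InA c -> (k < d)%nat -> polyval d (c * x ^ k).
Proof.
intros Hc Hk. apply (polyval_le (S k)); [lia|].
exists c, 0. split; [exact Hc|]. split; [apply polyval_0|ring].
Qed.

Lemma polyval_plus (d : nat) (w w' : C) : polyval d w -> polyval d w' -> polyval d (w + w').
Proof.
revert w w'. induction d as [|d IH]; intros w w'; simpl.
- intros -> ->. ring.
- intros [c [v [Hc [Hv ->]]]] [c' [v' [Hc' [Hv' ->]]]].
  exists (c + c'), (v + v'). split; [apply InA_plus; assumption|].
  split; [apply IH; assumption|ring].
Qed.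

Lemma polyval_scal (d : nat) (c w : C) : InA c -> polyval d w -> polyval d (c * w).
Proof.
intros Hc. revert w. induction d as [|d IH]; intros w; simpl.
- intros ->. ring.
- intros [c' [v [Hc' [Hv ->]]]]. exists (c * c'), (c * v).
  split; [apply InA_mult; assumption|]. split; [apply IH; assumption|ring].
Qed.

Lemma polyval_monomial_mult (d k : nat) (w : C) : polyval d w -> polyval (d + k) (w * x ^ k).
Proof.
revert w. induction d as [|d IH]; intros w; simpl.
- intros ->. rewrite Cmult_0_l. apply polyval_0.
- intros [c [v [Hc [Hv ->]]]]. exists c, (v * x ^ k). split; [exact Hc|].
  split; [apply IH; exact Hv|]. rewrite Cpow_add_r. ring.
Qed.

Lemma polyval_mult (d d' : nat) (w w' : C) :
  polyval d w -> polyval d' w' -> polyval (d + d') (w * w').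
Proof.
intros Hw. revert w'. induction d' as [|d' IH]; intros w'; simpl.
- intros ->. rewrite Cmult_0_r. apply polyval_0.
- intros [c [v [Hc [Hv ->]]]].
  replace (w * (v + c * x ^ d')) with (w * v + c * (w * x ^ d')) by ring.
  apply polyval_plus; apply (polyval_le (d + d')); try lia; [apply IH; exact Hv|].
  apply polyval_scal; [exact Hc|]. apply polyval_monomial_mult; exact Hw.
Qed.

(** One number may satisfy this for several l and d. In particular [leading l d 0] is an algebraic
    equation for [x]. *)
Definition leading (l : Z) (d : nat) (w : C) : Prop :=
  exists w', polyval d w' /\ w = RtoC (IZR l) * x ^ d + w'.

Lemma leading_eq (l l' : Z) (d d' : nat) (w : C) :
  l = l' -> d = d' -> leading l d w -> leading l' d' w.
Proof. intros -> ->. auto. Qed.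

Lemma leading_mult (l l' : Z) (d d' : nat) (w w' : C) :
  leading l d w -> leading l' d' w' -> leading (l * l') (d + d') (w * w').
Proof.
intros [v [Hv ->]] [v' [Hv' ->]].
exists (RtoC (IZR l) * (v' * x ^ d) + RtoC (IZR l') * (v * x ^ d') + v * v'). split.
- apply polyval_plus; [apply polyval_plus|].
  + apply polyval_scal; [apply InA_int|]. rewrite Nat.add_comm.
    apply polyval_monomial_mult; exact Hv'.
  + apply polyval_scal; [apply InA_int|]. apply polyval_monomial_mult; exact Hv.
  + apply polyval_mult; assumption.
- rewrite mult_IZR, RtoC_mult, Cpow_add_r. ring.
Qed.

Lemma leading_minus (l l' : Z) (d : nat) (w w' : C) :
  leading l d w -> leading l' d w' -> leading (l - l') d (w - w').
Proof.
intros [v [Hv ->]] [v' [Hv' ->]].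
exists (v + - (1) * v'). split.
- apply polyval_plus; [exact Hv|]. apply polyval_scal; [|exact Hv'].
  apply InA_opp, InA_1.
- rewrite minus_IZR, RtoC_minus. ring.
Qed.

Lemma leading_1 : leading 1 0 1.
Proof. exists 0. split; [reflexivity|]. simpl. ring. Qed.

Lemma leading_pow (l : Z) (d : nat) (w : C) (n : nat) :
  leading l d w -> leading (l ^ Z.of_nat n) (n * d) (w ^ n).
Proof.
intros H. induction n as [|n IH].
- exact leading_1.
- rewrite Nat2Z.inj_succ, Z.pow_succ_r by lia. apply leading_mult; assumption.
Qed.

Definition integral_A (z : C) : Prop := integral_over_Z_h2h3 e2 e3 z.

(** A term in x^i takes l^i from the factor l^k, which is possible because i is at most k; the rest
    of l^k joins the coefficient. *)
Lemma polyval_rescale (l : Z) (d k : nat) (w : C) : (d <= S k)%nat -> polyval d w ->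
  exists coef : nat -> C, (forall i, InA (coef i)) /\
    RtoC (IZR l) ^ k * w = csum (fun i => coef i * (RtoC (IZR l) * x) ^ i) d.
Proof.
revert w. induction d as [|d IH]; intros w Hd; simpl.
- intros ->. exists (fun _ => 0). split; [intros _; exact (InA_int 0)|].
  change (RtoC (IZR l) ^ k * 0 = RtoC 0). ring.
- intros [c [v [Hc [Hv ->]]]]. destruct (IH v ltac:(lia) Hv) as [coef [Hco E]].
  exists (fun i => if Nat.ltb i d then coef i else c * RtoC (IZR l) ^ (k - d)). split.
  + intros i. destruct (Nat.ltb i d); [apply Hco|].
    apply InA_mult; [exact Hc|]. apply InA_pow, InA_int.
  + change (RtoC (IZR l) ^ k * (v + c * x ^ d) =
      csum (fun i => (if Nat.ltb i d then coef i else c * RtoC (IZR l) ^ (k - d))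
         * (RtoC (IZR l) * x) ^ i) d
      + (if Nat.ltb d d then coef d else c * RtoC (IZR l) ^ (k - d)) * (RtoC (IZR l) * x) ^ d).
    rewrite Nat.ltb_irrefl.
    rewrite (csum_ext _ (fun i => coef i * (RtoC (IZR l) * x) ^ i)).
    * rewrite <- E. rewrite Cpow_mult_l.
      assert (Ek : RtoC (IZR l) ^ k = RtoC (IZR l) ^ (k - d) * RtoC (IZR l) ^ d).
      { rewrite <- Cpow_add_r. f_equal. lia. }
      rewrite Ek. ring.
    * intros i Hi. rewrite (proj2 (Nat.ltb_lt i d) Hi). reflexivity.
Qed.

(* Multiplying l x^d + ... = 0 by l^(d-1) gives a monic equation for l x. *)
Lemma leading_zero_integral (l : Z) (d : nat) : l <> 0%Z -> leading l d 0 ->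
  integral_A (RtoC (IZR l) * x).
Proof.
intros Hl [w' [Hw E]]. destruct d as [|d].
- exfalso. simpl in Hw. rewrite Hw in E. apply Hl.
  assert (E' : RtoC 0 = RtoC (IZR l)) by (rewrite E; simpl; ring).
  apply RtoC_inj in E'. apply eq_IZR. auto.
- destruct (polyval_rescale l (S d) d w' ltac:(lia) Hw) as [coef [Hco Ec]].
  exists (S d), coef. split; [exact Hco|].
  change ((RtoC (IZR l) * x) ^ (S d)
    + csum (fun i => coef i * (RtoC (IZR l) * x) ^ i) (S d) = RtoC 0).
  rewrite <- Ec, Cpow_mult_l.
  transitivity (RtoC (IZR l) ^ d * (RtoC (IZR l) * x ^ S d + w')).
  simpl; ring. rewrite <- E. ring.
Qed.

End Integrality.

(** The equation of degree n is multiplied by k^n, distributed as k^(n-i) on the coefficient and k^i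
    on the power. It serves to pass from the exact order of u to its multiples. *)
Lemma integral_int_mult (e2 e3 z : C) (k : Z) :
  integral_A e2 e3 z -> integral_A e2 e3 (RtoC (IZR k) * z).
Proof.
intros [n [coef [Hco E]]].
exists n, (fun i => coef i * RtoC (IZR k) ^ (n - i)). split.
- intros i. apply InA_mult; [apply Hco|]. apply InA_pow, InA_int.
- change ((RtoC (IZR k) * z) ^ n
    + csum (fun i => coef i * RtoC (IZR k) ^ (n - i) * (RtoC (IZR k) * z) ^ i) n = RtoC 0).
  rewrite (csum_ext _ (fun i => RtoC (IZR k) ^ n * (coef i * z ^ i))).
  + rewrite csum_scal, Cpow_mult_l.
    transitivity (RtoC (IZR k) ^ n * (z ^ n + csum (fun i => coef i * z ^ i) n)); [ring|].
    change (z ^ n + csum (fun i => coef i * z ^ i) n = RtoC 0) in E. rewrite E. ring.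
  + intros i Hi. rewrite Cpow_mult_l.
    replace (RtoC (IZR k) ^ n) with (RtoC (IZR k) ^ (n - i) * RtoC (IZR k) ^ i); [ring|].
    rewrite <- Cpow_add_r. f_equal. lia.
Qed.

(** * The elliptic divisibility sequence of a torsion point *)

Lemma Cmult_cancel (k a b : C) : k <> 0 -> k * a = k * b -> a = b.
Proof.
intros Hk E. transitivity (/ k * (k * a)). field; exact Hk.
rewrite E. field; exact Hk.
Qed.

(* The biquadratic form with roots x(a+b), x(a-b) in X when A = x(a), B = x(b). *)
Definition biquad (e2 e3 A B X : C) : C :=
  (A - B) ^ 2 * X ^ 2
  - (2 * (A ^ 3 - e2 * A - e3 + (B ^ 3 - e2 * B - e3)) - 2 * (A + B) * (A - B) ^ 2) * X
  + ((A ^ 2 + A * B + B ^ 2 - e2) ^ 2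
     - 2 * (A + B) * (A ^ 3 - e2 * A - e3 + (B ^ 3 - e2 * B - e3))
     + (A + B) ^ 2 * (A - B) ^ 2).

(** The symmetry reflects that the form relates the abscissas of three points whose sum is zero for
    some choice of signs. The induction for [W_product] turns on it. *)
Lemma biquad_rotate (e2 e3 A B X : C) : biquad e2 e3 A B X = biquad e2 e3 B X A.
Proof. unfold biquad. ring. Qed.

Lemma biquad_roots (e2 e3 A B ya yb p q X : C) : A <> B ->
  ya ^ 2 = A ^ 3 - e2 * A - e3 -> yb ^ 2 = B ^ 3 - e2 * B - e3 ->
  (p + A + B) * (A - B) ^ 2 = (ya - yb) ^ 2 ->
  (q + A + B) * (A - B) ^ 2 = (ya + yb) ^ 2 ->
  (X - p) * (X - q) * (A - B) ^ 2 = biquad e2 e3 A B X.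
Proof.
intros HAB Ha Hb Hp Hq.
assert (HD : (A - B) ^ 2 <> 0) by (apply Cpow_nz, Cminus_eq_contra, HAB).
apply (Cmult_cancel _ _ _ HD).
set (D := (A - B) ^ 2) in *.
transitivity (((X + A + B) * D - (p + A + B) * D) * ((X + A + B) * D - (q + A + B) * D)); [ring|].
rewrite Hp, Hq.
transitivity (((X + A + B) * D) ^ 2 - (X + A + B) * D * (2 * (ya ^ 2 + yb ^ 2))
  + (ya ^ 2 - yb ^ 2) ^ 2); [ring|].
rewrite Ha, Hb. unfold D, biquad. ring.
Qed.

Section Divisibility.

Variables e2 e3 y Z : C.
Variable xs : nat -> C.
Variable m : nat.
Notation x := (xs 1).

(** The value 2y is prescribed because the recursion W(n+1) W(n-1) = W(n)^2 (x - x(n)) reads 0 = 0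
    at n = 1. *)
Fixpoint W (n : nat) : C :=
  match n with
  | O => 0
  | S n1 => match n1 with
            | O => 1
            | S k => match k with
                     | O => 2 * y
                     | S _ => W n1 ^ 2 * (x - xs n1) / W k
                     end
            end
  end.

(** These hypotheses are all that the algebra takes from function theory. The bound i + j < m keeps
    the points iu, ju and (i ± j)u off the lattice. [Z] is minus the slope of the tangent at u,
    later [zet u u]. *)
Hypothesis Hm : (3 <= m)%nat.
Hypothesis Hy : y <> 0.
Hypothesis Hcurve : y ^ 2 = x ^ 3 - e2 * x - e3.
Hypothesis Hdist : forall i j, (1 <= j < i)%nat -> (i + j < m)%nat -> xs i <> xs j.
Hypothesis Hlast : xs (m - 1) = x.
Hypothesis Hbiquad : forall i j X, (1 <= j < i)%nat -> (i + j < m)%nat ->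
  (X - xs (i + j)%nat) * (X - xs (i - j)%nat) * (xs i - xs j) ^ 2
  = biquad e2 e3 (xs i) (xs j) X.
Hypothesis Htangent : Z * (2 * y) = - (3 * x ^ 2 - e2).
Hypothesis Hdouble : xs 2 + 2 * x = Z ^ 2.
Hypothesis Htriple : (4 <= m)%nat ->
  (xs 3 + xs 2 + x) * (xs 2 - x) ^ 2 = (Z * (xs 2 - x) - y - y) ^ 2.

Lemma C2_neq_0 : RtoC 2 <> 0.
Proof. intro H. apply RtoC_inj in H. lra. Qed.

Lemma W_SSS (k : nat) : W (S (S (S k))) = W (S (S k)) ^ 2 * (x - xs (S (S k))) / W (S k).
Proof. reflexivity. Qed.

(** Each step multiplies by x - x(n), which is nonzero by [Hdist] with j = 1 as long as n + 1 < m.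
    This makes the divisions in [W] genuine. *)
Lemma W_neq_0 (n : nat) : (1 <= n < m)%nat -> W n <> 0.
Proof.
induction n as [n IH] using lt_wf_ind. intros Hn.
destruct n as [|[|[|k]]]; [lia| | |].
- intro H. apply RtoC_inj in H. lra.
- apply Cmult_neq_0; [exact C2_neq_0|exact Hy].
- rewrite W_SSS. unfold Complex.Cdiv.
  assert (H1 : W (S (S k)) <> 0) by (apply IH; lia).
  assert (H2 : W (S k) <> 0) by (apply IH; lia).
  assert (H3 : x - xs (S (S k)) <> 0).
  { apply Cminus_eq_contra. apply not_eq_sym. apply Hdist; lia. }
  apply Cmult_neq_0; [apply Cmult_neq_0; [apply Cpow_nz|]; assumption|].
  intro H. apply (Cmult_neq_0 (W (S k)) (/ W (S k))); auto.
  + intro H4. apply C1_nz. rewrite <- (Cinv_r (W (S k)) H2), H4. ring.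
  + rewrite H. ring.
Qed.

Lemma W_step (i : nat) : (2 <= i < m)%nat -> W (i + 1) * W (i - 1) = W i ^ 2 * (x - xs i).
Proof.
intros Hi. destruct i as [|[|k]]; try lia.
replace (S (S k) + 1)%nat with (S (S (S k))) by lia.
replace (S (S k) - 1)%nat with (S k) by lia.
rewrite W_SSS. field. apply W_neq_0. lia.
Qed.

Lemma W_last : W m = 0.
Proof.
destruct m as [|[|[|k]]] eqn:Em; try lia. rewrite W_SSS.
replace (S (S (S k)) - 1)%nat with (S (S k)) in Hlast by lia. rewrite Hlast.
unfold Complex.Cdiv. ring.
Qed.

Lemma W_2 : W 2 = 2 * y.
Proof. reflexivity. Qed.

(** The second base case: with two arguments equal to x(1) the form [biquad] degenerates to a linear
    one with root x(2), which the tangent formulas identify. *)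
Lemma W_product_2 (i : nat) : (3 <= i)%nat -> (i + 2 <= m)%nat ->
  W (i + 2) * W (i - 2) = W i ^ 2 * W 2 ^ 2 * (xs 2 - xs i).
Proof.
intros Hi Him.
assert (S1 := W_step (i + 1) ltac:(lia)). assert (S2 := W_step (i - 1) ltac:(lia)).
assert (S3 := W_step i ltac:(lia)).
replace (i + 1 + 1)%nat with (i + 2)%nat in S1 by lia.
replace (i + 1 - 1)%nat with i in S1 by lia.
replace (i - 1 + 1)%nat with i in S2 by lia.
replace (i - 1 - 1)%nat with (i - 2)%nat in S2 by lia.
assert (B := Hbiquad i 1 x ltac:(lia) ltac:(lia)).
assert (B2 : biquad e2 e3 (xs i) x x = 4 * y ^ 2 * (xs 2 - xs i)).
{ rewrite biquad_rotate.
  transitivity ((Z * (2 * y)) ^ 2 - 8 * x * y ^ 2 - 4 * y ^ 2 * xs i).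
  - rewrite Htangent, Hcurve. unfold biquad. ring.
  - transitivity (4 * y ^ 2 * (Z ^ 2 - 2 * x - xs i)); [ring|]. rewrite <- Hdouble. ring. }
rewrite B2 in B. clear B2.
assert (Hn : W i ^ 2 <> 0) by (apply Cpow_nz, W_neq_0; lia).
apply (Cmult_cancel _ _ _ Hn).
transitivity ((W (i + 2) * W i) * (W i * W (i - 2))); [ring|].
rewrite S1, S2.
transitivity ((W (i + 1) * W (i - 1)) ^ 2 * ((x - xs (i + 1)%nat) * (x - xs (i - 1)%nat))); [ring|].
rewrite S3.
transitivity (W i ^ 4 * ((x - xs (i + 1)%nat) * (x - xs (i - 1)%nat) * (xs i - x) ^ 2)); [ring|].
rewrite B, W_2. ring.
Qed.

(** Induction on j with two predecessors. The steps at i + j and i - j produce (x - x(i+j))(x -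
    x(i-j)); by the symmetry of [biquad] this becomes, up to squared differences, (x(i) -
    x(j+1))(x(i) - x(j-1)), the factor needed for j + 1 times the one for j - 1. Index m is allowed
    for i + j, where [W] vanishes. *)
Lemma W_product (j : nat) : (1 <= j)%nat -> forall i, (j < i)%nat -> (i + j <= m)%nat ->
  W (i + j) * W (i - j) = W i ^ 2 * W j ^ 2 * (xs j - xs i).
Proof.
induction j as [j IH] using lt_wf_ind. intros Hj i Hji Him.
destruct j as [|[|[|j0]]]; [lia| | |].
- rewrite W_step by lia. change (W 1) with (RtoC 1). ring.
- apply W_product_2; lia.
- set (j := S (S j0)) in *. assert (Hj2 : (2 <= j)%nat) by (unfold j; lia).
  assert (I1 := IH j ltac:(lia) ltac:(lia) i ltac:(lia) ltac:(lia)).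
  assert (I2 := IH (j - 1)%nat ltac:(lia) ltac:(lia) i ltac:(lia) ltac:(lia)).
  assert (S1 := W_step (i + j) ltac:(lia)). assert (S2 := W_step (i - j) ltac:(lia)).
  assert (S3 := W_step j ltac:(lia)).
  replace (i + (j - 1))%nat with (i + j - 1)%nat in I2 by lia.
  replace (i - (j - 1))%nat with (i - j + 1)%nat in I2 by lia.
  replace (S j) with (j + 1)%nat by lia.
  replace (i + (j + 1))%nat with (i + j + 1)%nat by lia.
  replace (i - (j + 1))%nat with (i - j - 1)%nat by lia.
  assert (B1 := Hbiquad i j x ltac:(lia) ltac:(lia)).
  assert (B2 := Hbiquad j 1 (xs i) ltac:(lia) ltac:(lia)).
  rewrite biquad_rotate, <- B2 in B1.
  assert (Hn1 : W (i + j - 1) <> 0) by (apply W_neq_0; lia).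
  assert (Hn2 : W (i - j + 1) <> 0) by (apply W_neq_0; lia).
  apply (Cmult_cancel _ _ _ (Cmult_neq_0 _ _ Hn1 Hn2)).
  transitivity ((W (i + j + 1) * W (i + j - 1)) * (W (i - j + 1) * W (i - j - 1))); [ring|].
  rewrite S1, S2, I2.
  transitivity ((W (i + j) * W (i - j)) ^ 2 * ((x - xs (i + j)%nat) * (x - xs (i - j)%nat))); [ring|].
  rewrite I1.
  transitivity (W i ^ 4 * W j ^ 4 * ((x - xs (i + j)%nat) * (x - xs (i - j)%nat) * (xs i - xs j) ^ 2)); [ring|].
  rewrite B1.
  transitivity (W i ^ 4 * (W j ^ 2 * (x - xs j)) ^ 2
    * ((xs i - xs (j + 1)%nat) * (xs i - xs (j - 1)%nat))); [ring|].
  rewrite <- S3. ring.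
Qed.

(** [W_product] for the pair k + 1, k, with x(k) - x(k+1) split as (x - x(k+1)) - (x - x(k)). The
    even case uses the pair k + 1, k - 1, whose difference 2 brings in 2y. *)
Lemma W_odd (k : nat) : (2 <= k)%nat -> (2 * k + 1 <= m)%nat ->
  W (2 * k + 1) = W (k + 2) * W k ^ 3 - W (k - 1) * W (k + 1) ^ 3.
Proof.
intros Hk Hkm.
assert (P := W_product k ltac:(lia) (k + 1)%nat ltac:(lia) ltac:(lia)).
assert (S1 := W_step (k + 1) ltac:(lia)). assert (S2 := W_step k ltac:(lia)).
replace (k + 1 + 1)%nat with (k + 2)%nat in S1 by lia.
replace (k + 1 - 1)%nat with k in S1 by lia.
replace (k + 1 + k)%nat with (2 * k + 1)%nat in P by lia.
replace (k + 1 - k)%nat with 1%nat in P by lia. change (W 1) with (RtoC 1) in P.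
transitivity (W (2 * k + 1) * 1); [ring|]. rewrite P.
transitivity (W k ^ 2 * (W (k + 2) * W k) - W (k + 1) ^ 2 * (W (k + 1) * W (k - 1))); [|ring].
rewrite S1, S2. ring.
Qed.

Lemma W_even (k : nat) : (3 <= k)%nat -> (2 * k <= m)%nat ->
  2 * y * W (2 * k) = W k * (W (k + 2) * W (k - 1) ^ 2 - W (k - 2) * W (k + 1) ^ 2).
Proof.
intros Hk Hkm.
assert (P := W_product (k - 1) ltac:(lia) (k + 1)%nat ltac:(lia) ltac:(lia)).
assert (S1 := W_step (k + 1) ltac:(lia)). assert (S2 := W_step (k - 1) ltac:(lia)).
replace (k + 1 + 1)%nat with (k + 2)%nat in S1 by lia.
replace (k + 1 - 1)%nat with k in S1 by lia.
replace (k - 1 + 1)%nat with k in S2 by lia.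
replace (k - 1 - 1)%nat with (k - 2)%nat in S2 by lia.
replace (k + 1 + (k - 1))%nat with (2 * k)%nat in P by lia.
replace (k + 1 - (k - 1))%nat with 2%nat in P by lia. rewrite W_2 in P.
rewrite Cmult_comm, P.
transitivity (W (k - 1) ^ 2 * (W (k + 2) * W k) - W (k + 1) ^ 2 * (W k * W (k - 2))); [|ring].
rewrite S1, S2. ring.
Qed.

Lemma W_3 : W 3 = 3 * x ^ 4 - 6 * e2 * x ^ 2 - 12 * e3 * x - e2 ^ 2.
Proof.
transitivity (12 * x * y ^ 2 - (Z * (2 * y)) ^ 2).
- rewrite W_SSS, W_2. change (W 1) with (RtoC 1).
  transitivity (4 * y ^ 2 * (3 * x - (xs 2 + 2 * x))); [field|].
  rewrite Hdouble. ring.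
- rewrite Htangent, Hcurve. ring.
Qed.

(** In [Htriple] the expression [Z * (xs 2 - x) - y] is the ordinate of 2u, so x(3) is expressed
    without any ordinate other than y. *)
Lemma W_4 : (4 <= m)%nat -> W 4 = 2 * y * (2 * (3 * x ^ 2 - e2) * W 3 - (4 * y ^ 2) ^ 2).
Proof.
intros H4. assert (T := Htriple H4).
assert (E3 : W 3 = 4 * y ^ 2 * (x - xs 2)).
{ rewrite W_SSS, W_2. change (W 1) with (RtoC 1). field. }
assert (Ed : xs 2 = Z ^ 2 - 2 * x) by (rewrite <- Hdouble; ring).
assert (Et : 3 * x ^ 2 - e2 = - (Z * (2 * y))) by (rewrite Htangent; ring).
rewrite W_SSS, W_2, Et.
assert (K : W 3 ^ 2 * (x - xs 3) = 4 * y ^ 2 * (2 * - (Z * (2 * y)) * W 3 - (4 * y ^ 2) ^ 2)).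
{ rewrite E3.
  transitivity (16 * y ^ 4 * ((2 * x + xs 2) * (xs 2 - x) ^ 2 - (xs 3 + xs 2 + x) * (xs 2 - x) ^ 2));
    [ring|].
  rewrite T. rewrite Ed at 1. ring. }
rewrite K. field. exact Hy.
Qed.

(** * Degrees and leading coefficients of the sequence W *)

Notation A := (InA e2 e3).
Notation pv := (polyval e2 e3 x).
Notation ld := (leading e2 e3 x).

Lemma leading_four_y_sqr : ld 4 3 (4 * y ^ 2).
Proof.
exists (RtoC (IZR (-4)) * e2 * x ^ 1 + RtoC (IZR (-4)) * e3 * x ^ 0). split.
- apply polyval_plus; apply polyval_term; try lia; apply InA_int_mult; [apply InA_e2|apply InA_e3].
- rewrite Hcurve. change (IZR (-4)) with (- (4))%R. rewrite RtoC_opp. ring.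
Qed.

Lemma leading_W_3 : ld 3 4 (W 3).
Proof.
rewrite W_3.
exists (RtoC (IZR (-6)) * e2 * x ^ 2 + RtoC (IZR (-12)) * e3 * x ^ 1
  + RtoC (IZR (-1)) * (e2 * e2) * x ^ 0). split.
- repeat apply polyval_plus; apply polyval_term; try lia; apply InA_int_mult;
    [apply InA_e2|apply InA_e3|apply InA_mult; apply InA_e2].
- change (IZR (-6)) with (- (6))%R. change (IZR (-12)) with (- (12))%R.
  change (IZR (-1)) with (- (1))%R. rewrite !RtoC_opp. ring.
Qed.

(** Both terms have degree 6, and 18 - 16 = 2 is half of the index 4, as it has to be after removing
    2y. *)
Lemma leading_v4 : ld 2 6 (2 * (3 * x ^ 2 - e2) * W 3 - (4 * y ^ 2) ^ 2).
Proof.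
apply (leading_eq _ _ _ (6 * 3 - 4 ^ Z.of_nat 2) _ 6); [reflexivity|reflexivity|].
apply leading_minus.
- apply (leading_eq _ _ _ (6 * 3) _ (2 + 4)); [reflexivity|reflexivity|].
  apply leading_mult; [|exact leading_W_3].
  exists (RtoC (IZR (-2)) * e2 * x ^ 0). split.
  + apply polyval_term; [|lia]. apply InA_int_mult, InA_e2.
  + change (IZR (-2)) with (- (2))%R. rewrite RtoC_opp. ring.
- apply (leading_pow _ _ _ 4 3 _ 2). exact leading_four_y_sqr.
Qed.

(* Even terms carry the factor 2y, so the recurrences are stated for W/(2y) there;
   (2y)^2 = 4 y^2 is a polynomial in x. *)
Lemma leading_W (n : nat) : (1 <= n <= m)%nat ->
  (forall j, n = (2 * j + 1)%nat -> ld (2 * Z.of_nat j + 1) (2 * j * (j + 1)) (W n)) /\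
  (forall j, n = (2 * j)%nat ->
     exists v, W n = 2 * y * v /\ ld (Z.of_nat j) (2 * j * j - 2) v).
Proof.
induction n as [n IH] using lt_wf_ind. intros Hn.
assert (IHo : forall j, (2 * j + 1 < n)%nat ->
  ld (2 * Z.of_nat j + 1) (2 * j * (j + 1)) (W (2 * j + 1))).
{ intros j Hj. apply (IH (2 * j + 1)%nat); [exact Hj|lia|reflexivity]. }
assert (IHe : forall j, (1 <= j)%nat -> (2 * j < n)%nat ->
  exists v, W (2 * j) = 2 * y * v /\ ld (Z.of_nat j) (2 * j * j - 2) v).
{ intros j Hj0 Hj. apply (IH (2 * j)%nat); [exact Hj|lia|reflexivity]. }
assert (F2 := leading_pow _ _ _ 4 3 _ 2 leading_four_y_sqr).
split; intros j ->.
- destruct j as [|[|j0]].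
  + apply leading_1.
  + apply leading_W_3.
  + set (j := S (S j0)) in *. rewrite W_odd by lia.
    (* In exactly one of the two products of [W_odd] all four factors have even index; that one
       carries (2y)^4 = (4y^2)^2. *)
    destruct (Nat.Even_or_Odd j) as [[i Ei]|[i Ei]].
    * rewrite Ei.
      destruct (IHe (i + 1)%nat ltac:(lia) ltac:(lia)) as [v1 [E1 L1]].
      destruct (IHe i ltac:(lia) ltac:(lia)) as [v0 [E0 L0]].
      assert (Lm := IHo (i - 1)%nat ltac:(lia)). assert (Lp := IHo i ltac:(lia)).
      replace (2 * i + 2)%nat with (2 * (i + 1))%nat by lia.
      replace (2 * i - 1)%nat with (2 * (i - 1) + 1)%nat by lia.
      rewrite E1, E0.
      replace (2 * y * v1 * (2 * y * v0) ^ 3) with ((4 * y ^ 2) ^ 2 * (v1 * v0 ^ 3)) by ring.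
      assert (T1 := leading_mult _ _ _ _ _ _ _ _ _ F2
        (leading_mult _ _ _ _ _ _ _ _ _ L1 (leading_pow _ _ _ _ _ _ 3 L0))).
      assert (T2 := leading_mult _ _ _ _ _ _ _ _ _ Lm (leading_pow _ _ _ _ _ _ 3 Lp)).
      eapply leading_eq in T2; [|reflexivity|].
      assert (T := leading_minus _ _ _ _ _ _ _ _ T1 T2).
      eapply leading_eq; [| |exact T].
      (* The leading coefficients close up because the sequence of integers n satisfies the same
         recurrences. *)
      { rewrite Nat2Z.inj_add, Nat2Z.inj_sub, Nat2Z.inj_mul by lia. simpl Z.of_nat. ring. }
      { nia. }
      { destruct i as [|i]; [lia|]. replace (S i - 1)%nat with i by lia. nia. }
    * rewrite Ei.
      destruct (IHe (i + 1)%nat ltac:(lia) ltac:(lia)) as [v1 [E1 L1]].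
      destruct (IHe i ltac:(lia) ltac:(lia)) as [v0 [E0 L0]].
      assert (Lm := IHo (i + 1)%nat ltac:(lia)). assert (Lp := IHo i ltac:(lia)).
      replace (2 * i + 1 + 2)%nat with (2 * (i + 1) + 1)%nat by lia.
      replace (2 * i + 1 - 1)%nat with (2 * i)%nat by lia.
      replace (2 * i + 1 + 1)%nat with (2 * (i + 1))%nat by lia.
      rewrite E1, E0.
      replace (2 * y * v0 * (2 * y * v1) ^ 3) with ((4 * y ^ 2) ^ 2 * (v0 * v1 ^ 3)) by ring.
      assert (T1 := leading_mult _ _ _ _ _ _ _ _ _ F2
        (leading_mult _ _ _ _ _ _ _ _ _ L0 (leading_pow _ _ _ _ _ _ 3 L1))).
      assert (T2 := leading_mult _ _ _ _ _ _ _ _ _ Lm (leading_pow _ _ _ _ _ _ 3 Lp)).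
      eapply leading_eq in T1; [|reflexivity|].
      assert (T := leading_minus _ _ _ _ _ _ _ _ T2 T1).
      eapply leading_eq; [| |exact T].
      { rewrite !Nat2Z.inj_add, !Nat2Z.inj_mul. simpl Z.of_nat. ring. }
      { nia. }
      { nia. }
- destruct j as [|[|[|j0]]]; [lia| | |].
  + exists 1. split; [change (W (2 * 1)) with (2 * y); ring|apply leading_1].
  + eexists. split; [apply W_4; lia|apply leading_v4].
  + set (j := S (S (S j0))) in *.
    assert (R := W_even j ltac:(lia) ltac:(lia)).
    assert (H2y : 2 * y <> 0) by (apply Cmult_neq_0; [exact C2_neq_0|exact Hy]).
    (* For either parity of j, both products on the right of [W_even] contain (2y)^2. One factor
       cancels the 2y on the left and the other is the one to be split off, so no power of y
       remains. *)
    destruct (Nat.Even_or_Odd j) as [[i Ei]|[i Ei]].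
    * rewrite Ei in R |- *.
      destruct (IHe (i + 1)%nat ltac:(lia) ltac:(lia)) as [v1 [E1 L1]].
      destruct (IHe i ltac:(lia) ltac:(lia)) as [v0 [E0 L0]].
      destruct (IHe (i - 1)%nat ltac:(lia) ltac:(lia)) as [vm [Em Lvm]].
      assert (Lm := IHo (i - 1)%nat ltac:(lia)). assert (Lp := IHo i ltac:(lia)).
      replace (2 * i + 2)%nat with (2 * (i + 1))%nat in R by lia.
      replace (2 * i - 1)%nat with (2 * (i - 1) + 1)%nat in R by lia.
      replace (2 * i - 2)%nat with (2 * (i - 1))%nat in R by lia.
      rewrite E1, E0, Em in R.
      exists (v0 * (v1 * W (2 * (i - 1) + 1) ^ 2 - vm * W (2 * i + 1) ^ 2)). split.
      { apply (Cmult_cancel _ _ _ H2y). rewrite R. ring. }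
      assert (T1 := leading_mult _ _ _ _ _ _ _ _ _ L1 (leading_pow _ _ _ _ _ _ 2 Lm)).
      assert (T2 := leading_mult _ _ _ _ _ _ _ _ _ Lvm (leading_pow _ _ _ _ _ _ 2 Lp)).
      eapply leading_eq in T2; [|reflexivity|].
      assert (T := leading_mult _ _ _ _ _ _ _ _ _ L0 (leading_minus _ _ _ _ _ _ _ _ T1 T2)).
      eapply leading_eq; [| |exact T].
      { rewrite Nat2Z.inj_add, !Nat2Z.inj_sub, Nat2Z.inj_mul by lia. simpl Z.of_nat. ring. }
      { destruct i as [|i]; [lia|]. replace (S i - 1)%nat with i by lia. nia. }
      { destruct i as [|[|i]]; [lia|lia|]. replace (S (S i) - 1)%nat with (S i) by lia. nia. }
    * rewrite Ei in R |- *.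
      destruct (IHe (i + 1)%nat ltac:(lia) ltac:(lia)) as [v1 [E1 L1]].
      destruct (IHe i ltac:(lia) ltac:(lia)) as [v0 [E0 L0]].
      assert (Lq := IHo (i + 1)%nat ltac:(lia)). assert (Lp := IHo i ltac:(lia)).
      assert (Lm := IHo (i - 1)%nat ltac:(lia)).
      replace (2 * i + 1 + 2)%nat with (2 * (i + 1) + 1)%nat in R by lia.
      replace (2 * i + 1 - 1)%nat with (2 * i)%nat in R by lia.
      replace (2 * i + 1 - 2)%nat with (2 * (i - 1) + 1)%nat in R by lia.
      replace (2 * i + 1 + 1)%nat with (2 * (i + 1))%nat in R by lia.
      rewrite E1, E0 in R.
      exists (W (2 * i + 1) * (W (2 * (i + 1) + 1) * v0 ^ 2 - W (2 * (i - 1) + 1) * v1 ^ 2)). split.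
      { apply (Cmult_cancel _ _ _ H2y). rewrite R. ring. }
      assert (T1 := leading_mult _ _ _ _ _ _ _ _ _ Lq (leading_pow _ _ _ _ _ _ 2 L0)).
      assert (T2 := leading_mult _ _ _ _ _ _ _ _ _ Lm (leading_pow _ _ _ _ _ _ 2 L1)).
      eapply leading_eq in T2; [|reflexivity|].
      assert (T := leading_mult _ _ _ _ _ _ _ _ _ Lp (leading_minus _ _ _ _ _ _ _ _ T1 T2)).
      eapply leading_eq; [| |exact T].
      { rewrite !Nat2Z.inj_add, !Nat2Z.inj_sub, !Nat2Z.inj_mul by lia. simpl Z.of_nat. ring. }
      { nia. }
      { destruct i as [|i]; [lia|]. replace (S i - 1)%nat with i by lia. nia. }
Qed.

Lemma torsion_integral_odd (j : nat) : m = (2 * j + 1)%nat ->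
  integral_A e2 e3 (RtoC (IZR (2 * Z.of_nat j + 1)) * x).
Proof.
intros Ej. assert (L := proj1 (leading_W m ltac:(lia)) j Ej). rewrite W_last in L.
eapply leading_zero_integral; [lia|exact L].
Qed.

Lemma torsion_integral_even (j : nat) : m = (2 * j)%nat ->
  integral_A e2 e3 (RtoC (IZR (Z.of_nat j)) * x).
Proof.
intros Ej. destruct (proj2 (leading_W m ltac:(lia)) j Ej) as [v [E L]].
rewrite W_last in E.
assert (Hv : v = 0).
{ assert (H2y : 2 * y <> 0) by (apply Cmult_neq_0; [exact C2_neq_0|exact Hy]).
  apply (Cmult_cancel _ _ _ H2y). rewrite <- E. ring. }
rewrite Hv in L. eapply leading_zero_integral; [lia|exact L].
Qed.

End Divisibility.


(** * Lattices *)

Section Lattice.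

Variables w1 w2 : C.
Hypothesis basis : lattice_basis w1 w2.

Definition om (a b : Z) : C := RtoC (IZR a) * w1 + RtoC (IZR b) * w2.

Definition Lat (z : C) : Prop := exists a b : Z, z = om a b.

Lemma om_plus (a b c d : Z) : om (a + c) (b + d) = om a b + om c d.
Proof. unfold om. rewrite !plus_IZR, !RtoC_plus. ring. Qed.

Lemma om_opp (a b : Z) : om (- a) (- b) = - om a b.
Proof. unfold om. rewrite !opp_IZR, !RtoC_opp. ring. Qed.

Lemma om_0 : om 0 0 = 0.
Proof. unfold om. ring. Qed.

Lemma om_1_0 : om 1 0 = w1.
Proof. unfold om. ring. Qed.

Lemma om_0_1 : om 0 1 = w2.
Proof. unfold om. ring. Qed.

Lemma Lat_om (a b : Z) : Lat (om a b).
Proof. exists a, b. reflexivity. Qed.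

Lemma Lat_0 : Lat 0.
Proof. exists 0%Z, 0%Z. symmetry. apply om_0. Qed.

Lemma Lat_plus (z w : C) : Lat z -> Lat w -> Lat (z + w).
Proof.
intros [a [b ->]] [c [d ->]]. exists (a + c)%Z, (b + d)%Z. symmetry. apply om_plus.
Qed.

Lemma Lat_opp (z : C) : Lat z -> Lat (- z).
Proof. intros [a [b ->]]. exists (- a)%Z, (- b)%Z. symmetry. apply om_opp. Qed.

Lemma Lat_minus (z w : C) : Lat z -> Lat w -> Lat (z - w).
Proof. intros Hz Hw. apply Lat_plus; [exact Hz|apply Lat_opp; exact Hw]. Qed.

Lemma not_Lat_neq_0 (z : C) : ~ Lat z -> z <> 0.
Proof. intros H ->. exact (H Lat_0). Qed.

Lemma not_Lat_opp (z : C) : ~ Lat z -> ~ Lat (- z).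
Proof. intros H H1. apply H. replace z with (- - z) by ring. apply Lat_opp, H1. Qed.

Lemma not_Lat_plus (z w : C) : ~ Lat z -> Lat w -> ~ Lat (z + w).
Proof.
intros H Hw H1. apply H. replace z with (z + w - w) by ring. apply Lat_minus; assumption.
Qed.

(** Cramer's rule: each of a, b times the determinant is a linear combination of the coordinates of
    [om a b], with coefficients bounded by those of the basis. *)
Lemma om_lower_weak : exists k : R, (0 < k)%R /\
  forall a b, (k * (idx_size a b - 1) <= Cmod (om a b))%R.
Proof.
unfold lattice_basis in basis.
set (D := (fst w1 * snd w2 - snd w1 * fst w2)%R) in *.
set (S := (Rabs (fst w1) + Rabs (snd w1) + Rabs (fst w2) + Rabs (snd w2) + 1)%R).
generalize (Rabs_pos (fst w1)) (Rabs_pos (snd w1)) (Rabs_pos (fst w2)) (Rabs_pos (snd w2)).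
intros p1 p2 p3 p4.
assert (HS : (0 < S)%R) by (unfold S; lra).
assert (HD : (0 < Rabs D)%R) by (apply Rabs_pos_lt; exact basis).
exists (Rabs D / S)%R. split; [apply Rdiv_lt_0_compat; assumption|].
intros a b. unfold idx_size.
replace (1 + IZR (Z.max (Z.abs a) (Z.abs b)) - 1)%R
  with (IZR (Z.max (Z.abs a) (Z.abs b))) by ring.
assert (H : forall c e f : R,
  (c * D = fst (om a b) * e + snd (om a b) * f)%R ->
  (Rabs e + Rabs f <= S)%R -> (Rabs D / S * Rabs c <= Cmod (om a b))%R).
{ intros c e f E Hef.
  apply Rmult_le_reg_r with S; [exact HS|].
  replace (Rabs D / S * Rabs c * S)%R with (Rabs c * Rabs D)%R by (field; lra).
  rewrite <- Rabs_mult, E.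
  eapply Rle_trans. apply Rabs_triang. rewrite !Rabs_mult.
  generalize (Rabs_fst_le_Cmod (om a b)) (Rabs_snd_le_Cmod (om a b)) (Cmod_ge_0 (om a b)).
  generalize (Rabs_pos e) (Rabs_pos f). intros.
  assert (Rabs (fst (om a b)) * Rabs e <= Cmod (om a b) * Rabs e)%R by nra.
  assert (Rabs (snd (om a b)) * Rabs f <= Cmod (om a b) * Rabs f)%R by nra.
  nra. }
destruct (Z.max_spec (Z.abs a) (Z.abs b)) as [[_ ->]|[_ ->]]; rewrite abs_IZR.
- apply (H (IZR b) (- snd w1)%R (fst w1)).
  + unfold om, D. simpl. ring.
  + rewrite Rabs_Ropp. unfold S. lra.
- apply (H (IZR a) (snd w2) (- fst w2)%R).
  + unfold om, D. simpl. ring.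
  + rewrite Rabs_Ropp. unfold S. lra.
Qed.

Lemma idx_size_ge_2 (a b : Z) : (a <> 0 \/ b <> 0)%Z -> (2 <= idx_size a b)%R.
Proof.
intros H. unfold idx_size.
assert (1 <= IZR (Z.max (Z.abs a) (Z.abs b)))%R; [|lra]. apply IZR_le. lia.
Qed.

Lemma om_lower : exists k : R, (0 < k)%R /\
  forall a b, (a <> 0 \/ b <> 0)%Z -> (k * idx_size a b <= Cmod (om a b))%R.
Proof.
destruct om_lower_weak as [k [Hk H]]. exists (k / 2)%R. split; [lra|].
intros a b Hab. specialize (H a b). assert (H2 := idx_size_ge_2 a b Hab). nra.
Qed.

Lemma om_neq_0 (a b : Z) : (a <> 0 \/ b <> 0)%Z -> om a b <> 0.
Proof.
intros H. destruct om_lower as [k [Hk HL]]. specialize (HL a b H).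
apply Cmod_gt_0. assert (H1 := idx_size_ge_1 a b). nra.
Qed.

Lemma finite_common_bound (P : Z -> R -> Prop) :
  (forall k c c', (0 < c' <= c)%R -> P k c -> P k c') ->
  (forall k, exists c : R, (0 < c)%R /\ P k c) ->
  forall N : nat, exists c : R, (0 < c)%R /\
    forall k, (Z.abs k <= Z.of_nat N)%Z -> P k c.
Proof.
intros Hd He. induction N as [|N [c [Hc IH]]].
- destruct (He 0%Z) as [c [Hc H]]. exists c. split; [exact Hc|].
  intros k Hk. replace k with 0%Z by lia. exact H.
- destruct (He (Z.of_nat (S N))) as [c1 [Hc1 H1]].
  destruct (He (- Z.of_nat (S N))%Z) as [c2 [Hc2 H2]].
  set (m := Rmin c (Rmin c1 c2)).
  assert (Hm : (0 < m)%R) by (unfold m; repeat apply Rmin_pos; assumption).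
  assert (m <= c)%R by apply Rmin_l.
  assert (m <= c1)%R by (eapply Rle_trans; [apply Rmin_r|apply Rmin_l]).
  assert (m <= c2)%R by (eapply Rle_trans; [apply Rmin_r|apply Rmin_r]).
  exists m. split; [exact Hm|]. intros k Hk.
  destruct (Z_le_gt_dec (Z.abs k) (Z.of_nat N)) as [Hl|Hg].
  + apply Hd with c; [lra|]. apply IH. exact Hl.
  + destruct (Z_le_gt_dec 0 k).
    * replace k with (Z.of_nat (S N)) by lia. apply Hd with c1; [lra|exact H1].
    * replace k with (- Z.of_nat (S N))%Z by lia. apply Hd with c2; [lra|exact H2].
Qed.

(** One inequality for two facts: z has positive distance from the lattice, and the distance grows
    linearly with the index. Far indices follow from [om_lower_weak]; the finitely many others each
    have a positive constant. *)
Lemma lattice_distance (z : C) : ~ Lat z ->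
  exists k : R, (0 < k)%R /\ forall a b, (k * idx_size a b <= Cmod (z - om a b))%R.
Proof.
intros Hz. destruct om_lower_weak as [k [Hk H]].
destruct (nfloor_ex (2 * (k + Cmod z) / k)) as [N HN].
{ apply Rdiv_le_0_compat; [|exact Hk]. generalize (Cmod_ge_0 z). lra. }
assert (HN' : (2 * (k + Cmod z) <= k * (INR N + 1))%R).
{ replace (2 * (k + Cmod z))%R with (k * (2 * (k + Cmod z) / k))%R by (field; lra).
  apply Rmult_le_compat_l; lra. }
destruct (finite_common_bound
  (fun a c => forall b, (Z.abs b <= Z.of_nat N)%Z -> (c * (INR N + 1) <= Cmod (z - om a b))%R))
  with (N := N) as [c [Hc Hfin]].
- intros a c c' Hc Hb b Hbn. specialize (Hb b Hbn).
  assert (HNp := pos_INR N). nra.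
- intros a. apply (finite_common_bound
    (fun b c => (c * (INR N + 1) <= Cmod (z - om a b))%R)).
  + intros b c c' Hc Hb. assert (HNp := pos_INR N). nra.
  + intros b. assert (Hp : (0 < Cmod (z - om a b))%R).
    { apply Cmod_gt_0. intro E. apply Hz. exists a, b. apply Ceq_minus. exact E. }
    assert (HNp := pos_INR N).
    exists (Cmod (z - om a b) / (INR N + 1))%R. split.
    apply Rdiv_lt_0_compat; lra. right. field. lra.
- exists (Rmin c (k / 2)). split; [apply Rmin_pos; lra|]. intros a b.
  assert (Hi := idx_size_ge_1 a b).
  destruct (Z_le_gt_dec (Z.max (Z.abs a) (Z.abs b)) (Z.of_nat N)) as [Hl|Hg].
  + eapply Rle_trans. 2: apply (Hfin a ltac:(lia) b ltac:(lia)).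
    apply Rmult_le_compat; try lra. apply Rmin_glb; lra. apply Rmin_l.
    unfold idx_size. rewrite INR_IZR_INZ. apply IZR_le in Hl. lra.
  + assert (T := Cmod_triangle_inv (om a b) z). rewrite Cmod_minus_sym in T.
    specialize (H a b).
    assert (Hi2 : (INR N + 1 <= idx_size a b - 1)%R).
    { unfold idx_size. rewrite INR_IZR_INZ. rewrite <- plus_IZR.
      ring_simplify. apply IZR_le. lia. }
    assert (k * (INR N + 1) <= k * (idx_size a b - 1))%R by (apply Rmult_le_compat_l; lra).
    apply Rle_trans with (k / 2 * idx_size a b)%R.
    apply Rmult_le_compat_r; [lra|apply Rmin_r]. lra.
Qed.

Lemma near0_not_Lat (z : C) : ~ Lat z -> near0 (fun h => ~ Lat (z + h)).
Proof.
intros Hz. destruct (lattice_distance z Hz) as [k [Hk H]].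
eapply near0_imp. 2: apply (near0_lt k Hk). simpl. intros h Hh [a [b E]].
specialize (H a b). assert (Hi := idx_size_ge_1 a b).
replace (z - om a b) with (- h) in H. rewrite Cmod_opp in H. nra.
rewrite <- E. ring.
Qed.

Lemma near0_Lat_0 : near0 (fun h => ~ Lat h).
Proof.
destruct om_lower as [k [Hk H]]. exists k. split; [exact Hk|].
intros h H0 Hh [a [b E]].
destruct (Z.eq_dec a 0) as [Ea|Ea].
- destruct (Z.eq_dec b 0) as [Eb|Eb].
  + subst. apply H0. apply om_0.
  + specialize (H a b (or_intror Eb)). rewrite <- E in H.
    assert (Hi := idx_size_ge_1 a b). nra.
- specialize (H a b (or_introl Ea)). rewrite <- E in H.
  assert (Hi := idx_size_ge_1 a b). nra.
Qed.

Lemma real_coordinates (z : C) : exists s t : R, z = RtoC s * w1 + RtoC t * w2.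
Proof.
unfold lattice_basis in basis. destruct z as [x y], w1 as [x1 y1], w2 as [x2 y2].
simpl in basis.
exists ((x * y2 - y * x2) / (x1 * y2 - y1 * x2))%R, ((x1 * y - y1 * x) / (x1 * y2 - y1 * x2))%R.
unfold Complex.RtoC, Cplus, Cmult; simpl. f_equal; field; exact basis.
Qed.

Lemma fundamental_cell (z : C) : exists (a b : Z) (w : C),
  z = w + om a b /\ (Cmod w <= Cmod w1 + Cmod w2)%R.
Proof.
destruct (real_coordinates z) as [s [t ->]].
destruct (floor_ex s) as [a Ha]. destruct (floor_ex t) as [b Hb].
exists a, b, (RtoC (s - IZR a) * w1 + RtoC (t - IZR b) * w2). split.
- unfold om. rewrite !RtoC_minus. ring.
- eapply Rle_trans. apply Cmod_triangle. rewrite !Cmod_mult, !Cmod_R.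
  rewrite !Rabs_pos_eq by lra.
  generalize (Cmod_ge_0 w1) (Cmod_ge_0 w2). intros. nra.
Qed.

(** Continuity bounds f on a disc containing a fundamental cell, and periodicity carries the bound
    to the plane. *)
Lemma elliptic_zero (f : C -> C) :
  (forall z a b, f (z + om a b) = f z) -> (forall z, Ccont f z) -> f 0 = 0 ->
  (forall z, f z = 0 \/ exists a1 a2, jet f z a1 a2) ->
  forall z, f z = 0.
Proof.
intros Hper Hc H0 HJ.
destruct (locally_bounded_bounded (fun z => (Cmod z <= Cmod w1 + Cmod w2)%R)
  (fun z => Cmod (f z)) (Cmod w1 + Cmod w2)) as [B HB].
- auto.
- intros z. destruct (Rcont_pt _ z 1 (Rcont_Cmod f z (Hc z))) as [d [Hd H]]; [lra|].
  exists d, (Cmod (f z) + 1)%R. split; [exact Hd|]. intros w _ Hw.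
  specialize (H w Hw). apply Rabs_lt_between in H. lra.
- apply liouville_zero with B; auto.
  intros z. destruct (fundamental_cell z) as [a [b [w [-> Hw]]]]. rewrite Hper. auto.
Qed.

(** * Families of lattice terms, uniformly of a given order *)

(** Order 3 is summability with a bound uniform in h. Orders add under products, so convergence is
    decided by counting inverse factors. *)
Definition unif (k : nat) (F : C -> Z -> Z -> C) : Prop :=
  exists M : R, (0 <= M)%R /\
    near0 (fun h => forall a b, (Cmod (F h a b) <= M / idx_size a b ^ k)%R).

Lemma idx_pow_pos (a b : Z) (k : nat) : (0 < idx_size a b ^ k)%R.
Proof. apply pow_lt. generalize (idx_size_ge_1 a b). lra. Qed.

Lemma unif_mult (j k : nat) (F G : C -> Z -> Z -> C) :
  unif j F -> unif k G -> unif (j + k) (fun h a b => F h a b * G h a b).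
Proof.
intros [M [HM HF]] [M' [HM' HG]]. exists (M * M')%R. split; [nra|].
eapply near0_imp. 2: apply (near0_and _ _ HF HG). simpl. intros h [H1 H2] a b.
rewrite Cmod_mult, pow_add.
replace (M * M' / (idx_size a b ^ j * idx_size a b ^ k))%R
  with ((M / idx_size a b ^ j) * (M' / idx_size a b ^ k))%R.
apply Rmult_le_compat; auto using Cmod_ge_0.
field. generalize (idx_pow_pos a b j) (idx_pow_pos a b k). lra.
Qed.

Lemma unif_plus (k : nat) (F G : C -> Z -> Z -> C) :
  unif k F -> unif k G -> unif k (fun h a b => F h a b + G h a b).
Proof.
intros [M [HM HF]] [M' [HM' HG]]. exists (M + M')%R. split; [lra|].
eapply near0_imp. 2: apply (near0_and _ _ HF HG). simpl. intros h [H1 H2] a b.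
eapply Rle_trans. apply Cmod_triangle. unfold Rdiv. rewrite Rmult_plus_distr_r.
apply Rplus_le_compat; auto.
Qed.

Lemma unif_opp (k : nat) (F : C -> Z -> Z -> C) :
  unif k F -> unif k (fun h a b => - F h a b).
Proof.
intros [M [HM HF]]. exists M. split; [exact HM|].
eapply near0_imp. 2: apply HF. simpl. intros h H a b. rewrite Cmod_opp. auto.
Qed.

Lemma unif_weaken (j k : nat) (F : C -> Z -> Z -> C) :
  (j <= k)%nat -> unif k F -> unif j F.
Proof.
intros Hjk [M [HM HF]]. exists M. split; [exact HM|].
eapply near0_imp. 2: apply HF. simpl. intros h H a b.
eapply Rle_trans. apply H. unfold Rdiv. apply Rmult_le_compat_l; [exact HM|].
apply Rinv_le_contravar. apply idx_pow_pos. apply Rle_pow; [|exact Hjk].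
apply idx_size_ge_1.
Qed.

Lemma unif_ext (k : nat) (F G : C -> Z -> Z -> C) :
  near0 (fun h => forall a b, F h a b = G h a b) -> unif k F -> unif k G.
Proof.
intros E [M [HM HF]]. exists M. split; [exact HM|].
eapply near0_imp. 2: apply (near0_and _ _ E HF). simpl. intros h [H1 H2] a b.
rewrite <- H1. apply H2.
Qed.

Lemma unif_scalar (c : C -> C) : bnd c -> unif 0 (fun h _ _ => c h).
Proof.
intros [K [HK H]]. exists K. split; [exact HK|].
eapply near0_imp. 2: apply H. simpl. intros h Hh _ _. lra.
Qed.

Lemma unif_scale (k : nat) (c : C -> C) (F : C -> Z -> Z -> C) :
  bnd c -> unif k F -> unif k (fun h a b => c h * F h a b).
Proof. intros Hc HF. apply (unif_mult 0 k (fun h _ _ => c h) F); [apply unif_scalar|]; assumption. Qed.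

Lemma unif_pow (k n : nat) (F : C -> Z -> Z -> C) :
  unif k F -> unif (n * k) (fun h a b => F h a b ^ n).
Proof.
intros H. induction n as [|n IH].
- apply (unif_scalar (fun _ => 1)). apply bnd_const.
- apply (unif_mult k (n * k) F (fun h a b => F h a b ^ n)); assumption.
Qed.

Lemma unif_at_origin (k : nat) (c : C) : unif k (fun _ => at_origin c).
Proof.
exists (Cmod c). split; [apply Cmod_ge_0|]. apply near0_all. intros _ a b.
unfold at_origin. destruct (Z.eqb_spec a 0), (Z.eqb_spec b 0); simpl.
2-4: rewrite Cmod_0; apply Rdiv_le_0_compat; [apply Cmod_ge_0|apply idx_pow_pos].
subst. rewrite idx_size_0, pow1. lra.
Qed.

Lemma unif_summable (f : Z -> Z -> C) : unif 3 (fun _ => f) -> exists M, summable M f.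
Proof.
intros [M [HM H]]. exists M. destruct (near0_ex _ H) as [h [_ Hh]]. exact Hh.
Qed.

Lemma unif_bnd_lat_sum (F : C -> Z -> Z -> C) :
  unif 3 F -> bnd (fun h => lat_sum (F h)).
Proof.
intros [M [HM H]]. exists (9 * M)%R. split; [lra|].
eapply near0_imp. 2: apply H. simpl. intros h Hh. apply lat_sum_Cmod_le. exact Hh.
Qed.

Lemma unif_near_summable (F : C -> Z -> Z -> C) :
  unif 3 F -> near0 (fun h => exists M, summable M (F h)).
Proof.
intros [M [HM H]]. eapply near0_imp. 2: apply H. intros h Hh. exists M. exact Hh.
Qed.

(** Termwise expansion: the remainders divided by h^3 are again a family of order 3 uniformly in h,
    so only linearity of the sum is involved. *)
Lemma lat_sum_jet (F : C -> Z -> Z -> C) (z : C) (F1 F2 : Z -> Z -> C)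
  (G : C -> Z -> Z -> C) :
  unif 3 (fun _ => F z) -> unif 3 (fun _ => F1) -> unif 3 (fun _ => F2) -> unif 3 G ->
  near0 (fun h => forall a b,
    F (z + h) a b = F z a b + h * F1 a b + h ^ 2 * F2 a b + h ^ 3 * G h a b) ->
  jet (fun x => lat_sum (F x)) z (lat_sum F1) (lat_sum F2).
Proof.
intros H0 H1 H2 HG HE. exists (fun h => lat_sum (G h)).
split; [apply unif_bnd_lat_sum; exact HG|].
destruct (unif_summable _ H0) as [M0 S0]. destruct (unif_summable _ H1) as [M1 S1].
destruct (unif_summable _ H2) as [M2 S2].
eapply near0_imp. 2: apply (near0_and _ _ HE (unif_near_summable _ HG)).
simpl. intros h [E [M SG]].
etransitivity; [apply (lat_sum_ext _ _ E)|].
assert (T1 := summable_scal _ h _ S1). assert (T2 := summable_scal _ (h ^ 2) _ S2).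
assert (TG := summable_scal _ (h ^ 3) _ SG).
assert (T01 := summable_plus _ _ _ _ S0 T1). assert (T012 := summable_plus _ _ _ _ T01 T2).
etransitivity; [exact (lat_sum_plus _ _ _ _ T012 TG)|].
etransitivity; [apply (f_equal2 Cplus); [exact (lat_sum_plus _ _ _ _ T01 T2)|reflexivity]|].
etransitivity; [apply (f_equal2 Cplus); [apply (f_equal2 Cplus);
  [exact (lat_sum_plus _ _ _ _ S0 T1)|reflexivity]|reflexivity]|].
rewrite (lat_sum_scal _ _ _ S1), (lat_sum_scal _ _ _ S2), (lat_sum_scal _ _ _ SG). ring.
Qed.

Lemma near0_shift_distance (z : C) : ~ Lat z -> exists k : R, (0 < k)%R /\
  near0 (fun h => forall a b, (k * idx_size a b <= Cmod (z + h - om a b))%R).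
Proof.
intros Hz. destruct (lattice_distance z Hz) as [k [Hk H]].
exists (k / 2)%R. split; [lra|].
eapply near0_imp. 2: apply (near0_lt (k / 2)); lra. simpl. intros h Hh a b.
specialize (H a b). assert (Hi := idx_size_ge_1 a b).
replace (z + h - om a b) with (z - om a b + h) by ring.
assert (T := Cmod_triangle_inv_plus (z - om a b) h). nra.
Qed.

Lemma unif_inv_of_lower (k : R) (F : C -> Z -> Z -> C) : (0 < k)%R ->
  near0 (fun h => forall a b, (k * idx_size a b <= Cmod (F h a b))%R) ->
  unif 1 (fun h a b => / F h a b).
Proof.
intros Hk H. exists (/ k)%R. split. left. apply Rinv_0_lt_compat, Hk.
eapply near0_imp. 2: apply H. simpl. intros h Hh a b.
assert (Hi := idx_size_ge_1 a b).
replace (/ k / (idx_size a b * 1))%R with (/ (k * idx_size a b))%R by (field; lra).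
apply Cmod_inv_le; auto. nra.
Qed.

Lemma unif_inv_shift (z : C) : ~ Lat z -> unif 1 (fun h a b => / (z + h - om a b)).
Proof.
intros Hz. destruct (near0_shift_distance z Hz) as [k [Hk H]].
apply unif_inv_of_lower with k; assumption.
Qed.

Lemma unif_inv_point (z : C) : ~ Lat z -> unif 1 (fun _ a b => / (z - om a b)).
Proof.
intros Hz. destruct (lattice_distance z Hz) as [k [Hk H]].
apply unif_inv_of_lower with k; [exact Hk|]. apply near0_all. auto.
Qed.

Lemma origin_or_not (a b : Z) : (a = 0 /\ b = 0)%Z \/ (a <> 0 \/ b <> 0)%Z.
Proof. lia. Qed.

Lemma unif_inv_om : unif 1 (fun _ a b => / om a b).
Proof.
destruct om_lower as [k [Hk H]].
exists (/ k)%R. split. left. apply Rinv_0_lt_compat, Hk.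
apply near0_all. intros _ a b. assert (Hi := idx_size_ge_1 a b).
replace (/ k / idx_size a b ^ 1)%R with (/ (k * idx_size a b))%R by (field; lra).
destruct (origin_or_not a b) as [[-> ->]|Hab].
- rewrite om_0, Cinv_0, Cmod_0. left. apply Rinv_0_lt_compat. nra.
- apply Cmod_inv_le; auto. nra.
Qed.

(** Drops the one index at which [/ (h - om a b)] blows up as h tends to 0. It is also the shape of
    the filtered sums in the definitions of g2, g3 and wp. *)
Definition punctured (g : Z -> Z -> C) (a b : Z) : C :=
  if (Z.eqb a 0 && Z.eqb b 0)%bool then 0 else g a b.

Lemma punctured_origin (g : Z -> Z -> C) : punctured g 0 0 = 0.
Proof. reflexivity. Qed.

Lemma punctured_off (g : Z -> Z -> C) (a b : Z) :
  (a <> 0 \/ b <> 0)%Z -> punctured g a b = g a b.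
Proof.
intros H. unfold punctured. destruct (Z.eqb_spec a 0), (Z.eqb_spec b 0); simpl; try reflexivity.
lia.
Qed.

Lemma at_origin_origin (c : C) : at_origin c 0 0 = c.
Proof. reflexivity. Qed.

Lemma at_origin_off (c : C) (a b : Z) : (a <> 0 \/ b <> 0)%Z -> at_origin c a b = 0.
Proof.
intros H. unfold at_origin. destruct (Z.eqb_spec a 0), (Z.eqb_spec b 0); simpl; try reflexivity.
lia.
Qed.

Lemma unif_inv_punctured : unif 1 (fun h => punctured (fun a b => / (h - om a b))).
Proof.
destruct om_lower as [k [Hk H]].
exists (/ (k / 2))%R. split. left. apply Rinv_0_lt_compat; lra.
eapply near0_imp. 2: apply (near0_lt (k / 2)); lra. simpl. intros h Hh a b.
assert (Hi := idx_size_ge_1 a b).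
replace (/ (k / 2) / (idx_size a b * 1))%R with (/ (k / 2 * idx_size a b))%R by (field; lra).
destruct (origin_or_not a b) as [[-> ->]|Hab].
- rewrite punctured_origin, Cmod_0. left. apply Rinv_0_lt_compat. nra.
- rewrite punctured_off by exact Hab. apply Cmod_inv_le; [nra|].
  specialize (H a b Hab).
  assert (T := Cmod_triangle_inv (om a b) h). rewrite Cmod_minus_sym in T. nra.
Qed.

Lemma near0_minus_om_neq (z : C) : ~ Lat z ->
  near0 (fun h => forall a b, z + h - om a b <> 0).
Proof.
intros Hz. eapply near0_imp. 2: apply (near0_not_Lat z Hz). simpl. intros h Hh a b E.
apply Hh. exists a, b. apply Ceq_minus. exact E.
Qed.

Lemma minus_om_neq (z : C) (a b : Z) : ~ Lat z -> z - om a b <> 0.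
Proof. intros Hz E. apply Hz. exists a, b. apply Ceq_minus. exact E. Qed.


Lemma unif_minus (k : nat) (F G : C -> Z -> Z -> C) :
  unif k F -> unif k G -> unif k (fun h a b => F h a b - G h a b).
Proof. intros HF HG. apply unif_plus; [|apply unif_opp]; assumption. Qed.

(** * The functions wp, wp'/2 and the zeta combination *)

(** The sum includes the origin, whose term is 1/z^2 because 1/0 = 0; the classical formula writes
    it separately. *)
Definition wpf (z : C) : C :=
  lat_sum (fun a b => (/ (z - om a b)) ^ 2 - (/ om a b) ^ 2).

Definition hpf (z : C) : C := - lat_sum (fun a b => (/ (z - om a b)) ^ 3).

(* zeta(z) + zeta(b) - zeta(z+b): the regularising terms of the three zeta series
   add up to 1/omega, with 1/0 = 0 at the origin. *)
Definition zet (z b : C) : C :=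
  lat_sum (fun m n => / (z - om m n) + / (b - om m n) - / (z + b - om m n) + / om m n).

(** The search leaves the order open and reads it off the factors; [usum] then compares it with the
    order wanted. [at_origin] has every order, so 3 is fixed for it. *)
Ltac uprod := first
  [ apply unif_inv_om
  | apply unif_inv_punctured
  | apply (unif_at_origin 3)
  | apply unif_inv_shift; assumption
  | apply unif_inv_point; assumption
  | eapply unif_pow; uprod
  | eapply unif_scale; [solve [bnd_auto]|uprod]
  | eapply unif_mult; uprod ].

Ltac usum := first
  [ apply unif_minus; usum
  | apply unif_plus; usum
  | apply unif_opp; usum
  | eapply unif_weaken; [|uprod]; simpl; lia ].

(** Off the origin each term becomes a combination of products of three inverses, which shows the
    cubic decay hidden in the difference. *)
Lemma wp_term_split (z : C) (a b : Z) : ~ Lat z ->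
  (/ (z - om a b)) ^ 2 - (/ om a b) ^ 2 = at_origin ((/ z) ^ 2) a b
    + (z * (/ om a b * / (z - om a b) * / (z - om a b))
       - z * (/ om a b * / (z - om a b) * / om a b)).
Proof.
intros Hz. assert (H1 := minus_om_neq z a b Hz).
destruct (origin_or_not a b) as [[-> ->]|Hab].
- rewrite at_origin_origin, om_0, Cinv_0. replace (z - 0) with z by ring. ring.
- rewrite at_origin_off by exact Hab. assert (H2 := om_neq_0 a b Hab). field. auto.
Qed.

Lemma wp_unif (z : C) : ~ Lat z ->
  unif 3 (fun _ a b => (/ (z - om a b)) ^ 2 - (/ om a b) ^ 2).
Proof.
intros Hz. eapply unif_ext.
apply near0_all. intros h a b. symmetry. apply wp_term_split; exact Hz.
usum.
Qed.

Lemma hp_unif (z : C) : ~ Lat z -> unif 3 (fun _ a b => (/ (z - om a b)) ^ 3).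
Proof. intros Hz. usum. Qed.

(** A term of the zeta series is 1/(z - ω) + 1/ω + z/ω^2 = z^2/(ω^2 (z - ω)). The linear corrections
    z/ω^2, b/ω^2, -(z+b)/ω^2 cancel, so three terms of order 3 remain. *)
Lemma zet_term_split (z b : C) (m n : Z) : ~ Lat z -> ~ Lat b -> ~ Lat (z + b) ->
  / (z - om m n) + / (b - om m n) - / (z + b - om m n) + / om m n
  = at_origin (/ z + / b - / (z + b)) m n
    + (z ^ 2 * ((/ om m n) ^ 2 * / (z - om m n))
       + b ^ 2 * ((/ om m n) ^ 2 * / (b - om m n))
       - (z + b) ^ 2 * ((/ om m n) ^ 2 * / (z + b - om m n))).
Proof.
intros Hz Hb Hzb. assert (H1 := minus_om_neq z m n Hz).
assert (H2 := minus_om_neq b m n Hb). assert (H3 := minus_om_neq (z + b) m n Hzb).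
destruct (origin_or_not m n) as [[-> ->]|Hab].
- rewrite at_origin_origin, om_0, Cinv_0.
  replace (z - 0) with z by ring. replace (b - 0) with b by ring.
  replace (z + b - 0) with (z + b) by ring. ring.
- rewrite at_origin_off by exact Hab. assert (H4 := om_neq_0 m n Hab). field. auto.
Qed.

Lemma zet_unif (z b : C) : ~ Lat z -> ~ Lat b -> ~ Lat (z + b) ->
  unif 3 (fun _ m n => / (z - om m n) + / (b - om m n) - / (z + b - om m n) + / om m n).
Proof.
intros Hz Hb Hzb. eapply unif_ext.
apply near0_all. intros h a c. symmetry. apply zet_term_split; assumption.
usum.
Qed.

(** With p = z - ω, the last family is the exact Taylor remainder of 1/(p+h)^2 divided by h^3; every
    product in it has at least five inverse factors. *)
Lemma wp_jet (z : C) : ~ Lat z -> exists a2, jet wpf z (2 * hpf z) a2.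
Proof.
intros Hz. destruct (unif_summable _ (hp_unif z Hz)) as [M HM].
replace (2 * hpf z) with (lat_sum (fun a b => (- (2)) * (/ (z - om a b)) ^ 3)).
2:{ rewrite (lat_sum_scal M) by exact HM. unfold hpf. ring. }
eexists.
apply (lat_sum_jet (fun z a b => (/ (z - om a b)) ^ 2 - (/ om a b) ^ 2) z _
  (fun a b => 3 * (/ (z - om a b)) ^ 4)
  (fun h a b => - (4 * ((/ (z - om a b)) ^ 3 * (/ (z + h - om a b)) ^ 2)
     + (3 * h) * ((/ (z - om a b)) ^ 4 * (/ (z + h - om a b)) ^ 2)))).
- apply wp_unif; exact Hz.
- usum.
- usum.
- usum.
- eapply near0_imp. 2: apply (near0_minus_om_neq z Hz). simpl. intros h Hh a b.
  specialize (Hh a b). assert (H1 := minus_om_neq z a b Hz).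
  generalize (/ om a b). intros i.
  replace (z + h - om a b) with ((z - om a b) + h) in * by ring.
  set (p := z - om a b) in *. field. auto.
Qed.

Lemma hp_jet (z : C) : ~ Lat z -> exists a1 a2, jet hpf z a1 a2.
Proof.
intros Hz. eexists. eexists. apply jet_opp.
apply (lat_sum_jet (fun z a b => (/ (z - om a b)) ^ 3) z
  (fun a b => - (3 * (/ (z - om a b)) ^ 4))
  (fun a b => 6 * (/ (z - om a b)) ^ 5)
  (fun h a b => - (10 * ((/ (z - om a b)) ^ 3 * (/ (z + h - om a b)) ^ 3)
     + (15 * h) * ((/ (z - om a b)) ^ 4 * (/ (z + h - om a b)) ^ 3)
     + (6 * h ^ 2) * ((/ (z - om a b)) ^ 5 * (/ (z + h - om a b)) ^ 3)))).
- apply hp_unif; exact Hz.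
- usum.
- usum.
- usum.
- eapply near0_imp. 2: apply (near0_minus_om_neq z Hz). simpl. intros h Hh a b.
  specialize (Hh a b). assert (H1 := minus_om_neq z a b Hz).
  replace (z + h - om a b) with ((z - om a b) + h) in * by ring.
  set (p := z - om a b) in *. field. auto.
Qed.

Lemma lat_sum_minus (M M' : R) (f g : Z -> Z -> C) :
  summable M f -> summable M' g ->
  lat_sum (fun a b => f a b - g a b) = lat_sum f - lat_sum g.
Proof.
intros H1 H2. assert (H3 := summable_scal _ (- (1)) _ H2).
transitivity (lat_sum (fun a b => f a b + (- (1)) * g a b)).
- apply lat_sum_ext. intros. ring.
- etransitivity. exact (lat_sum_plus _ _ _ _ H1 H3).
  rewrite (lat_sum_scal _ _ _ H2). ring.
Qed.

(** The derivative of zeta is -wp; the regularising terms of the two wp series cancel in the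
    difference. *)
Lemma zet_jet (z b : C) : ~ Lat z -> ~ Lat b -> ~ Lat (z + b) ->
  exists a2, jet (fun x => zet x b) z (wpf (z + b) - wpf z) a2.
Proof.
intros Hz Hb Hzb.
destruct (unif_summable _ (wp_unif z Hz)) as [M HM].
destruct (unif_summable _ (wp_unif (z + b) Hzb)) as [M' HM'].
replace (wpf (z + b) - wpf z)
  with (lat_sum (fun m n => ((/ (z + b - om m n)) ^ 2 - (/ om m n) ^ 2)
     - ((/ (z - om m n)) ^ 2 - (/ om m n) ^ 2))).
2: apply (lat_sum_minus _ _ _ _ HM' HM).
eexists.
apply (lat_sum_jet
  (fun z m n => / (z - om m n) + / (b - om m n) - / (z + b - om m n) + / om m n) z _
  (fun m n => (/ (z - om m n)) ^ 3 - (/ (z + b - om m n)) ^ 3)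
  (fun h m n => - ((/ (z - om m n)) ^ 3 * / (z + h - om m n))
     + (/ (z + b - om m n)) ^ 3 * / (z + b + h - om m n))).
- apply zet_unif; assumption.
- apply unif_minus; apply wp_unif; assumption.
- usum.
- usum.
- eapply near0_imp.
  2: apply (near0_and _ _ (near0_minus_om_neq z Hz) (near0_minus_om_neq (z + b) Hzb)).
  simpl. intros h [Hh Hh'] m n. specialize (Hh m n). specialize (Hh' m n).
  assert (H1 := minus_om_neq z m n Hz). assert (H2 := minus_om_neq (z + b) m n Hzb).
  generalize (/ om m n) (/ (b - om m n)). intros i j.
  replace (z + h + b - om m n) with ((z + b - om m n) + h) in * by ring.
  replace (z + b + h - om m n) with ((z + b - om m n) + h) in * by ring.
  replace (z + h - om m n) with ((z - om m n) + h) in * by ring.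
  set (p := z - om m n) in *. set (q := z + b - om m n) in *. field. auto.
Qed.

(** * Periodicity and parity *)

(** One order short of summable, but enough for periodicity: a telescoping sum over a box leaves 2N
    + 1 boundary differences of size O(1/N^2). *)
Definition order2 (g : Z -> Z -> C) : Prop := unif 2 (fun _ => g).

Lemma order2_bound (g : Z -> Z -> C) : order2 g ->
  exists M : R, (0 <= M)%R /\ forall a b, (Cmod (g a b) <= M / idx_size a b ^ 2)%R.
Proof.
intros [M [HM H]]. exists M. split; [exact HM|].
destruct (near0_ex _ H) as [h [_ Hh]]. exact Hh.
Qed.

Lemma boundary_cv (u : nat -> C) (M : R) : (0 <= M)%R ->
  (forall N, Cmod (u N) <= (2 * INR N + 1) * (2 * (M / (INR N + 1) ^ 2)))%R ->
  Cseq_cv u (RtoC 0).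
Proof.
intros HM H eps He.
destruct (nfloor_ex (4 * M / eps)) as [N HN].
{ apply Rdiv_le_0_compat; lra. }
exists N. intros n Hn. change (Cmod (u n - 0) < eps)%R.
replace (u n - 0) with (u n) by ring.
eapply Rle_lt_trans. apply H.
assert (Hp := pos_INR n). assert (HNn : (INR N <= INR n)%R) by (apply le_INR; exact Hn).
apply Rle_lt_trans with (4 * M / (INR n + 1))%R.
- replace (4 * M / (INR n + 1))%R with ((2 * INR n + 2) * (2 * (M / (INR n + 1) ^ 2)))%R
    by (field; lra).
  apply Rmult_le_compat_r; [|lra].
  assert (0 <= M / (INR n + 1) ^ 2)%R; [|lra].
  apply Rdiv_le_0_compat; [lra|]. apply pow_lt; lra.
- apply Rmult_lt_reg_r with (INR n + 1)%R; [lra|].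
  replace (4 * M / (INR n + 1) * (INR n + 1))%R with (4 * M / eps * eps)%R by (field; lra).
  nra.
Qed.

Lemma edge_bound (M : R) (g : Z -> Z -> C) (N : nat) (a b : Z) : (0 <= M)%R ->
  (forall a b, (Cmod (g a b) <= M / idx_size a b ^ 2)%R) ->
  (Z.of_nat N <= Z.max (Z.abs a) (Z.abs b))%Z ->
  (Cmod (g a b) <= M / (INR N + 1) ^ 2)%R.
Proof.
intros HM H Hab. eapply Rle_trans. apply H. unfold Rdiv.
apply Rmult_le_compat_l; [exact HM|].
assert (Hp := pos_INR N).
apply Rinv_le_contravar. apply pow_lt; lra.
apply pow_incr. split; [lra|]. unfold idx_size. rewrite INR_IZR_INZ.
apply IZR_le in Hab. lra.
Qed.

Lemma lat_sum_telescope_1 (g : Z -> Z -> C) : order2 g ->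
  lat_sum (fun a b => g (a + 1)%Z b - g a b) = 0.
Proof.
intros Hg. destruct (order2_bound g Hg) as [M [HM H]].
apply lat_sum_unique. apply boundary_cv with M; [exact HM|]. intros N.
unfold box_sum. rewrite sum_sym_exchange.
apply sum_sym_Cmod_le. intros b _.
rewrite (sum_sym_telescope (fun a => g a b)).
eapply Rle_trans. apply Cmod_minus_triangle.
assert (H1 := edge_bound M g N (Z.of_nat N + 1) b HM H ltac:(lia)).
assert (H2 := edge_bound M g N (- Z.of_nat N) b HM H ltac:(lia)). lra.
Qed.

Lemma lat_sum_telescope_2 (g : Z -> Z -> C) : order2 g ->
  lat_sum (fun a b => g a (b + 1)%Z - g a b) = 0.
Proof.
intros Hg. destruct (order2_bound g Hg) as [M [HM H]].
apply lat_sum_unique. apply boundary_cv with M; [exact HM|]. intros N.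
unfold box_sum.
apply sum_sym_Cmod_le. intros a _.
rewrite (sum_sym_telescope (g a)).
eapply Rle_trans. apply Cmod_minus_triangle.
assert (H1 := edge_bound M g N a (Z.of_nat N + 1) HM H ltac:(lia)).
assert (H2 := edge_bound M g N a (- Z.of_nat N) HM H ltac:(lia)). lra.
Qed.

(* [g z] is the part of the series which depends on the position of [z] in the
   lattice; translating [z] by a period shifts its index. *)
Lemma lat_sum_translate (t g : C -> Z -> Z -> C) (z : C) :
  (forall a b, g (z + w1) (a + 1)%Z b = g z a b) ->
  (forall a b, g (z + w2) a (b + 1)%Z = g z a b) ->
  (forall w a b, t w a b - t z a b = g w a b - g z a b) ->
  (forall w, Lat w -> unif 3 (fun _ => t (z + w)) /\ order2 (g (z + w))) ->
  lat_sum (t (z + w1)) = lat_sum (t z) /\ lat_sum (t (z + w2)) = lat_sum (t z).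
Proof.
intros E1 E2 Et Hu.
assert (L1 : Lat w1) by (rewrite <- om_1_0; apply Lat_om).
assert (L2 : Lat w2) by (rewrite <- om_0_1; apply Lat_om).
destruct (Hu 0 Lat_0) as [U0 _]. rewrite Cplus_0_r in U0.
destruct (unif_summable _ U0) as [M0 S0].
assert (Hone : forall w, Lat w ->
  lat_sum (fun a b => g (z + w) a b - g z a b) = 0 ->
  lat_sum (t (z + w)) = lat_sum (t z)).
{ intros w Lw H0. destruct (Hu w Lw) as [Uw _]. destruct (unif_summable _ Uw) as [M S].
  apply Ceq_minus. rewrite <- (lat_sum_minus _ _ _ _ S S0), <- H0.
  apply lat_sum_ext. intros a b. apply Et. }
split; (apply Hone; [assumption|]).
- destruct (Hu w1 L1) as [_ G1]. assert (T := lat_sum_telescope_1 _ G1).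
  replace (RtoC 0) with ((- (1)) * 0) by ring. rewrite <- T.
  assert (HS : exists M, summable M (fun a b => g (z + w1) (a + 1)%Z b - g (z + w1) a b)).
  { destruct (Hu w1 L1) as [U1 _]. apply unif_summable.
    apply unif_ext with (fun _ a b => t z a b - t (z + w1) a b).
    - apply near0_all. intros _ a b. rewrite E1.
      replace (t z a b - t (z + w1) a b) with (- (t (z + w1) a b - t z a b)) by ring.
      rewrite Et. ring.
    - apply unif_minus; assumption. }
  destruct HS as [M S]. rewrite <- (lat_sum_scal _ _ _ S).
  apply lat_sum_ext. intros a b. rewrite E1. ring.
- destruct (Hu w2 L2) as [_ G1]. assert (T := lat_sum_telescope_2 _ G1).
  replace (RtoC 0) with ((- (1)) * 0) by ring. rewrite <- T.
  assert (HS : exists M, summable M (fun a b => g (z + w2) a (b + 1)%Z - g (z + w2) a b)).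
  { destruct (Hu w2 L2) as [U1 _]. apply unif_summable.
    apply unif_ext with (fun _ a b => t z a b - t (z + w2) a b).
    - apply near0_all. intros _ a b. rewrite E2.
      replace (t z a b - t (z + w2) a b) with (- (t (z + w2) a b - t z a b)) by ring.
      rewrite Et. ring.
    - apply unif_minus; assumption. }
  destruct HS as [M S]. rewrite <- (lat_sum_scal _ _ _ S).
  apply lat_sum_ext. intros a b. rewrite E2. ring.
Qed.

Lemma periodic_lattice (f : C -> C) (P : C -> Prop) :
  (forall z w, P z -> Lat w -> P (z + w)) ->
  (forall z, P z -> f (z + w1) = f z /\ f (z + w2) = f z) ->
  forall z w, P z -> Lat w -> f (z + w) = f z.
Proof.
intros HP Hf.
assert (Hn : forall w, Lat w -> (forall z, P z -> f (z + w) = f z) ->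
  forall (n : nat) z, P z -> f (z + RtoC (IZR (Z.of_nat n)) * w) = f z).
{ intros w Lw Hw. induction n as [|n IH]; intros z Pz.
  - simpl. f_equal. ring.
  - rewrite Nat2Z.inj_succ, succ_IZR, RtoC_plus.
    replace (z + (RtoC (IZR (Z.of_nat n)) + RtoC 1) * w)
      with ((z + w) + RtoC (IZR (Z.of_nat n)) * w) by ring.
    rewrite IH by (apply HP; assumption). apply Hw; exact Pz. }
assert (HZ : forall w, Lat w -> (forall k, Lat (RtoC (IZR k) * w)) ->
  (forall z, P z -> f (z + w) = f z) ->
  forall (k : Z) z, P z -> f (z + RtoC (IZR k) * w) = f z).
{ intros w Lw Lk Hw k z Pz. destruct (Z_le_gt_dec 0 k) as [Hk|Hk].
  - rewrite <- (Z2Nat.id k Hk). apply Hn; assumption.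
  - rewrite <- (Hn w Lw Hw (Z.to_nat (- k)) (z + RtoC (IZR k) * w)) by (apply HP; auto).
    f_equal. rewrite Z2Nat.id by lia. rewrite opp_IZR, RtoC_opp. ring. }
intros z w Pz [a [b ->]]. unfold om. rewrite Cplus_assoc.
assert (L1 : forall k, Lat (RtoC (IZR k) * w1)).
{ intros k. exists k, 0%Z. unfold om. ring. }
assert (L2 : forall k, Lat (RtoC (IZR k) * w2)).
{ intros k. exists 0%Z, k. unfold om. ring. }
rewrite (HZ w2).
- apply HZ; auto. rewrite <- om_1_0; apply Lat_om. intros; apply Hf; assumption.
- rewrite <- om_0_1; apply Lat_om.
- exact L2.
- intros; apply Hf; assumption.
- apply HP; auto.
Qed.

Lemma om_shift_1 (z : C) (a b : Z) : z + w1 - om (a + 1) b = z - om a b.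
Proof. unfold om. rewrite plus_IZR, RtoC_plus. ring. Qed.

Lemma om_shift_2 (z : C) (a b : Z) : z + w2 - om a (b + 1) = z - om a b.
Proof. unfold om. rewrite plus_IZR, RtoC_plus. ring. Qed.

Lemma wp_periodic (z w : C) : ~ Lat z -> Lat w -> wpf (z + w) = wpf z.
Proof.
intros Hz0 Hw0; refine (periodic_lattice wpf (fun z => ~ Lat z) _ _ z w Hz0 Hw0); clear z w Hz0 Hw0.
- intros; apply not_Lat_plus; assumption.
- intros z Hz.
  apply (lat_sum_translate (fun z a b => (/ (z - om a b)) ^ 2 - (/ om a b) ^ 2)
    (fun z a b => (/ (z - om a b)) ^ 2)).
  + intros a b. rewrite om_shift_1. reflexivity.
  + intros a b. rewrite om_shift_2. reflexivity.
  + intros. ring.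
  + intros w Hw. assert (Hzw := not_Lat_plus _ _ Hz Hw).
    split; [apply wp_unif; exact Hzw|]. unfold order2. usum.
Qed.

Lemma hp_periodic (z w : C) : ~ Lat z -> Lat w -> hpf (z + w) = hpf z.
Proof.
intros Hz0 Hw0; refine (periodic_lattice hpf (fun z => ~ Lat z) _ _ z w Hz0 Hw0); clear z w Hz0 Hw0.
- intros; apply not_Lat_plus; assumption.
- intros z Hz. unfold hpf.
  destruct (lat_sum_translate (fun z a b => (/ (z - om a b)) ^ 3)
    (fun z a b => (/ (z - om a b)) ^ 3) z) as [E1 E2].
  + intros a b. rewrite om_shift_1. reflexivity.
  + intros a b. rewrite om_shift_2. reflexivity.
  + intros. ring.
  + intros w Hw. assert (Hzw := not_Lat_plus _ _ Hz Hw).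
    split; [apply hp_unif; exact Hzw|]. unfold order2. usum.
  + rewrite E1, E2. auto.
Qed.

(** The quasi-periods of zeta(z) and zeta(z+b) cancel. In terms of series, 1/(z - ω) - 1/(z + b - ω)
    = b/((z - ω)(z + b - ω)) has order 2, while its two parts only have order 1. *)
Lemma zet_periodic (b z w : C) : ~ Lat b -> ~ Lat z -> ~ Lat (z + b) -> Lat w ->
  zet (z + w) b = zet z b.
Proof.
intros Hb Hz0 Hzb0 Hw0.
refine (periodic_lattice (fun z => zet z b) (fun z => ~ Lat z /\ ~ Lat (z + b)) _ _ z w
  (conj Hz0 Hzb0) Hw0); clear z w Hz0 Hzb0 Hw0.
- intros x y [H1 H2] H3. split. apply not_Lat_plus; assumption.
  replace (x + y + b) with (x + b + y) by ring. apply not_Lat_plus; assumption.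
- intros z [Hz Hzb].
  apply (lat_sum_translate
    (fun z m n => / (z - om m n) + / (b - om m n) - / (z + b - om m n) + / om m n)
    (fun z m n => / (z - om m n) - / (z + b - om m n))).
  + intros m n. rewrite om_shift_1.
    replace (z + w1 + b) with (z + b + w1) by ring. rewrite om_shift_1. reflexivity.
  + intros m n. rewrite om_shift_2.
    replace (z + w2 + b) with (z + b + w2) by ring. rewrite om_shift_2. reflexivity.
  + intros. ring.
  + intros w Hw. assert (Hzw := not_Lat_plus _ _ Hz Hw).
    assert (Hzbw : ~ Lat (z + w + b)).
    { replace (z + w + b) with (z + b + w) by ring. apply not_Lat_plus; assumption. }
    split; [apply zet_unif; assumption|]. unfold order2.
    apply unif_ext with (fun _ m n => b * (/ (z + w - om m n) * / (z + w + b - om m n))).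
    * apply near0_all. intros _ m n.
      assert (H1 := minus_om_neq _ m n Hzw). assert (H2 := minus_om_neq _ m n Hzbw).
      field. auto.
    * usum.
Qed.

Lemma Cinv_opp (x : C) : / (- x) = - / x.
Proof.
destruct (Ceq_dec x 0) as [->|H].
- replace (- 0) with (RtoC 0) by ring. rewrite Cinv_0. ring.
- field. auto.
Qed.

Lemma wp_even (z : C) : wpf (- z) = wpf z.
Proof.
unfold wpf. rewrite <- lat_sum_opp_index. apply lat_sum_ext. intros a b.
rewrite om_opp. replace (- z - - om a b) with (- (z - om a b)) by ring.
rewrite !Cinv_opp. ring.
Qed.

Lemma hp_odd (z : C) : ~ Lat z -> hpf (- z) = - hpf z.
Proof.
intros Hz. unfold hpf. f_equal. rewrite <- lat_sum_opp_index.
destruct (unif_summable _ (hp_unif z Hz)) as [M HM].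
transitivity (lat_sum (fun a b => (- (1)) * (/ (z - om a b)) ^ 3)).
2: rewrite (lat_sum_scal _ _ _ HM); ring.
apply lat_sum_ext. intros a b.
rewrite om_opp. replace (- z - - om a b) with (- (z - om a b)) by ring.
rewrite Cinv_opp. ring.
Qed.

Lemma zet_sym (z b : C) : zet z b = zet b z.
Proof.
apply lat_sum_ext. intros m n. replace (b + z - om m n) with (z + b - om m n) by ring. ring.
Qed.

(** Zeta is odd. After ω is replaced by -ω in one series, the terms differ by 1/(b - ω) - 1/(b + ω)
    + 2/ω, odd in ω. The reflection exchanges the poles at 0 and at -b, so expansions are made only
    at 0. *)
Lemma zet_reflect (z b : C) : ~ Lat z -> ~ Lat b -> ~ Lat (z + b) ->
  zet (- z - b) b = zet z b.
Proof.
intros Hz Hb Hzb. unfold zet at 2. rewrite <- lat_sum_opp_index.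
assert (Hz' : ~ Lat (- z - b)).
{ replace (- z - b) with (- (z + b)) by ring. apply not_Lat_opp; exact Hzb. }
assert (Hzb' : ~ Lat (- z - b + b)).
{ replace (- z - b + b) with (- z) by ring. apply not_Lat_opp; exact Hz. }
destruct (unif_summable _ (zet_unif _ _ Hz' Hb Hzb')) as [M1 S1].
assert (S2 : exists M, summable M
  (fun a b0 => / (z - om (- a) (- b0)) + / (b - om (- a) (- b0))
     - / (z + b - om (- a) (- b0)) + / om (- a) (- b0))).
{ destruct (unif_summable _ (zet_unif _ _ Hz Hb Hzb)) as [M S]. exists M.
  intros a c. eapply Rle_trans. apply (S (- a)%Z (- c)%Z).
  unfold idx_size. rewrite !Z.abs_opp. lra. }
destruct S2 as [M2 S2].
apply Ceq_minus. unfold zet. rewrite <- (lat_sum_minus _ _ _ _ S1 S2).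
apply lat_sum_odd. intros m n.
rewrite !om_opp. replace (- - om m n) with (om m n) by ring. rewrite !Cinv_opp.
replace (- z - b - - om m n) with (- (z + b - om m n)) by ring.
replace (- z - b + b - - om m n) with (- (z - om m n)) by ring.
replace (- z - b - om m n) with (- (z + b - - om m n)) by ring.
replace (- z - b + b - om m n) with (- (z - - om m n)) by ring.
rewrite !Cinv_opp. ring.
Qed.

(** * Laurent expansions at the origin *)

Definition has_sum (f : Z -> Z -> C) (l : C) : Prop :=
  (exists M, summable M f) /\ lat_sum f = l.

Lemma has_sum_plus (f g : Z -> Z -> C) (k l : C) :
  has_sum f k -> has_sum g l -> has_sum (fun a b => f a b + g a b) (k + l).
Proof.
intros [[M S] <-] [[M' S'] <-]. split.
- eexists. apply (summable_plus _ _ _ _ S S').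
- apply (lat_sum_plus _ _ _ _ S S').
Qed.

Lemma has_sum_scal (c : C) (f : Z -> Z -> C) (l : C) :
  has_sum f l -> has_sum (fun a b => c * f a b) (c * l).
Proof.
intros [[M S] <-]. split.
- eexists. apply (summable_scal _ c _ S).
- apply (lat_sum_scal _ c _ S).
Qed.

Lemma has_sum_at_origin (c : C) : has_sum (at_origin c) c.
Proof. split; [eexists; apply summable_at_origin|apply lat_sum_at_origin]. Qed.

Lemma has_sum_unif (f : Z -> Z -> C) : unif 3 (fun _ => f) -> has_sum f (lat_sum f).
Proof. intros H. split; [apply unif_summable; exact H|reflexivity]. Qed.

Lemma has_sum_inv_om_odd (n : nat) : (3 <= n)%nat -> Nat.Odd n ->
  has_sum (fun a b => (/ om a b) ^ n) 0.
Proof.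
intros Hn [k ->]. split.
- apply unif_summable. eapply unif_weaken. 2: apply unif_pow, unif_inv_om. lia.
- apply lat_sum_odd. intros a b. rewrite om_opp, Cinv_opp.
  generalize (/ om a b). intros i.
  replace (2 * k + 1)%nat with (S (2 * k)) by lia. rewrite !Cpow_S, !Cpow_mult_r.
  replace ((- i) ^ 2) with (i ^ 2) by ring. ring.
Qed.

Definition G4 : C := lat_sum (fun a b => (/ om a b) ^ 4).
Definition G6 : C := lat_sum (fun a b => (/ om a b) ^ 6).
Definition h2 : C := 15 * G4.
Definition h3 : C := 35 * G6.

Lemma has_sum_G4 : has_sum (fun a b => (/ om a b) ^ 4) G4.
Proof. apply has_sum_unif. usum. Qed.

Lemma has_sum_G6 : has_sum (fun a b => (/ om a b) ^ 6) G6.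
Proof. apply has_sum_unif. usum. Qed.

Lemma near0_off_lattice : near0 (fun h => h <> 0 /\ forall a b, h - om a b <> 0).
Proof.
eapply near0_imp. 2: apply near0_Lat_0. simpl. intros h Hh. split.
- apply not_Lat_neq_0; exact Hh.
- intros a b. apply minus_om_neq; exact Hh.
Qed.

(** The depth is dictated by the differential equation: in wp^3 an error is multiplied by h^(-4), so
    h^5 is needed to leave O(h). Likewise h^4 for [hpf], and h^2 for [zet], which is only
    squared. *)
Lemma wp_near0 : exists R, bnd R /\
  near0 (fun h => wpf h = / h ^ 2 + h ^ 2 * (3 * G4 + 5 * G6 * h ^ 2 + h ^ 3 * R h)).
Proof.
(* The remainder of 1/(h - ω)^2 after the terms (n+1) h^n/ω^(n+2) with n <= 4, divided by h^5. *)
set (G := fun h a b => 6 * ((/ om a b) ^ 5 * (punctured (fun a b => / (h - om a b)) a b) ^ 2)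
  - 5 * h * ((/ om a b) ^ 6 * (punctured (fun a b => / (h - om a b)) a b) ^ 2)).
assert (UG : unif 3 G) by (unfold G; usum).
exists (fun h => lat_sum (G h)). split; [apply unif_bnd_lat_sum; exact UG|].
eapply near0_imp. 2: apply (near0_and _ _ (unif_near_summable _ UG) near0_off_lattice).
simpl. intros h [[M SG] [H0 Hh]].
assert (HG : has_sum (G h) (lat_sum (G h))) by (split; [eexists; exact SG|reflexivity]).
assert (A := has_sum_plus _ _ _ _ (has_sum_at_origin ((/ h) ^ 2))
  (has_sum_plus _ _ _ _ (has_sum_scal (2 * h) _ _ (has_sum_inv_om_odd 3 ltac:(lia) ltac:(exists 1%nat; lia)))
  (has_sum_plus _ _ _ _ (has_sum_scal (3 * h ^ 2) _ _ has_sum_G4)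
  (has_sum_plus _ _ _ _ (has_sum_scal (4 * h ^ 3) _ _ (has_sum_inv_om_odd 5 ltac:(lia) ltac:(exists 2%nat; lia)))
  (has_sum_plus _ _ _ _ (has_sum_scal (5 * h ^ 4) _ _ has_sum_G6)
    (has_sum_scal (h ^ 5) _ _ HG)))))).
destruct A as [_ A]. cbv beta in A.
transitivity ((/ h) ^ 2 + (2 * h * 0 + (3 * h ^ 2 * G4 + (4 * h ^ 3 * 0 +
   (5 * h ^ 4 * G6 + h ^ 5 * lat_sum (G h)))))).
2: field; exact H0.
rewrite <- A. apply lat_sum_ext. intros a b. specialize (Hh a b). unfold G.
destruct (origin_or_not a b) as [[-> ->]|Hab].
- rewrite at_origin_origin, punctured_origin, om_0, Cinv_0.
  replace (h - 0) with h by ring. ring.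
- rewrite at_origin_off, punctured_off by exact Hab. assert (H2 := om_neq_0 a b Hab).
  field. auto.
Qed.

Lemma hp_near0 : exists R, bnd R /\
  near0 (fun h => hpf h = - / h ^ 3 + h * (3 * G4 + 10 * G6 * h ^ 2 + h ^ 3 * R h)).
Proof.
set (G := fun h a b => 15 * ((/ om a b) ^ 4 * (punctured (fun a b => / (h - om a b)) a b) ^ 3)
  - 24 * h * ((/ om a b) ^ 5 * (punctured (fun a b => / (h - om a b)) a b) ^ 3)
  + 10 * h ^ 2 * ((/ om a b) ^ 6 * (punctured (fun a b => / (h - om a b)) a b) ^ 3)).
assert (UG : unif 3 G) by (unfold G; usum).
exists (fun h => - lat_sum (G h)). split; [apply bnd_opp, unif_bnd_lat_sum; exact UG|].
eapply near0_imp. 2: apply (near0_and _ _ (unif_near_summable _ UG) near0_off_lattice).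
simpl. intros h [[M SG] [H0 Hh]].
assert (HG : has_sum (G h) (lat_sum (G h))) by (split; [eexists; exact SG|reflexivity]).
assert (A := has_sum_plus _ _ _ _ (has_sum_at_origin ((/ h) ^ 3))
  (has_sum_plus _ _ _ _ (has_sum_scal (- (1)) _ _ (has_sum_inv_om_odd 3 ltac:(lia) ltac:(exists 1%nat; lia)))
  (has_sum_plus _ _ _ _ (has_sum_scal (- (3) * h) _ _ has_sum_G4)
  (has_sum_plus _ _ _ _ (has_sum_scal (- (6) * h ^ 2) _ _ (has_sum_inv_om_odd 5 ltac:(lia) ltac:(exists 2%nat; lia)))
  (has_sum_plus _ _ _ _ (has_sum_scal (- (10) * h ^ 3) _ _ has_sum_G6)
    (has_sum_scal (h ^ 4) _ _ HG)))))).
destruct A as [_ A]. cbv beta in A.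
transitivity (- ((/ h) ^ 3 + (- (1) * 0 + (- (3) * h * G4 + (- (6) * h ^ 2 * 0 +
   (- (10) * h ^ 3 * G6 + h ^ 4 * lat_sum (G h))))))).
2: field; exact H0.
rewrite <- A. unfold hpf. f_equal. apply lat_sum_ext. intros a b. specialize (Hh a b). unfold G.
destruct (origin_or_not a b) as [[-> ->]|Hab].
- rewrite at_origin_origin, punctured_origin, om_0, Cinv_0.
  replace (h - 0) with h by ring. ring.
- rewrite at_origin_off, punctured_off by exact Hab. assert (H2 := om_neq_0 a b Hab).
  field. auto.
Qed.

Lemma zet_near0 (b : C) : ~ Lat b -> exists R, bnd R /\
  near0 (fun h => zet h b = / h + wpf b * h + h ^ 2 * R h).
Proof.
intros Hb.
set (G := fun h m n => (/ om m n) ^ 2 * punctured (fun m n => / (h - om m n)) m n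
  - (/ (b - om m n)) ^ 2 * / (b + h - om m n)).
assert (UG : unif 3 G) by (unfold G; usum).
exists (fun h => lat_sum (G h)). split; [apply unif_bnd_lat_sum; exact UG|].
eapply near0_imp. 2: apply (near0_and _ _ (near0_and _ _ (unif_near_summable _ UG)
  near0_off_lattice) (near0_minus_om_neq b Hb)).
simpl. intros h [[[M SG] [H0 Hh]] Hbh].
assert (HG : has_sum (G h) (lat_sum (G h))) by (split; [eexists; exact SG|reflexivity]).
assert (A := has_sum_plus _ _ _ _ (has_sum_at_origin (/ h))
  (has_sum_plus _ _ _ _ (has_sum_scal h _ _ (has_sum_unif _ (wp_unif b Hb)))
    (has_sum_scal (h ^ 2) _ _ HG))).
destruct A as [_ A]. cbv beta in A.
transitivity (/ h + (h * wpf b + h ^ 2 * lat_sum (G h))).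
2: ring.
unfold wpf.
rewrite <- A. apply lat_sum_ext. intros m n. specialize (Hh m n). specialize (Hbh m n).
unfold G. assert (Hbm := minus_om_neq b m n Hb).
replace (h + b - om m n) with (b - om m n + h) by ring.
replace (b + h - om m n) with (b - om m n + h) in * by ring.
set (q := b - om m n) in *.
destruct (origin_or_not m n) as [[-> ->]|Hab].
- rewrite at_origin_origin, punctured_origin, om_0, Cinv_0.
  replace (h - 0) with h by ring. field. auto.
- rewrite at_origin_off, punctured_off by exact Hab. assert (H2 := om_neq_0 m n Hab).
  field. auto.
Qed.

(** * Addition theorem and differential equation *)

(** F is extended by 0 over its singular set. The bound h G(h) makes the extension continuous there,
    and no expansion is required at its zeros. *)
Lemma elliptic_relation (Sg : C -> Prop) (F : C -> C) :
  (forall z w, Lat w -> Sg z -> Sg (z + w)) ->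
  (forall z w, ~ Sg z -> Lat w -> F (z + w) = F z) ->
  (forall z, ~ Sg z -> near0 (fun h => ~ Sg (z + h))) ->
  (forall z, ~ Sg z -> exists a1 a2, jet F z a1 a2) ->
  (forall z, Sg z -> exists G, bnd G /\
     near0 (fun h => ~ Sg (z + h) /\ F (z + h) = h * G h)) ->
  Sg 0 ->
  forall z, ~ Sg z -> F z = 0.
Proof.
intros HS HF Hopen HJ Hsing HS0.
set (f := fun z => if excluded_middle_informative (Sg z) then RtoC 0 else F z).
assert (f_in : forall z, Sg z -> f z = 0).
{ intros z Hz. unfold f. destruct (excluded_middle_informative (Sg z)); tauto. }
assert (f_out : forall z, ~ Sg z -> f z = F z).
{ intros z Hz. unfold f. destruct (excluded_middle_informative (Sg z)); tauto. }
assert (fJ : forall z, ~ Sg z -> exists a1 a2, jet f z a1 a2).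
{ intros z Hz. destruct (HJ z Hz) as [a1 [a2 J]]. exists a1, a2.
  apply (jet_ext_near F); [symmetry; apply f_out; exact Hz| |exact J].
  eapply near0_imp. 2: apply (Hopen z Hz). simpl. intros h Hh. symmetry. apply f_out; exact Hh. }
intros z Hz. rewrite <- f_out by exact Hz. revert z Hz.
assert (Main : forall z, f z = 0); [|auto].
apply elliptic_zero.
- intros z a b. destruct (classic (Sg z)) as [Hz|Hz].
  + rewrite !f_in; auto. apply HS; auto. apply Lat_om.
  + rewrite !f_out; auto. apply HF; auto. apply Lat_om.
    intro H. apply Hz. replace z with (z + om a b + - om a b) by ring.
    apply HS; [|exact H]. apply Lat_opp, Lat_om.
- intros z. destruct (classic (Sg z)) as [Hz|Hz].
  + destruct (Hsing z Hz) as [G [BG HG]]. intros e He.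
    eapply near0_imp. 2: apply (near0_and _ _ HG (bnd_small G e He BG)).
    simpl. intros h [[H1 H2] H3]. rewrite (f_in z Hz), (f_out _ H1), H2.
    replace (h * G h - 0) with (h * G h) by ring. exact H3.
  + destruct (fJ z Hz) as [a1 [a2 J]]. eapply jet_Ccont; exact J.
- apply f_in; exact HS0.
- intros z. destruct (classic (Sg z)) as [Hz|Hz]; [left; auto|right; auto].
Qed.

Lemma weierstrass (z : C) : ~ Lat z ->
  hpf z ^ 2 = wpf z ^ 3 - h2 * wpf z - h3.
Proof.
intros Hz. apply Ceq_minus. revert z Hz.
apply (elliptic_relation Lat
  (fun z => hpf z ^ 2 - (wpf z ^ 3 - h2 * wpf z - h3))).
- intros. apply Lat_plus; assumption.
- intros z w Hz Hw. rewrite wp_periodic, hp_periodic by assumption. reflexivity.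
- apply near0_not_Lat.
- intros z Hz. destruct (wp_jet z Hz) as [x2 Jx]. destruct (hp_jet z Hz) as [y1 [y2 Jy]].
  eexists. eexists. apply jet_minus.
  + simpl. apply jet_mult; [exact Jy|]. apply jet_mult; [exact Jy|apply jet_const].
  + apply jet_minus; [|apply jet_const]. apply jet_minus.
    * simpl. apply jet_mult; [exact Jx|]. apply jet_mult; [exact Jx|].
      apply jet_mult; [exact Jx|apply jet_const].
    * apply jet_mult; [apply jet_const|exact Jx].
- intros z Hz. destruct wp_near0 as [R [BR HR]]. destruct hp_near0 as [S [BS HS]].
  set (p := fun h => 3 * G4 + 5 * G6 * h ^ 2 + h ^ 3 * R h).
  set (q := fun h => 3 * G4 + 10 * G6 * h ^ 2 + h ^ 3 * S h).
  assert (Bp : bnd p) by (unfold p; bnd_auto).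
  assert (Bq : bnd q) by (unfold q; bnd_auto).
  (* What is left over after division by h: the poles h^(-6) cancel, h^(-2) has coefficient -(6 + 9)
     G4 = -h2 and the constant is -(20 + 15) G6 = -h3, which the other terms of the equation
     compensate. *)
  exists (fun h => - (2 * S h + 3 * R h) + h * (q h ^ 2 - 3 * p h ^ 2)
    - h ^ 5 * p h ^ 3 + 15 * G4 * h * p h).
  split; [bnd_auto|].
  eapply near0_imp. 2: apply (near0_and _ _ (near0_and _ _ HR HS) near0_Lat_0).
  simpl. intros h [[Ex Ey] Hh].
  assert (H0 := not_Lat_neq_0 _ Hh).
  rewrite (Cplus_comm z h). split; [apply not_Lat_plus; assumption|].
  rewrite wp_periodic, hp_periodic by assumption. rewrite Ex, Ey.
  unfold p, q, h2, h3. field. exact H0.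
- apply Lat_0.
Qed.

Definition zdef (b z : C) : C :=
  zet z b * zet z b - wpf z - wpf b - wpf (z + b).

Lemma zdef_jet (b z : C) : ~ Lat b -> ~ Lat z -> ~ Lat (z + b) ->
  exists a2, jet (zdef b) z
    (2 * (zet z b * (wpf (z + b) - wpf z) - hpf z - hpf (z + b))) a2.
Proof.
intros Hb Hz Hzb. destruct (zet_jet z b Hz Hb Hzb) as [t2 Jt].
destruct (wp_jet z Hz) as [x2 Jx].
destruct (wp_jet (z + b) Hzb) as [v2 Jv].
assert (J := jet_minus _ _ _ _ _ _ _ (jet_minus _ _ _ _ _ _ _ (jet_minus _ _ _ _ _ _ _
  (jet_mult _ _ _ _ _ _ _ Jt Jt) Jx) (jet_const (wpf b) z)) (jet_shift _ _ _ _ _ Jv)).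
eexists.
match type of J with jet _ _ ?a _ =>
  replace (2 * (zet z b * (wpf (z + b) - wpf z) - hpf z - hpf (z + b))) with a by ring end.
exact J.
Qed.

Lemma near0_zdef_regular (b z : C) : ~ Lat z -> ~ Lat (z + b) ->
  near0 (fun h => ~ Lat (z + h) /\ ~ Lat (z + h + b)).
Proof.
intros Hz Hzb.
eapply near0_imp. 2: apply (near0_and _ _ (near0_not_Lat z Hz) (near0_not_Lat _ Hzb)).
simpl. intros h [H1 H2]. split; [exact H1|].
replace (z + h + b) with (z + b + h) by ring. exact H2.
Qed.

(** The square of 1/h + wp(b) h contributes h^(-2) + 2 wp(b): the pole cancels that of wp(h), the
    constant cancels wp(b) and the limit of wp(h+b). *)
Lemma zdef_near0 (b : C) : ~ Lat b -> exists G, bnd G /\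
  near0 (fun h => ~ Lat h /\ ~ Lat (h + b) /\ zdef b h = h * G h).
Proof.
intros Hb. destruct wp_near0 as [R [BR HR]]. destruct (zet_near0 b Hb) as [R1 [BR1 HR1]].
destruct (wp_jet b Hb) as [v2 [R3 [BR3 HR3]]].
exists (fun h => 2 * R1 h + h * (wpf b + h * R1 h) ^ 2
  - h * (3 * G4 + 5 * G6 * h ^ 2 + h ^ 3 * R h) - (2 * hpf b + v2 * h + h ^ 2 * R3 h)).
split; [bnd_auto|].
eapply near0_imp. 2: apply (near0_and _ _ (near0_and _ _ HR HR1) (near0_and _ _ HR3
  (near0_and _ _ near0_Lat_0 (near0_not_Lat b Hb)))).
simpl. intros h [[Ex Et] [Ev [H1 H2]]].
assert (H0 := not_Lat_neq_0 _ H1).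
rewrite (Cplus_comm h b). split; [exact H1|split; [exact H2|]].
unfold zdef. rewrite (Cplus_comm h b), Ex, Et, Ev. field. exact H0.
Qed.

Lemma zdef_periodic (b z w : C) : ~ Lat b -> ~ Lat z -> ~ Lat (z + b) -> Lat w ->
  zdef b (z + w) = zdef b z.
Proof.
intros Hb Hz Hzb Hw. unfold zdef. rewrite zet_periodic, wp_periodic by assumption.
replace (z + w + b) with (z + b + w) by ring. rewrite (wp_periodic (z + b)) by assumption.
reflexivity.
Qed.

Lemma zdef_reflect (b z : C) : ~ Lat b -> ~ Lat z -> ~ Lat (z + b) ->
  zdef b (- z - b) = zdef b z.
Proof.
intros Hb Hz Hzb. unfold zdef. rewrite zet_reflect by assumption.
replace (- z - b + b) with (- z) by ring. rewrite wp_even.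
replace (- z - b) with (- (z + b)) by ring. rewrite wp_even. ring.
Qed.

Lemma zdef_zero (b z : C) : ~ Lat b -> ~ Lat z -> ~ Lat (z + b) -> zdef b z = 0.
Proof.
intros Hb Hz Hzb.
assert (Hz' : ~ (Lat z \/ Lat (z + b))) by tauto. clear Hz Hzb. revert z Hz'.
apply elliptic_relation.
- intros z w Hw [H|H]; [left|right].
  + apply Lat_plus; assumption.
  + replace (z + w + b) with (z + b + w) by ring. apply Lat_plus; assumption.
- intros z w Hz Hw. apply zdef_periodic; tauto.
- intros z Hz. eapply near0_imp. 2: apply (near0_zdef_regular b z); tauto.
  simpl. tauto.
- intros z Hz. destruct (zdef_jet b z) as [a2 J]; try tauto. eexists. eexists. exact J.
- intros z [Hz|Hz]; destruct (zdef_near0 b Hb) as [G [BG HG]].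
  + exists G. split; [exact BG|]. eapply near0_imp. 2: apply HG. simpl.
    intros h [H1 [H2 H3]]. split.
    * intros [H|H].
      { revert H. rewrite Cplus_comm. apply not_Lat_plus; assumption. }
      { revert H. replace (z + h + b) with (h + b + z) by ring. apply not_Lat_plus; assumption. }
    * rewrite Cplus_comm, zdef_periodic; assumption.
  + exists (fun h => - G (- h)). split.
    * apply bnd_opp. destruct BG as [K [HK BG]]. exists K. split; [exact HK|].
      apply (near0_opp _ BG).
    * eapply near0_imp. 2: apply (near0_opp _ HG). simpl. intros h [H1 [H2 H3]].
      (* Near a pole congruent to -b the point is the reflection of -h, moved by the lattice vector
         z + b. *)
      assert (E : z + h = - (- h) - b + (z + b)) by ring.
      assert (H4 : ~ Lat (- - h - b)).
      { replace (- - h - b) with (- (- h + b)) by ring. apply not_Lat_opp; exact H2. }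
      assert (H5 : ~ Lat (- - h - b + b)).
      { replace (- - h - b + b) with (- (- h)) by ring. apply not_Lat_opp; exact H1. }
      rewrite E. split.
      { intros [H|H].
        - revert H. apply not_Lat_plus; assumption.
        - revert H. replace (- - h - b + (z + b) + b) with (- - h - b + b + (z + b)) by ring.
          apply not_Lat_plus; assumption. }
      rewrite zdef_periodic by assumption.
      rewrite zdef_reflect by assumption. rewrite H3. ring.
- left. apply Lat_0.
Qed.

Lemma zet_sqr (a b : C) : ~ Lat a -> ~ Lat b -> ~ Lat (a + b) ->
  zet a b ^ 2 = wpf a + wpf b + wpf (a + b).
Proof.
intros Ha Hb Hab. assert (H := zdef_zero b a Hb Ha Hab). unfold zdef in H.
apply Ceq_minus. rewrite <- H. ring.
Qed.

Lemma zet_third (a b : C) : ~ Lat a -> ~ Lat b -> ~ Lat (a + b) ->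
  zet a b * (wpf (a + b) - wpf a) = hpf a + hpf (a + b).
Proof.
intros Ha Hb Hab. destruct (zdef_jet b a Hb Ha Hab) as [a2 J].
apply jet_zero_derivative in J.
- apply Ceq_minus.
  destruct (Ceq_dec (zet a b * (wpf (a + b) - wpf a) - (hpf a + hpf (a + b))) 0) as [E|E];
    [exact E|exfalso].
  apply (Cmult_neq_0 2 _) in E.
  + apply E. rewrite <- J. ring.
  + intro H. apply RtoC_inj in H. lra.
- apply zdef_zero; assumption.
- eapply near0_imp. 2: apply (near0_zdef_regular b a); assumption. simpl.
  intros h [H1 H2]. apply zdef_zero; assumption.
Qed.

(** The difference of [zet_third] for (a, b) and (b, a). It makes [zet a b] minus the slope of the
    chord through the two points. *)
Lemma zet_line (a b : C) : ~ Lat a -> ~ Lat b -> ~ Lat (a + b) ->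
  zet a b * (wpf b - wpf a) = hpf a - hpf b.
Proof.
intros Ha Hb Hab. assert (H1 := zet_third a b Ha Hb Hab).
assert (Hba : ~ Lat (b + a)) by (rewrite Cplus_comm; exact Hab).
assert (H2 := zet_third b a Hb Ha Hba). rewrite zet_sym, (Cplus_comm b a) in H2.
transitivity (zet a b * (wpf (a + b) - wpf a) - zet a b * (wpf (a + b) - wpf b)). ring.
rewrite H1, H2. ring.
Qed.

Lemma wp_addition (a b : C) : ~ Lat a -> ~ Lat b -> ~ Lat (a + b) ->
  (wpf (a + b) + wpf a + wpf b) * (wpf a - wpf b) ^ 2 = (hpf a - hpf b) ^ 2.
Proof.
intros Ha Hb Hab. rewrite <- zet_line by assumption.
replace (wpf (a + b) + wpf a + wpf b) with (zet a b ^ 2).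
ring. rewrite zet_sqr by assumption. ring.
Qed.

(** * Non-degeneracy of the Weierstrass parametrisation *)

Lemma Cmult_integral (x y : C) : x * y = 0 -> x = 0 \/ y = 0.
Proof.
intros H. destruct (Ceq_dec x 0) as [Hx|Hx]; [left; exact Hx|].
destruct (Ceq_dec y 0) as [Hy|Hy]; [right; exact Hy|].
exfalso. exact (Cmult_neq_0 x y Hx Hy H).
Qed.

Lemma Csqr_eq_0 (x : C) : x ^ 2 = 0 -> x = 0.
Proof.
intros H. replace (x ^ 2) with (x * x) in H by ring. destruct (Cmult_integral _ _ H); assumption.
Qed.

Lemma jet_first_order (f : C -> C) (z a1 a2 : C) : jet f z a1 a2 ->
  exists r, bnd r /\ near0 (fun h => f (z + h) = f z + h * r h).
Proof.
intros [r [Br Hr]]. exists (fun h => a1 + a2 * h + h ^ 2 * r h). split; [bnd_auto|].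
eapply near0_imp. 2: apply Hr. simpl. intros h ->. ring.
Qed.

Lemma wp_large (B : R) : near0 (fun d => (B < Cmod (wpf d))%R).
Proof.
destruct wp_near0 as [R [BR HR]].
assert (Bs : near0 (fun h => (Cmod (h * (h * (3 * G4 + 5 * G6 * h ^ 2 + h ^ 3 * R h))) < 1)%R)).
{ apply bnd_small; [lra|bnd_auto]. }
assert (HB := Rabs_pos B). assert (HB2 := Rle_abs B).
assert (Hd : (0 < / (Rabs B + 1))%R) by (apply Rinv_0_lt_compat; lra).
eapply near0_imp. 2: apply (near0_and _ _ (near0_and _ _ HR Bs) (near0_and _ _ near0_neq
  (near0_and _ _ (near0_lt _ Hd) (near0_lt 1 ltac:(lra))))).
intros h [[E H1] [H0 [H2 H3]]]. cbv beta in *. rewrite E.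
replace (h ^ 2 * (3 * G4 + 5 * G6 * h ^ 2 + h ^ 3 * R h))
  with (h * (h * (3 * G4 + 5 * G6 * h ^ 2 + h ^ 3 * R h))) by ring.
eapply Rlt_le_trans; [|apply Cmod_triangle_inv_plus].
assert (Hp : (0 < Cmod h)%R) by (apply Cmod_gt_0; exact H0).
assert (Hi : (Rabs B + 1 < / Cmod h)%R).
{ rewrite <- (Rinv_inv (Rabs B + 1)). apply Rinv_lt_contravar; [nra|exact H2]. }
rewrite Cmod_inv by (apply Cpow_nz; exact H0). rewrite Cmod_pow.
assert (Hi2 : (/ Cmod h <= / Cmod h ^ 2)%R).
{ apply Rinv_le_contravar. apply pow_lt; exact Hp. nra. }
lra.
Qed.

Lemma wp_neq_near0 (e : C) : near0 (fun d => wpf d <> e).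
Proof.
eapply near0_imp. 2: apply (wp_large (Cmod e)). simpl. intros d H E. rewrite E in H. lra.
Qed.

(** Where y = 0, x is a root of the fixed cubic and hence bounded, whereas wp is large near its
    pole. *)
Lemma hp_neq_0_near0 : near0 (fun d => hpf d <> 0).
Proof.
eapply near0_imp. 2: apply (near0_and _ _ near0_Lat_0 (wp_large (1 + Cmod h2 + Cmod h3))).
simpl. intros d [Hd HL] E. assert (W := weierstrass d Hd). rewrite E in W.
set (x := wpf d) in *.
assert (Ex : x ^ 3 = h2 * x + h3).
{ transitivity (0 ^ 2 + (h2 * x + h3)); [rewrite W|]; ring. }
assert (M : (Cmod x ^ 3 <= Cmod h2 * Cmod x + Cmod h3)%R).
{ rewrite <- Cmod_pow, Ex. eapply Rle_trans. apply Cmod_triangle. rewrite Cmod_mult. lra. }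
generalize (Cmod_ge_0 h2) (Cmod_ge_0 h3). intros P2 P3.
set (t := Cmod x) in *.
assert (1 <= t)%R by lra. assert (t <= t ^ 2)%R by nra.
assert (Cmod h3 <= Cmod h3 * t)%R by nra.
assert (t ^ 3 = t ^ 2 * t)%R by ring.
assert (t ^ 2 * t <= (Cmod h2 + Cmod h3) * t)%R by lra.
assert (t ^ 2 <= Cmod h2 + Cmod h3)%R by (apply Rmult_le_reg_r with t; lra). lra.
Qed.

(* On a singular cubic the addition theorem makes the value at the singular point
   invariant under all small translations; walking to the pole is absurd. *)
Lemma no_singular_point (a : C) : ~ Lat a -> hpf a = 0 -> h2 = 3 * wpf a ^ 2 -> False.
Proof.
intros Ha Hy E2. set (e := wpf a) in *.
assert (E3 : h3 = - (2) * e ^ 3).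
{ assert (W := weierstrass a Ha). rewrite Hy, E2 in W. fold e in W.
  transitivity (e ^ 3 - 3 * e ^ 2 * e - (e ^ 3 - 3 * e ^ 2 * e - h3)). ring.
  rewrite <- W. ring. }
destruct (near0_and _ _ near0_Lat_0 (wp_neq_near0 e)) as [r [Hr Hn]].
destruct (nfloor_ex (Cmod a / r)) as [K HK].
{ apply Rdiv_le_0_compat; [apply Cmod_ge_0|exact Hr]. }
assert (HKp := pos_INR K).
(* K + 1 steps of length d lead from a exactly to 0, and K is large enough for d to be small. *)
set (d := - (RtoC (/ (INR K + 1)) * a)).
assert (Hd0 : d <> 0).
{ unfold d. intro H. apply (Cmult_neq_0 (RtoC (/ (INR K + 1))) a).
  - intro H1. apply RtoC_inj in H1. assert (0 < / (INR K + 1))%R by (apply Rinv_0_lt_compat; lra). lra.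
  - apply not_Lat_neq_0; exact Ha.
  - transitivity (- - (RtoC (/ (INR K + 1)) * a)); [ring|rewrite H; ring]. }
assert (Hdr : (Cmod d < r)%R).
{ unfold d. rewrite Cmod_opp, Cmod_mult, Cmod_R, Rabs_pos_eq.
  2: left; apply Rinv_0_lt_compat; lra.
  apply Rmult_lt_reg_l with (INR K + 1)%R; [lra|].
  replace ((INR K + 1) * (/ (INR K + 1) * Cmod a))%R with (Cmod a / r * r)%R by (field; lra).
  apply Rmult_lt_compat_r; lra. }
destruct (Hn d Hd0 Hdr) as [HdL Hdx].
assert (Hstep : forall z, ~ Lat z /\ wpf z = e -> ~ Lat (z + d) /\ wpf (z + d) = e).
{ intros z [Hz Ez].
  assert (Hzd : ~ Lat (z + d)).
  { intro HL. apply Hdx. rewrite <- wp_even, <- Ez.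
    replace z with (- d + (z + d)) by ring.
    symmetry. apply wp_periodic; [|exact HL]. apply not_Lat_opp; exact HdL. }
  split; [exact Hzd|].
  assert (Hyz : hpf z = 0).
  { apply Csqr_eq_0. rewrite (weierstrass z Hz), Ez, E2, E3. ring. }
  assert (A := wp_addition z d Hz HdL Hzd). rewrite Ez, Hyz in A.
  assert (W := weierstrass d HdL). rewrite E2, E3 in W.
  set (x := wpf d) in *.
  (* The cubic is now (x - e)^2 (x + 2e), so the addition theorem with y(z) = 0 reads (x(z+d) + e +
     x)(e - x)^2 = (x + 2e)(e - x)^2. *)
  assert (A2 : (wpf (z + d) - e) * (e - x) ^ 2 = 0).
  { transitivity ((wpf (z + d) + e + x) * (e - x) ^ 2 - (x + 2 * e) * (e - x) ^ 2). ring.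
    rewrite A. replace ((0 - hpf d) ^ 2) with (hpf d ^ 2) by ring. rewrite W. ring. }
  destruct (Cmult_integral _ _ A2) as [H|H].
  - apply Ceq_minus; exact H.
  - exfalso. apply Hdx. symmetry. apply Ceq_minus. apply Csqr_eq_0; exact H. }
assert (Hall : forall k : nat, ~ Lat (a + RtoC (INR k) * d) /\ wpf (a + RtoC (INR k) * d) = e).
{ induction k as [|k IH].
  - simpl INR. replace (a + RtoC 0 * d) with a by ring. split; [exact Ha|reflexivity].
  - rewrite S_INR, RtoC_plus.
    replace (a + (RtoC (INR k) + RtoC 1) * d) with (a + RtoC (INR k) * d + d) by ring.
    apply Hstep; exact IH. }
destruct (Hall (S K)) as [H _]. apply H.
replace (a + RtoC (INR (S K)) * d) with (RtoC 0); [apply Lat_0|].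
assert (E1 : RtoC (INR (S K)) * RtoC (/ (INR K + 1)) = 1).
{ rewrite <- RtoC_mult, S_INR, Rinv_r; [reflexivity|lra]. }
unfold d. transitivity (a - RtoC (INR (S K)) * RtoC (/ (INR K + 1)) * a); [rewrite E1|]; ring.
Qed.

(** Equal values at a + d and a - d make the two addition formulas agree, whence y(a) = 0; inserting
    this in one of them gives (h2 - 3e^2)(x(d) - e) = 0, a singular point. *)
Lemma wp_not_locally_constant (a : C) : ~ Lat a ->
  near0 (fun h => wpf (a + h) = wpf a) -> False.
Proof.
intros Ha HN. set (e := wpf a) in *.
destruct (near0_ex _ (near0_and _ _ (near0_and _ _ HN (near0_opp _ HN))
  (near0_and _ _ (near0_and _ _ (near0_not_Lat a Ha) (near0_opp _ (near0_not_Lat a Ha)))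
    (near0_and _ _ near0_Lat_0 (near0_and _ _ hp_neq_0_near0 (wp_neq_near0 e))))))
  as [d [_ [[E1 E2] [[L1 L2] [Ld [Hyd Hxd]]]]]].
assert (A1 := wp_addition a d Ha Ld L1).
assert (A2 := wp_addition a (- d) Ha (not_Lat_opp _ Ld) L2).
rewrite E1 in A1. rewrite E2, wp_even, hp_odd in A2 by exact Ld. fold e in A1, A2.
assert (Ey : hpf a = 0).
{ assert (H : (4 * hpf d) * hpf a = 0).
  { transitivity ((hpf a - - hpf d) ^ 2 - (hpf a - hpf d) ^ 2). ring.
    rewrite <- A1, <- A2. ring. }
  destruct (Cmult_integral _ _ H) as [H1|H1]; [|exact H1]. exfalso.
  destruct (Cmult_integral _ _ H1) as [H3|H3]; [apply RtoC_inj in H3; lra|auto]. }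
apply (no_singular_point a Ha Ey). fold e.
assert (Wa := weierstrass a Ha). assert (Wd := weierstrass d Ld).
rewrite Ey in Wa, A1. fold e in Wa. set (x := wpf d) in *.
assert (H : (h2 - 3 * e ^ 2) * (x - e) = 0).
{ assert (Eh : h3 = e ^ 3 - h2 * e).
  { transitivity (e ^ 3 - h2 * e - (e ^ 3 - h2 * e - h3)). ring. rewrite <- Wa. ring. }
  rewrite Eh in Wd.
  transitivity ((e + e + x) * (e - x) ^ 2 - (x ^ 3 - h2 * x - (e ^ 3 - h2 * e))). ring.
  rewrite <- Wd, A1. ring. }
destruct (Cmult_integral _ _ H) as [H1|H1].
- apply Ceq_minus; exact H1.
- exfalso. apply Hxd. apply Ceq_minus; exact H1.
Qed.

(** Equal abscissas force y(a) = y(b) = 0 through both addition formulas, so a and b obey the same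
    formula when -a + d is added. The results wp(d) and wp(b - a + d) differ for small d, one being
    near the pole; hence wp(-a + d) = wp(a), and wp would be locally constant. *)
Lemma wp_injective (a b : C) : ~ Lat a -> ~ Lat b -> ~ Lat (a + b) -> ~ Lat (b - a) ->
  wpf a <> wpf b.
Proof.
intros Ha Hb Hab Hba E.
assert (Hab' : ~ Lat (a + - b)).
{ replace (a + - b) with (- (b - a)) by ring. apply not_Lat_opp; exact Hba. }
assert (A1 := wp_addition a b Ha Hb Hab).
assert (A2 := wp_addition a (- b) Ha (not_Lat_opp _ Hb) Hab').
rewrite wp_even, hp_odd in A2 by exact Hb. rewrite <- E in A1, A2.
set (e := wpf a) in *.
assert (B1 : hpf a - hpf b = 0) by (apply Csqr_eq_0; rewrite <- A1; ring).
assert (B2 : hpf a - - hpf b = 0) by (apply Csqr_eq_0; rewrite <- A2; ring).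
assert (Hya : hpf a = 0).
{ assert (H : 2 * hpf a = 0).
  { transitivity ((hpf a - hpf b) + (hpf a - - hpf b)). ring. rewrite B1, B2. ring. }
  destruct (Cmult_integral _ _ H) as [H1|H1]; [apply RtoC_inj in H1; lra|exact H1]. }
assert (Hyb : hpf b = 0).
{ transitivity (hpf a - (hpf a - hpf b)). ring. rewrite B1, Hya. ring. }
apply (wp_not_locally_constant (- a) (not_Lat_opp _ Ha)).
destruct (wp_jet (b - a) Hba) as [t2 J]. apply jet_Ccont in J.
eapply near0_imp. 2: apply (near0_and _ _ (near0_and _ _ (J 1%R ltac:(lra))
  (wp_large (Cmod (wpf (b - a)) + 1))) (near0_and _ _ near0_Lat_0
  (near0_and _ _ (near0_not_Lat _ (not_Lat_opp _ Ha)) (near0_not_Lat _ Hba)))).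
simpl. intros d [[H1 H2] [Ld [Lc Lbc]]].
rewrite wp_even. fold e.
assert (Ld' : ~ Lat (a + (- a + d))) by (replace (a + (- a + d)) with d by ring; exact Ld).
assert (Lbc' : ~ Lat (b + (- a + d))).
{ replace (b + (- a + d)) with (b - a + d) by ring. exact Lbc. }
assert (D1 := wp_addition a (- a + d) Ha Lc Ld').
assert (D2 := wp_addition b (- a + d) Hb Lc Lbc').
replace (a + (- a + d)) with d in D1 by ring.
replace (b + (- a + d)) with (b - a + d) in D2 by ring.
rewrite <- E in D2. rewrite Hya in D1. rewrite Hyb in D2. fold e in D1, D2.
set (c := wpf (- a + d)) in *.
assert (H : (wpf d - wpf (b - a + d)) * (e - c) ^ 2 = 0).
{ transitivity ((wpf d + e + c) * (e - c) ^ 2 - (wpf (b - a + d) + e + c) * (e - c) ^ 2).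
  ring. rewrite D1, D2. ring. }
destruct (Cmult_integral _ _ H) as [H3|H3].
- exfalso. apply Ceq_minus in H3. rewrite H3 in H2.
  assert (T := Cmod_triangle_inv (wpf (b - a + d)) (wpf (b - a))). lra.
- symmetry. apply Ceq_minus. apply Csqr_eq_0. exact H3.
Qed.

(** Replaces passage to the limit in a quotient: if V were nonzero, the second factor would not
    vanish for small h, and wp would be locally constant. *)
Lemma near_limit_factor (a V : C) (g : C -> C) : ~ Lat a -> bnd g ->
  near0 (fun h => (wpf (a + h) - wpf a) * (V + h * g h) = 0) -> V = 0.
Proof.
intros Ha Bg HN. destruct (Ceq_dec V 0) as [E|E]; [exact E|exfalso].
apply (wp_not_locally_constant a Ha).
assert (Hp : (0 < Cmod V)%R) by (apply Cmod_gt_0; exact E).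
eapply near0_imp. 2: apply (near0_and _ _ HN (bnd_small g _ Hp Bg)).
simpl. intros h [H1 H2].
destruct (Cmult_integral _ _ H1) as [H|H]; [apply Ceq_minus; exact H|exfalso].
assert (T := Cmod_triangle_inv_plus V (h * g h)). rewrite H, Cmod_0 in T. lra.
Qed.

(** If y(a) = 0, adding a and a + h, dividing by wp(a + h) - wp(a) and letting h tend to 0 gives 3
    wp(a)^2 = h2, a singular point. That 2a is off the lattice keeps wp(2a + h) bounded. *)
Lemma hp_neq_0 (a : C) : ~ Lat a -> ~ Lat (a + a) -> hpf a <> 0.
Proof.
intros Ha Haa Hy. set (e := wpf a).
assert (Wa := weierstrass a Ha). rewrite Hy in Wa. fold e in Wa.
assert (E3 : h3 = e ^ 3 - h2 * e).
{ transitivity (e ^ 3 - h2 * e - (e ^ 3 - h2 * e - h3)). ring. rewrite <- Wa. ring. }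
apply (no_singular_point a Ha Hy). fold e. symmetry. apply Ceq_minus.
destruct (wp_jet a Ha) as [a2 J]. apply jet_first_order in J. destruct J as [r [Br Hr]].
destruct (wp_jet (a + a) Haa) as [b2 J]. apply jet_first_order in J. destruct J as [s [Bs Hs]].
apply (near_limit_factor a _ (fun h => 3 * e * r h + h * r h ^ 2
  - (wpf (a + a) + h * s h + 2 * e + h * r h) * r h) Ha).
- bnd_auto.
- eapply near0_imp. 2: apply (near0_and _ _ (near0_and _ _ Hr Hs)
    (near0_and _ _ (near0_not_Lat a Ha) (near0_not_Lat _ Haa))).
  simpl. intros h [[E1 E2] [L1 L2]].
  assert (L3 : ~ Lat (a + (a + h))) by (rewrite Cplus_assoc; exact L2).
  assert (A := wp_addition a (a + h) Ha L1 L3). rewrite Cplus_assoc in A.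
  assert (W := weierstrass (a + h) L1). rewrite E1, E3 in W. rewrite E1, E2, Hy in A.
  rewrite E1. fold e in A, W |- *.
  transitivity ((hpf (a + h)) ^ 2 - (0 - hpf (a + h)) ^ 2).
  2: ring.
  rewrite <- A, W. ring.
Qed.

(** The chord through a + h and a becomes the tangent: [zet_line] is multiplied by the sum of the
    ordinates, their squares are replaced by the curve equation, and the difference of abscissas is
    cancelled. *)
Lemma zet_duplication (a : C) : ~ Lat a -> ~ Lat (a + a) ->
  zet a a * (2 * hpf a) = - (3 * wpf a ^ 2 - h2).
Proof.
intros Ha Haa. apply Ceq_minus. set (e := wpf a). set (y := hpf a).
destruct (wp_jet a Ha) as [a2 J]. apply jet_first_order in J. destruct J as [r [Br Hr]].
destruct (hp_jet a Ha) as [c1 [c2 J]]. apply jet_first_order in J. destruct J as [q [Bq Hq]].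
destruct (zet_jet a a Ha Ha Haa) as [b2 J]. apply jet_first_order in J. destruct J as [s [Bs Hs]].
apply (near_limit_factor a _ (fun h => zet a a * q h + s h * (2 * y + h * q h)
  + 3 * e * r h + h * r h ^ 2) Ha).
- bnd_auto.
- eapply near0_imp. 2: apply (near0_and _ _ (near0_and _ _ Hr (near0_and _ _ Hq Hs))
    (near0_and _ _ (near0_not_Lat a Ha) (near0_not_Lat _ Haa))).
  simpl. intros h [[E1 [E2 E3]] [L1 L2]].
  assert (L3 : ~ Lat (a + h + a)) by (replace (a + h + a) with (a + a + h) by ring; exact L2).
  assert (A := zet_line (a + h) a L1 Ha L3).
  assert (W := weierstrass (a + h) L1). assert (Wa := weierstrass a Ha).
  rewrite E1 in A, W |- *. rewrite E2 in A, W. rewrite E3 in A. fold e y in A, W, Wa |- *.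
  set (Y := y + h * q h) in *. set (Z := zet a a + h * s h) in *.
  transitivity ((Y ^ 2 - y ^ 2) - (y + Y) * (Z * (e - (e + h * r h)))
     - ((Y ^ 2 - y ^ 2) - (y + Y) * (Y - y))).
  2: rewrite A; ring.
  rewrite W at 1. rewrite Wa at 1. unfold Y, Z. ring.
Qed.

(** * Torsion points *)

Lemma mult_Lat (u : C) (n k : nat) :
  Lat (RtoC (INR n) * u) -> Lat (RtoC (INR (k * n)) * u).
Proof.
intros H. induction k as [|k IH].
- simpl. rewrite Cmult_0_l. apply Lat_0.
- replace (S k * n)%nat with (n + k * n)%nat by lia.
  rewrite plus_INR, RtoC_plus, Cmult_plus_distr_r. apply Lat_plus; assumption.
Qed.

(** Oddness and periodicity give y(u) = 0, so x(u) is a root of the monic cubic. Order 2 has to be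
    separate because the sequence [W] is studied with y nonzero. *)
Lemma integral_two_torsion (u : C) : ~ Lat u -> Lat (u + u) -> integral_A h2 h3 (wpf u).
Proof.
intros Hu Huu.
assert (E : hpf u = - hpf u).
{ rewrite <- (hp_odd u Hu). rewrite <- (hp_periodic (- u) (u + u) (not_Lat_opp _ Hu) Huu).
  f_equal. ring. }
assert (E0 : hpf u = 0).
{ assert (H : 2 * hpf u = 0) by (transitivity (hpf u + hpf u); [ring|rewrite E at 1; ring]).
  destruct (Cmult_integral _ _ H) as [H1|H1]; [apply RtoC_inj in H1; lra|exact H1]. }
assert (W0 := weierstrass u Hu). rewrite E0 in W0.
replace (wpf u) with (RtoC (IZR 1) * wpf u) by ring.
apply (leading_zero_integral _ _ _ _ 3); [lia|].
exists (RtoC (IZR (-1)) * h2 * wpf u ^ 1 + RtoC (IZR (-1)) * h3 * wpf u ^ 0). split.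
- apply polyval_plus; apply polyval_term; try lia; apply InA_int_mult; [apply InA_e2|apply InA_e3].
- change (IZR (-1)) with (- (1))%R. rewrite RtoC_opp.
  transitivity (0 ^ 2); [ring|]. rewrite W0. ring.
Qed.

(** Exactness of the order places every ku with 0 < k < m off the lattice, which supplies the
    hypotheses on the abstract sequence for m >= 3. *)
Lemma integral_exact_order (u : C) (m : nat) : ~ Lat u -> (1 <= m)%nat ->
  Lat (RtoC (INR m) * u) ->
  (forall k, (1 <= k < m)%nat -> ~ Lat (RtoC (INR k) * u)) ->
  integral_A h2 h3 (RtoC (IZR (Z.of_nat m)) * wpf u) /\
  (forall j, m = (2 * j)%nat -> integral_A h2 h3 (RtoC (IZR (Z.of_nat j)) * wpf u)).
Proof.
intros Hu Hm HmL Hk.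
set (pt := fun n => RtoC (INR n) * u).
assert (Epl : forall i j, pt (i + j)%nat = pt i + pt j).
{ intros i j. unfold pt. rewrite plus_INR, RtoC_plus. ring. }
assert (Emi : forall i j, (j <= i)%nat -> pt (i - j)%nat = pt i - pt j).
{ intros i j Hij. unfold pt. rewrite minus_INR, RtoC_minus by exact Hij. ring. }
assert (E1 : pt 1%nat = u) by (unfold pt; simpl; ring).
assert (Hpt : forall k, (1 <= k < m)%nat -> ~ Lat (pt k)) by exact Hk.
destruct (Nat.eq_dec m 1) as [->|Hm1].
{ exfalso. apply Hu. rewrite <- E1. exact HmL. }
destruct (Nat.eq_dec m 2) as [->|Hm2].
{ assert (I : integral_A h2 h3 (wpf u)).
  { apply integral_two_torsion; [exact Hu|].
    rewrite <- E1, <- Epl. exact HmL. }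
  split; [apply integral_int_mult; exact I|].
  intros j Hj. apply integral_int_mult; exact I. }
assert (Ha : ~ Lat (u + u)) by (rewrite <- E1, <- Epl; apply Hpt; lia).
assert (E2 : pt 2%nat = u + u) by (rewrite <- E1, <- Epl; reflexivity).
set (xs := fun n => wpf (pt n)).
assert (Ex : xs 1%nat = wpf u) by (unfold xs; rewrite E1; reflexivity).
assert (Hdist : forall i j, (1 <= j < i)%nat -> (i + j < m)%nat -> xs i <> xs j).
{ intros i j Hij Hs. unfold xs. apply not_eq_sym.
  apply wp_injective; [apply Hpt; lia|apply Hpt; lia| |].
  - rewrite <- Epl. apply Hpt. lia.
  - rewrite <- Emi by lia. apply Hpt. lia. }
assert (Hlast : xs (m - 1)%nat = xs 1%nat).
{ unfold xs. rewrite Emi, E1 by lia. replace (pt m - u) with (- u + pt m) by ring.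
  rewrite wp_periodic; [apply wp_even|apply not_Lat_opp; exact Hu|exact HmL]. }
assert (Hbi : forall i j X, (1 <= j < i)%nat -> (i + j < m)%nat ->
  (X - xs (i + j)%nat) * (X - xs (i - j)%nat) * (xs i - xs j) ^ 2
  = biquad h2 h3 (xs i) (xs j) X).
{ intros i j X Hij Hs.
  assert (Hi : ~ Lat (pt i)) by (apply Hpt; lia).
  assert (Hj : ~ Lat (pt j)) by (apply Hpt; lia).
  apply (biquad_roots _ _ _ _ (hpf (pt i)) (hpf (pt j))).
  - apply Hdist; assumption.
  - apply weierstrass; exact Hi.
  - apply weierstrass; exact Hj.
  - unfold xs. rewrite Epl. apply wp_addition; try assumption.
    rewrite <- Epl. apply Hpt. lia.
  - unfold xs. rewrite Emi by lia.
    assert (Hn : ~ Lat (pt i + - pt j)).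
    { change (~ Lat (pt i - pt j)). rewrite <- Emi by lia. apply Hpt. lia. }
    assert (A := wp_addition (pt i) (- pt j) Hi (not_Lat_opp _ Hj) Hn).
    rewrite wp_even, hp_odd in A by exact Hj.
    change (pt i - pt j) with (pt i + - pt j). rewrite A. ring. }
assert (Hcurve : hpf u ^ 2 = xs 1%nat ^ 3 - h2 * xs 1%nat - h3).
{ rewrite Ex. apply weierstrass; exact Hu. }
assert (Hy : hpf u <> 0) by (apply hp_neq_0; assumption).
assert (Ht : zet u u * (2 * hpf u) = - (3 * xs 1%nat ^ 2 - h2)).
{ rewrite Ex. apply zet_duplication; assumption. }
assert (Hd : xs 2%nat + 2 * xs 1%nat = zet u u ^ 2).
{ rewrite zet_sqr by assumption. rewrite Ex. unfold xs. rewrite E2. ring. }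
assert (Htr : (4 <= m)%nat -> (xs 3%nat + xs 2%nat + xs 1%nat) * (xs 2%nat - xs 1%nat) ^ 2
  = (zet u u * (xs 2%nat - xs 1%nat) - hpf u - hpf u) ^ 2).
{ intros H4. assert (T := zet_third u u Hu Hu Ha).
  assert (H3 : pt 3%nat = u + u + u).
  { change 3%nat with (2 + 1)%nat. rewrite Epl, E1, E2. reflexivity. }
  assert (L3 : ~ Lat (u + u + u)) by (rewrite <- H3; apply Hpt; lia).
  rewrite Ex. unfold xs. rewrite H3, E2, T, (wp_addition (u + u) u Ha Hu L3). ring. }
rewrite <- Ex. destruct (Nat.Even_or_Odd m) as [[i Ei]|[i Ei]].
- assert (I := torsion_integral_even h2 h3 (hpf u) (zet u u) xs m ltac:(lia)
    Hy Hcurve Hdist Hlast Hbi Ht Hd Htr i Ei).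
  split.
  + rewrite Ei. replace (Z.of_nat (2 * i)) with (2 * Z.of_nat i)%Z by lia.
    rewrite mult_IZR, RtoC_mult, <- Cmult_assoc. apply integral_int_mult; exact I.
  + intros j Hj. replace j with i by lia. exact I.
- split.
  + rewrite Ei. replace (Z.of_nat (2 * i + 1)) with (2 * Z.of_nat i + 1)%Z by lia.
    exact (torsion_integral_odd h2 h3 (hpf u) (zet u u) xs m ltac:(lia)
      Hy Hcurve Hdist Hlast Hbi Ht Hd Htr i Ei).
  + intros j Hj. lia.
Qed.

Lemma exact_order (u : C) (m : nat) : (1 <= m)%nat -> Lat (RtoC (INR m) * u) ->
  exists n q, (1 <= n)%nat /\ m = (q * n)%nat /\ Lat (RtoC (INR n) * u) /\
    forall k, (1 <= k < n)%nat -> ~ Lat (RtoC (INR k) * u).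
Proof.
intros Hm HL.
assert (Hmin : exists n, (1 <= n)%nat /\ Lat (RtoC (INR n) * u) /\
    forall k, (1 <= k < n)%nat -> ~ Lat (RtoC (INR k) * u)).
{ revert Hm HL. induction m as [m IH] using lt_wf_ind. intros Hm HL.
  destruct (classic (exists k, (1 <= k < m)%nat /\ Lat (RtoC (INR k) * u))) as [[k [Hk Hk2]]|Hno].
  - apply (IH k); [lia|lia|exact Hk2].
  - exists m. split; [exact Hm|split; [exact HL|]]. intros k Hk H. apply Hno. exists k. auto. }
destruct Hmin as [n [Hn [Ln Hk]]].
exists n, (m / n)%nat. split; [exact Hn|]. split; [|split; assumption].
assert (D := Nat.div_mod_eq m n). assert (R := Nat.mod_upper_bound m n ltac:(lia)).
destruct (Nat.eq_dec (m mod n) 0) as [E|E]; [lia|exfalso].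
apply (Hk (m mod n)%nat); [lia|].
replace (RtoC (INR (m mod n)) * u) with (RtoC (INR m) * u - RtoC (INR ((m / n) * n)) * u).
- apply Lat_minus; [exact HL|]. apply mult_Lat; exact Ln.
- rewrite D at 1. rewrite plus_INR, RtoC_plus, (Nat.mul_comm n). ring.
Qed.

Lemma torsion_integral (u : C) (m : nat) : ~ Lat u -> (1 <= m)%nat ->
  Lat (RtoC (INR m) * u) ->
  integral_A h2 h3 (RtoC (INR m) * wpf u) /\
  (Nat.Even m -> integral_A h2 h3 (RtoC (INR (m / 2)) * wpf u)).
Proof.
intros Hu Hm HL. destruct (exact_order u m Hm HL) as [n [q [Hn [Em [Ln Hk]]]]].
destruct (integral_exact_order u n Hu Hn Ln Hk) as [I1 I2].
assert (Hmul : forall a b, integral_A h2 h3 (RtoC (IZR (Z.of_nat a)) * wpf u) ->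
  integral_A h2 h3 (RtoC (INR (b * a)) * wpf u)).
{ intros a b H. rewrite INR_IZR_INZ, Nat2Z.inj_mul, mult_IZR, RtoC_mult, <- Cmult_assoc.
  apply integral_int_mult; exact H. }
split.
- rewrite Em. apply Hmul; exact I1.
- intros [h Hh]. replace (m / 2)%nat with h.
  2: rewrite Hh, Nat.mul_comm, Nat.div_mul; lia.
  (* With m = qn even, m/2 is q (n/2) when n is even and (q/2) n when n is odd, in both cases a
     multiple of an integer already treated. *)
  destruct (Nat.Even_or_Odd n) as [[j Hj]|[j Hj]].
  + replace h with (q * j)%nat by nia. apply Hmul, I2; exact Hj.
  + destruct (Nat.Even_or_Odd q) as [[i Hi]|[i Hi]].
    * replace h with (i * n)%nat by nia. apply Hmul; exact I1.
    * exfalso. nia.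
Qed.

(** * Comparison with the partial sums *)

Definition lsum (l : list C) : C := Csum_list l.

Lemma lsum_cons (c : C) (l : list C) : lsum (c :: l) = c + lsum l.
Proof. reflexivity. Qed.

Lemma lsum_app (l l' : list C) :
  lsum (l ++ l') = lsum l + lsum l'.
Proof.
induction l as [|c l IH].
- change (lsum l' = RtoC 0 + lsum l'). ring.
- rewrite <- app_comm_cons, !lsum_cons, IH. ring.
Qed.

Lemma lsum_filter {T : Type} (P : T -> bool) (F : T -> C) (l : list T) :
  lsum (map F (filter P l)) = lsum (map (fun p => if P p then F p else RtoC 0) l).
Proof.
induction l as [|p l IH]; [reflexivity|]. cbn [filter map].
rewrite lsum_cons, <- IH. destruct (P p).
- cbn [map]. apply lsum_cons.
- rewrite Cplus_0_l. reflexivity.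
Qed.

Lemma lsum_prod (G : Z * Z -> C) (l l' : list Z) :
  lsum (map G (list_prod l l'))
  = lsum (map (fun a => lsum (map (fun b => G (a, b)) l')) l).
Proof.
induction l as [|a l IH]; [reflexivity|]. cbn [list_prod map].
rewrite map_app, lsum_app, lsum_cons, IH, map_map. reflexivity.
Qed.

Lemma lsum_seq (g : nat -> C) (n : nat) : lsum (map g (seq 0 n)) = csum g n.
Proof.
induction n as [|n IH]; [reflexivity|].
rewrite seq_S, map_app, lsum_app, IH, csum_S. cbn [map Nat.add].
rewrite lsum_cons. change (csum g n + (g n + RtoC 0) = csum g n + g n). ring.
Qed.

Lemma lsum_Zrange (g : Z -> C) (N : nat) :
  lsum (map g (Zrange N)) = sum_sym g N.
Proof.
unfold Zrange. rewrite map_map, lsum_seq.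
induction N as [|N IH].
- change (RtoC 0 + g 0%Z = g 0%Z). ring.
- replace (2 * S N + 1)%nat with (S (S (2 * N + 1))) by lia.
  rewrite csum_S, csum_shift. cbn [sum_sym]. rewrite <- IH.
  rewrite (csum_ext _ (fun k => g (Z.of_nat k - Z.of_nat N)%Z)).
  + replace (Z.of_nat (S (2 * N + 1)) - Z.of_nat (S N))%Z with (Z.of_nat (S N)) by lia.
    replace (Z.of_nat 0 - Z.of_nat (S N))%Z with (- Z.of_nat (S N))%Z by lia. ring.
  + intros i _. f_equal. lia.
Qed.

Lemma lat_partial_sum_box (f : C -> C) (N : nat) :
  lat_partial_sum w1 w2 f N = box_sum (punctured (fun a b => f (om a b))) N.
Proof.
unfold lat_partial_sum.
match goal with |- Csum_list ?l = ?r => change (lsum l = r) end.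
rewrite lsum_filter, lsum_prod, lsum_Zrange.
unfold box_sum. apply sum_sym_ext. intros a _. rewrite lsum_Zrange.
apply sum_sym_ext. intros b _. unfold punctured. cbn [fst snd].
destruct (Z.eqb a 0 && Z.eqb b 0)%bool; reflexivity.
Qed.

Lemma Cinv_pow (z : C) (n : nat) : / z ^ S n = (/ z) ^ S n.
Proof.
destruct (Ceq_dec z 0) as [->|H].
- rewrite !Cpow_S, Cinv_0, !Cmult_0_l. apply Cinv_0.
- rewrite Cpow_inv by exact H. reflexivity.
Qed.

Lemma g2_value (g : C) : is_g2 w1 w2 g -> g = 60 * G4.
Proof.
intros H. apply (Cseq_cv_unique _ _ _ H).
destruct (proj1 has_sum_G4) as [M S].
eapply Cseq_cv_ext. 2: apply Cseq_cv_scal, (lat_sum_correct M _ S).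
intros N. apply (f_equal (Cmult (RtoC 60))). rewrite lat_partial_sum_box.
apply box_sum_ext. intros a b. destruct (origin_or_not a b) as [[-> ->]|Hab].
- rewrite punctured_origin, om_0, Cinv_0. ring.
- rewrite punctured_off by exact Hab. symmetry. apply Cinv_pow.
Qed.

Lemma g3_value (g : C) : is_g3 w1 w2 g -> g = 140 * G6.
Proof.
intros H. apply (Cseq_cv_unique _ _ _ H).
destruct (proj1 has_sum_G6) as [M S].
eapply Cseq_cv_ext. 2: apply Cseq_cv_scal, (lat_sum_correct M _ S).
intros N. apply (f_equal (Cmult (RtoC 140))). rewrite lat_partial_sum_box.
apply box_sum_ext. intros a b. destruct (origin_or_not a b) as [[-> ->]|Hab].
- rewrite punctured_origin, om_0, Cinv_0. ring.
- rewrite punctured_off by exact Hab. symmetry. apply Cinv_pow.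
Qed.

Lemma wp_value (u p : C) : ~ Lat u -> is_wp w1 w2 u p -> p = wpf u.
Proof.
intros Hu H. apply (Cseq_cv_unique _ _ _ H).
destruct (unif_summable _ (wp_unif u Hu)) as [M S].
eapply Cseq_cv_ext. 2: apply (lat_sum_correct M _ S).
intros N. rewrite lat_partial_sum_box.
(* The isolated term 1/u^2 of the definition is put back at the origin index. *)
transitivity (box_sum (at_origin (/ u ^ 2)) N
  + box_sum (punctured (fun a b => / (u - om a b) ^ 2 - / om a b ^ 2)) N).
- rewrite <- box_sum_plus. apply box_sum_ext. intros a b.
  destruct (origin_or_not a b) as [[-> ->]|Hab].
  + rewrite punctured_origin, at_origin_origin, om_0, Cinv_0, (Cinv_pow u 1).
    replace (u - 0) with u by ring. ring.
  + rewrite punctured_off, at_origin_off, (Cinv_pow _ 1), (Cinv_pow _ 1) by exact Hab. ring.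
- rewrite box_sum_at_origin. reflexivity.
Qed.

End Lattice.

End Development.

Theorem mainTheorem17 (w1 w2 g2 g3 u p : Cx) (m : nat) :
  lattice_basis w1 w2 ->
  is_g2 w1 w2 g2 ->
  is_g3 w1 w2 g3 ->
  (m > 0)%nat ->
  ~ in_lattice w1 w2 u ->
  in_lattice w1 w2 (Cmul (RtoC (INR m)) u) ->
  is_wp w1 w2 u p ->
  integral_over_Z_h2h3 (Cdiv g2 (RtoC 4)) (Cdiv g3 (RtoC 4))
    (Cmul (RtoC (INR m)) p) /\
  (Nat.Even m ->
   integral_over_Z_h2h3 (Cdiv g2 (RtoC 4)) (Cdiv g3 (RtoC 4))
     (Cmul (RtoC (INR (Nat.div m 2))) p)).
Proof.
intros Hb H2 H3 Hm Hu Hmu Hp.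
rewrite (wp_value w1 w2 Hb u p Hu Hp), (g2_value w1 w2 Hb g2 H2), (g3_value w1 w2 Hb g3 H3).
assert (E2 : Cdiv (60 * G4 w1 w2)%C (RtoC 4) = h2 w1 w2).
{ change ((60 * G4 w1 w2 / 4)%C = h2 w1 w2). unfold h2. field. }
assert (E3 : Cdiv (140 * G6 w1 w2)%C (RtoC 4) = h3 w1 w2).
{ change ((140 * G6 w1 w2 / 4)%C = h3 w1 w2). unfold h3. field. }
rewrite E2, E3.
exact (torsion_integral w1 w2 Hb u m Hu Hm Hmu).
Qed.
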